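(* Let $w_1,w_2,w_3\in(-\infty,1)\setminus\{0\}$, $W=(w_1,w_2,w_3)$, $\Sigma=\mathbb{P}^1\setminus\{0,1,\infty\}$ with universal cover $\widetilde\Sigma$, and let $\xi_W$ be the trinoid potential. Let $\Phi$ be a solution on $\widetilde\Sigma$ of $d\Phi=\Phi\xi_W$, with $\Phi(p,\lambda)$ holomorphic and invertible in $\lambda\in\mathbb{C}^*$ for some base point $p\in\widetilde\Sigma$, and let $M_1(\lambda),M_2(\lambda),M_3(\lambda)$ be its monodromies around $0,1,\infty$. If $n_j=\tfrac12(1-\sqrt{1-w_j})$ satisfy \[ |n_1|+|n_2|+|n_3|\le 1,\quad |n_i|\le|n_j|+|n_k|,\quad |w_i|\le|w_j|+|w_k|\quad(\{i,j,k\}=\{1,2,3\}),\tag{$\ast$} \] then there is a finite set $S\subset\mathbb{S}^1$ such that for every $\lambda\in\mathbb{S}^1\setminus S$ the set $\{M_1(\lambda),M_2(\lambda),M_3(\lambda)\}$ is nondegenerate and simultaneously unitarizable. Conversely, if such a finite set $S$ exists, then the inequalities $(\ast)$ hold.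
   Context: The trinoid potential is the $\lambda$-dependent $\mathfrak{sl}_2(\mathbb{C})$-valued meromorphic 1-form on $\mathbb{P}^1$ \[ \xi_W=\begin{pmatrix}0&\lambda^{-1}dz\\ (\lambda-1)^2Q_W/dz&0\end{pmatrix},\qquad Q_W=\frac{w_3z^2-(w_1-w_2+w_3)z+w_1}{16z^2(z-1)^2}\,dz^2, \] so $Q_W$ has double poles at $0,1,\infty$ with quadratic residues $w_1/16,w_2/16,w_3/16$. The monodromy of $\Phi$ along a deck transformation $\tau$ is $M(\tau)=(\Phi\circ\tau)\Phi^{-1}$; the monodromy around a puncture is that of the deck transformation corresponding to a loop winding once around it. A finite set $\{M_j\}\subset\mathrm{GL}_2(\mathbb{C})$ is simultaneously unitarizable if some $C\in\mathrm{GL}_2(\mathbb{C})$ has $CM_jC^{-1}\in\mathrm{U}_2$ for all $j$, and nondegenerate if $M_iM_j\ne M_jM_i$ for some $i\ne j$. *)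

(* Defs.v *)
From Stdlib Require Import Reals List.
From Coquelicot Require Import Coquelicot.
Open Scope R_scope.

Record M2 := mkM2 { m11 : C; m12 : C; m21 : C; m22 : C }.

Definition M2id : M2 := mkM2 1%C 0%C 0%C 1%C.

Definition M2mul (A B : M2) : M2 :=
  mkM2 (m11 A * m11 B + m12 A * m21 B)%C (m11 A * m12 B + m12 A * m22 B)%C
       (m21 A * m11 B + m22 A * m21 B)%C (m21 A * m12 B + m22 A * m22 B)%C.

Definition M2scal (c : C) (A : M2) : M2 :=
  mkM2 (c * m11 A)%C (c * m12 A)%C (c * m21 A)%C (c * m22 A)%C.

Definition M2det (A : M2) : C := (m11 A * m22 A - m12 A * m21 A)%C.

(** inverse (meaningful when det <> 0) *)
Definition M2inv (A : M2) : M2 :=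
  M2scal (/ M2det A)%C (mkM2 (m22 A) (- m12 A)%C (- m21 A)%C (m11 A)).

Definition M2adj (A : M2) : M2 :=
  mkM2 (Cconj (m11 A)) (Cconj (m21 A)) (Cconj (m12 A)) (Cconj (m22 A)).

Definition unitary (U : M2) : Prop := M2mul U (M2adj U) = M2id.

Definition simult_unitarizable (A B D : M2) : Prop :=
  exists P : M2, M2det P <> 0%C /\
    unitary (M2mul (M2mul P A) (M2inv P)) /\
    unitary (M2mul (M2mul P B) (M2inv P)) /\
    unitary (M2mul (M2mul P D) (M2inv P)).

Definition nondegenerate (A B D : M2) : Prop :=
  M2mul A B <> M2mul B A \/ M2mul A D <> M2mul D A \/ M2mul B D <> M2mul D B.

(** The trinoid potential xi_W = A(z) dz, with
    Q_W/dz^2 = (w3 z^2 - (w1-w2+w3) z + w1) / (16 z^2 (z-1)^2). *)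
Definition QW (w1 w2 w3 : R) (z : C) : C :=
  ((RtoC w3 * z * z - RtoC (w1 - w2 + w3) * z + RtoC w1)
   / (RtoC 16 * z * z * (z - 1) * (z - 1)))%C.

Definition trinoid_A (w1 w2 w3 : R) (lam z : C) : M2 :=
  mkM2 0%C (/ lam)%C ((lam - 1) * (lam - 1) * QW w1 w2 w3 z)%C 0%C.

Definition Cexpi (theta : R) : C := (cos theta, sin theta).

Definition circ (c v : C) (t : R) : C := (c + v * Cexpi (2 * PI * t))%C.
Definition dcirc (v : C) (t : R) : C :=
  (Ci * RtoC (2 * PI) * v * Cexpi (2 * PI * t))%C.

(** Base point z0 = 1/2 + (3/4) i of Sigma = P^1 \ {0,1,oo}, and three
    loops based at z0, each winding once (positively) around exactly one
    puncture: gamma1 around 0, gamma2 around 1, gamma3 around both 0 and 1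
    (i.e. once around oo). *)
Definition z0 : C := (1/2, 3/4).
Definition ctr0 : C := 0%C.
Definition ctr1 : C := 1%C.
Definition ctrInf : C := RtoC (1/2).
Definition v_of (c : C) : C := (z0 - c)%C.

(** Y : R -> M2 solves d/dt Y = Y * A(gamma(t)) * gamma'(t) along the loop
    circ c (v_of c), i.e. Y = Phi o (lift of gamma), where dPhi = Phi xi_W. *)
Definition solves_along (w1 w2 w3 : R) (lam : C) (c : C) (Y : R -> M2) : Prop :=
  forall t : R,
    let D := M2scal (dcirc (v_of c) t)
               (M2mul (Y t) (trinoid_A w1 w2 w3 lam (circ c (v_of c) t))) in
    @is_derive R_AbsRing C_R_NormedModule (fun s => m11 (Y s)) t (m11 D) /\
    @is_derive R_AbsRing C_R_NormedModule (fun s => m12 (Y s)) t (m12 D) /\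
    @is_derive R_AbsRing C_R_NormedModule (fun s => m21 (Y s)) t (m21 D) /\
    @is_derive R_AbsRing C_R_NormedModule (fun s => m22 (Y s)) t (m22 D).

Definition holo_Cstar (F : C -> M2) : Prop :=
  forall lam : C, lam <> 0%C ->
    @ex_derive C_AbsRing C_NormedModule (fun l => m11 (F l)) lam /\
    @ex_derive C_AbsRing C_NormedModule (fun l => m12 (F l)) lam /\
    @ex_derive C_AbsRing C_NormedModule (fun l => m21 (F l)) lam /\
    @ex_derive C_AbsRing C_NormedModule (fun l => m22 (F l)) lam.

Definition nW (w : R) : R := (1 - sqrt (1 - w)) / 2.

Definition trinoid_ineqs (w1 w2 w3 : R) : Prop :=
  let n1 := Rabs (nW w1) in let n2 := Rabs (nW w2) in let n3 := Rabs (nW w3) in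
  n1 + n2 + n3 <= 1 /\
  n1 <= n2 + n3 /\ n2 <= n1 + n3 /\ n3 <= n1 + n2 /\
  Rabs w1 <= Rabs w2 + Rabs w3 /\ Rabs w2 <= Rabs w1 + Rabs w3 /\
  Rabs w3 <= Rabs w1 + Rabs w2.

(* Main.v *)
Require Import Defs.
From Stdlib Require Import Reals Lra Lia Psatz List.
From Coquelicot Require Import Coquelicot.
Open Scope R_scope.

(** For |lam| = 1 put s = (1 - Re lam) / 2. Rescaling the first column turns d Phi = Phi xi_W into
    X' = X [[0, 1], [q, 0]] with q = -(s/4) (w1/z^2 + w2/(z-1)^2 + (w3-w1-w2)/(z(z-1))), so only the
    monodromy T1, T2, T3 of this Fuchsian equation at real s in [0, 1] matters.
    Parallel transport is homotopy invariant: for a straight-line homotopy H_u, the matrix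
    T_u (I + (H_u' - H_u) [[0, 1], [q, 0]]) solves the equation along H_u' up to an error O((u - u')^2),
    so subdividing the homotopy makes the total error vanish.
    All three loops pass through z0 and its conjugate, and comparing arcs gives T3 = T1 T2.
    Deforming the loops to circles of radius tending to 0 or infinity gives tr Tj = 2 cos(2 pi nu_j) with
    nu_j = (1 - sqrt(1 - s wj)) / 2.
    A pair in SL(2, C) with real half-traces x, y in [-1, 1] and half-trace z of the product is
    unitarizable and noncommuting iff 1 - x^2 - y^2 - z^2 + 2xyz > 0, and for these traces that quantity is
    the product 4 sin pi(m1+m2+m3) sin pi(-m1+m2+m3) sin pi(m1-m2+m3) sin pi(m1+m2-m3), mj = |nu_j|.
    The signs of the factors as s runs through (0, 1) are governed by the inequalities at s = 1 (for the n_j)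
    and at s -> 0 (for the w_j). *)

(** * Linear differential equations *)

(** For |lam| = 1 the factor (lam - 1)^2 / lam equals -4 s, a real number; hence the exponents and
    the three traces are real there, and unitarizability becomes a sign condition on one real
    function of s. Another choice of Phi conjugates the three monodromies simultaneously, so only
    invariants of the triple matter. The number nu_j is a root of the indicial equation nu (nu - 1)
    = - s wj / 4 at its puncture. Frobenius series are avoided: on a very small or very large circle
    the rescaled system has nearly constant coefficients. As the third loop surrounds both finite
    punctures, the relation reads T3 = T1 T2 instead of T1 T2 T3 = I. For the direct implication S =
    {1, -1} suffices: s = 0, where q vanishes, and s = 1, where the n_j may satisfy an equality. In
    the converse a finite S is used only through density: every subinterval of [0, 1] contains an s
    with positive product, so an open interval on which the product is not positive gives a
    contradiction. *)

Lemma deriv_nonneg_increasing (F dF : R -> R) (a b : R) : a <= b ->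
  (forall x, a <= x <= b -> is_derive F x (dF x)) ->
  (forall x, a <= x <= b -> 0 <= dF x) -> F a <= F b.
Proof.
  intros Hab HF Hpos.
  destruct (MVT_gen F a b dF) as [c [Hc E]].
  - rewrite Rmin_left, Rmax_right by lra. intros x Hx; apply HF; lra.
  - rewrite Rmin_left, Rmax_right by lra. intros x Hx.
    apply derivable_continuous_pt. exists (dF x).
    apply is_derive_Reals, HF; lra.
  - rewrite Rmin_left, Rmax_right in Hc by lra.
    pose proof (Hpos c Hc). nra.
Qed.

(** The derivative of f(t) exp(-K t) is nonpositive. *)
Lemma gronwall (f df : R -> R) (K : R) :
  (forall t, 0 <= t <= 1 -> is_derive f t (df t)) ->
  (forall t, 0 <= t <= 1 -> df t <= K * f t) ->
  forall t, 0 <= t <= 1 -> f t <= f 0 * exp (K * t).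
Proof.
  intros Hd Hle t Ht.
  assert (H : - (f 0 * exp (- K * 0)) <= - (f t * exp (- K * t))).
  { apply (deriv_nonneg_increasing (fun x => - (f x * exp (- K * x)))
             (fun x => (K * f x - df x) * exp (- K * x))); [lra| |].
    - intros x Hx. assert (Hf : is_derive f x (df x)) by (apply Hd; lra).
      auto_derive; [exists (df x); exact Hf|].
      replace (Derive (fun y : R => f y) x) with (df x) by (symmetry; exact (is_derive_unique _ _ _ Hf)). ring.
    - intros x Hx. apply Rmult_le_pos; [|left; apply exp_pos].
      specialize (Hle x ltac:(lra)); lra. }
  rewrite Rmult_0_r, exp_0 in H.
  assert (E : exp (- K * t) * exp (K * t) = 1).
  { rewrite <- exp_plus. replace (- K * t + K * t) with 0 by ring. apply exp_0. }
  pose proof (exp_pos (K * t)).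
  replace (f t) with (f t * exp (- K * t) * exp (K * t)) by (rewrite Rmult_assoc, E; ring).
  apply Rmult_le_compat_r; lra.
Qed.

(** Integration gains a factor 1/a in the norm weighted by exp(a |t|); a large a replaces the usual
    smallness of the time interval. In [key], [sg] chooses the direction of time and [sf] the sign
    of F. *)
Lemma exp_growth_bound (F dF : R -> R) (M a : R) : 0 < a ->
  F 0 = 0 -> (forall t, is_derive F t (dF t)) ->
  (forall t, Rabs (dF t) <= M * exp (a * Rabs t)) ->
  forall t, Rabs (F t) <= M / a * exp (a * Rabs t).
Proof.
  intros Ha F0 HF HB.
  assert (HM : 0 <= M).
  { pose proof (HB 0) as H. rewrite Rabs_R0, Rmult_0_r, exp_0 in H.
    pose proof (Rabs_pos (dF 0)); lra. }
  assert (HMa : 0 <= M / a) by (apply Rdiv_le_0_compat; lra).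
  assert (key : forall sg sf t, (sg = 1 \/ sg = -1) -> (sf = 1 \/ sf = -1) -> 0 <= t ->
     sf * F (sg * t) <= M / a * exp (a * t)).
  { intros sg sf t Hg Hf Ht.
    assert (H : M / a * exp (a * 0) - sf * F (sg * 0) <= M / a * exp (a * t) - sf * F (sg * t)).
    { apply (deriv_nonneg_increasing (fun x => M / a * exp (a * x) - sf * F (sg * x))
               (fun x => M * exp (a * x) - sf * sg * dF (sg * x))); [lra| |].
      - intros x Hx. pose proof (HF (sg * x)) as HFx.
        auto_derive; [exists (dF (sg * x)); exact HFx|].
        replace (Derive (fun y : R => F y) (sg * x)) with (dF (sg * x)) by (symmetry; exact (is_derive_unique _ _ _ HFx)). field. lra.
      - intros x Hx. pose proof (HB (sg * x)) as H.
        replace (Rabs (sg * x)) with x in H.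
        2:{ rewrite Rabs_mult, (Rabs_pos_eq x) by lra.
            destruct Hg; subst; [rewrite Rabs_R1|rewrite (Rabs_left (-1)) by lra]; ring. }
        pose proof (Rle_abs (dF (sg * x))). pose proof (Rle_abs (- dF (sg * x))) as H'.
        rewrite Rabs_Ropp in H'.
        destruct Hg; destruct Hf; subst; lra. }
    rewrite !Rmult_0_r, exp_0, F0 in H. lra. }
  intros t. destruct (Rle_dec 0 t) as [Ht|Ht].
  - rewrite (Rabs_pos_eq t) by lra. apply Rabs_le.
    pose proof (key 1 1 t ltac:(lra) ltac:(lra) Ht).
    pose proof (key 1 (-1) t ltac:(lra) ltac:(lra) Ht).
    rewrite !Rmult_1_l in *. lra.
  - rewrite (Rabs_left t) by lra. apply Rabs_le.
    pose proof (key (-1) 1 (-t) ltac:(lra) ltac:(lra) ltac:(lra)) as H1.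
    pose proof (key (-1) (-1) (-t) ltac:(lra) ltac:(lra) ltac:(lra)) as H2.
    replace (-1 * - t) with t in H1, H2 by ring. lra.
Qed.

(** * Picard iteration for a linear system on the whole line *)

Section Picard.
Variables (L : nat -> nat -> R -> R) (K : R) (x0 : nat -> R).
Hypothesis Lcont : forall i j t, continuous (L i j) t.
Hypothesis Lbound : forall i j t, Rabs (L i j t) <= K.
Hypothesis Kpos : 0 < K.

(** The bound 3 of [sum_f_R0] is inclusive: there are four real unknowns, the real and imaginary
    parts of the two entries of a row. *)
Definition apply_L (f : nat -> R -> R) (i : nat) (t : R) : R :=
  sum_f_R0 (fun j => L i j t * f j t) 3.

Fixpoint picard_term (k : nat) : nat -> R -> R :=
  match k with
  | O => fun i _ => x0 i
  | S k' => fun i t => RInt (apply_L (picard_term k') i) 0 t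
  end.

Lemma apply_L_continuous f i : (forall j t, continuous (f j) t) ->
  forall t, continuous (apply_L f i) t.
Proof.
  intros Hf t. unfold apply_L. simpl.
  apply (continuous_plus (V := R_NormedModule));
    [apply (continuous_plus (V := R_NormedModule)); [apply (continuous_plus (V := R_NormedModule))|]|];
    apply (continuous_mult (K := R_AbsRing)); auto.
Qed.

Lemma RInt_derive_continuous (f : R -> R) : (forall t, continuous f t) ->
  forall t, is_derive (fun t => RInt f 0 t) t (f t).
Proof.
  intros Hf t. apply (is_derive_RInt f (fun t => RInt f 0 t) 0 t); [|apply Hf].
  exists (mkposreal 1 Rlt_0_1). intros y _. apply (RInt_correct (V := R_CompleteNormedModule)).
  apply (ex_RInt_continuous (V := R_CompleteNormedModule)). intros; apply Hf.
Qed.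

Lemma picard_term_continuous k : forall i t, continuous (picard_term k i) t.
Proof.
  induction k; intros i t; simpl.
  - apply continuous_const.
  - apply (ex_derive_continuous (V := R_NormedModule)). eexists. apply RInt_derive_continuous.
    apply apply_L_continuous. auto.
Qed.

Lemma picard_term_derive k i t :
  is_derive (picard_term (S k) i) t (apply_L (picard_term k) i t).
Proof. apply RInt_derive_continuous, apply_L_continuous, picard_term_continuous. Qed.

Lemma apply_L_bound f i t M : (forall j, Rabs (f j t) <= M) ->
  Rabs (apply_L f i t) <= 4 * K * M.
Proof.
  intros H. unfold apply_L. simpl.
  assert (P : forall j, Rabs (L i j t * f j t) <= K * M).
  { intros j. rewrite Rabs_mult. apply Rmult_le_compat; auto using Rabs_pos. }
  pose proof (P 0%nat); pose proof (P 1%nat); pose proof (P 2%nat); pose proof (P 3%nat).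
  eapply Rle_trans; [apply Rabs_triang|]. eapply Rle_trans.
  { apply Rplus_le_compat_r. eapply Rle_trans; [apply Rabs_triang|].
    apply Rplus_le_compat_r. apply Rabs_triang. } lra.
Qed.

Variable c0 : R.
Hypothesis x0_bound : forall i, Rabs (x0 i) <= c0.

(** Applying L costs at most 4 K, and integrating against the weight exp(8 K |t|) gains 1 / (8 K);
    hence the ratio 1/2, valid for all t. *)
Lemma picard_term_bound k : forall i t,
  Rabs (picard_term k i t) <= c0 * (1/2) ^ k * exp (8 * K * Rabs t).
Proof.
  induction k; intros i t.
  - simpl. assert (1 <= exp (8 * K * Rabs t)).
    { rewrite <- exp_0. pose proof (Rabs_pos t).
      destruct (Req_dec (8 * K * Rabs t) 0) as [->|]; [lra|].
      left. apply exp_increasing. nra. }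
    pose proof (x0_bound i). pose proof (Rabs_pos (x0 i)). nra.
  - replace (c0 * (1/2) ^ S k) with (4 * K * (c0 * (1/2)^k) / (8 * K)) by (simpl; field; lra).
    apply (exp_growth_bound _ (apply_L (picard_term k) i)); [lra| | |].
    + simpl. apply (RInt_point (V := R_CompleteNormedModule)).
    + apply picard_term_derive.
    + intros u. rewrite Rmult_assoc. apply apply_L_bound. intros; apply IHk.
Qed.

Definition picard_sum (n i : nat) (t : R) : R := sum_f_R0 (fun k => picard_term k i t) n.
Definition picard_sol (i : nat) (t : R) : R := Lim_seq (fun n => picard_sum n i t).

Lemma geometric_tail (a : nat -> R) (c : R) : (forall k, Rabs (a k) <= c * (1/2)^k) ->
  is_lim_seq (sum_f_R0 a) (real (Lim_seq (sum_f_R0 a))) /\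
  forall n, Rabs (sum_f_R0 a n - Lim_seq (sum_f_R0 a)) <= c * (1/2)^n.
Proof.
  intros Ha.
  assert (Hex : ex_series a).
  { apply (ex_series_le (K := R_AbsRing) (V := R_CompleteNormedModule) a (fun k => c * (1/2)^k)).
    - exact Ha.
    - apply (ex_series_scal_l (K := R_AbsRing) (V := R_NormedModule) c (fun k => (1/2)^k)). apply ex_series_geom. rewrite Rabs_pos_eq; lra. }
  assert (HL : is_lim_seq (sum_f_R0 a) (Series a)).
  { apply (is_lim_seq_ext (sum_n a)); [intros; apply sum_n_Reals|].
    apply Series_correct, Hex. }
  rewrite (is_lim_seq_unique _ _ HL). split; [exact HL|]. intros n.
  apply (is_lim_seq_le (fun m => Rabs (sum_f_R0 a n - sum_f_R0 a (n + m)%nat))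
           (fun _ => c * (1/2)^n) (Rabs (sum_f_R0 a n - Series a)) (c * (1/2)^n)).
  - intros m.
    (* The subtracted c (1/2)^(n+m) strengthens the claim for the induction on m: it halves at each
       step, and the half released pays for the new term. *)
    assert (B : Rabs (sum_f_R0 a n - sum_f_R0 a (n + m)%nat) <= c * (1/2)^n - c * (1/2)^(n+m)).
    { induction m.
      - rewrite Nat.add_0_r. rewrite Rminus_diag, Rabs_R0. lra.
      - rewrite Nat.add_succ_r. simpl sum_f_R0.
        replace (sum_f_R0 a n - (sum_f_R0 a (n + m) + a (S (n + m))))
          with ((sum_f_R0 a n - sum_f_R0 a (n + m)) + - a (S (n + m))) by ring.
        eapply Rle_trans; [apply Rabs_triang|]. rewrite Rabs_Ropp.
        pose proof (Ha (S (n + m))) as H. simpl pow in *. lra. }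
    assert (0 <= c * (1/2)^(n+m)).
    { eapply Rle_trans; [apply Rabs_pos | apply (Ha (n + m)%nat)]. }
    lra.
  - apply (is_lim_seq_abs _ (Finite (sum_f_R0 a n - Series a))).
    apply is_lim_seq_minus'; [apply is_lim_seq_const|].
    apply (is_lim_seq_ext (fun m => sum_f_R0 a (m + n)%nat)).
    + intros m; f_equal; lia.
    + apply (is_lim_seq_incr_n (sum_f_R0 a) n). exact HL.
  - apply is_lim_seq_const.
Qed.

Lemma picard_sum_tail i t :
  is_lim_seq (fun n => picard_sum n i t) (picard_sol i t) /\
  forall n, Rabs (picard_sum n i t - picard_sol i t) <= c0 * exp (8 * K * Rabs t) * (1/2)^n.
Proof.
  apply (geometric_tail (fun k => picard_term k i t) (c0 * exp (8 * K * Rabs t))).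
  intros k. pose proof (picard_term_bound k i t). lra.
Qed.

Lemma picard_sum_derive n i t :
  is_derive (picard_sum (S n) i) t (apply_L (picard_sum n) i t).
Proof.
  induction n.
  - unfold picard_sum at 1.
    apply (is_derive_ext (fun t => x0 i + picard_term 1 i t)); [reflexivity|].
    replace (apply_L (picard_sum 0) i t) with (0 + apply_L (picard_term 0) i t)
      by (unfold apply_L, picard_sum; simpl; ring).
    apply (is_derive_plus (V := R_NormedModule)); [apply (is_derive_const (V := R_NormedModule))|].
    apply picard_term_derive.
  - apply (is_derive_ext (fun t => picard_sum (S n) i t + picard_term (S (S n)) i t)); [reflexivity|].
    replace (apply_L (picard_sum (S n)) i t)
      with (apply_L (picard_sum n) i t + apply_L (picard_term (S n)) i t).
    + apply (is_derive_plus (V := R_NormedModule)); [exact IHn|apply picard_term_derive].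
    + unfold apply_L, picard_sum.
      rewrite <- sum_plus. apply sum_eq. intros j _.
      change (sum_f_R0 (fun k => picard_term k j t) (S n)) with
        (sum_f_R0 (fun k => picard_term k j t) n + picard_term (S n) j t). ring.
Qed.

Lemma apply_L_lim i t :
  is_lim_seq (fun n => apply_L (picard_sum n) i t) (apply_L picard_sol i t).
Proof.
  unfold apply_L. simpl.
  repeat apply is_lim_seq_plus';
    (apply is_lim_seq_mult'; [apply is_lim_seq_const | apply picard_sum_tail]).
Qed.

Lemma half_pow_small (M : R) (eps : posreal) : 0 <= M ->
  eventually (fun n => M * (1/2)^n < eps).
Proof.
  intros HM.
  assert (H : is_lim_seq (fun n => M * (1/2)^n) (M * 0)).
  { apply is_lim_seq_mult'; [apply is_lim_seq_const|].
    apply is_lim_seq_geom. rewrite Rabs_pos_eq; lra. }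
  rewrite Rmult_0_r in H. apply is_lim_seq_spec in H. specialize (H eps).
  destruct H as [N HN]. exists N. intros n Hn. specialize (HN n Hn).
  pose proof (Rle_abs (M * (1/2)^n - 0)). lra.
Qed.

(** Partial sums and their derivatives converge uniformly on |y| < |t| + 1, so [CVU_Derive]
    differentiates the limit. The sequence starts at index 1 because [picard_sum (S n)] has the
    closed derivative [apply_L (picard_sum n)]. *)
Lemma picard_sol_derive i t : is_derive (picard_sol i) t (apply_L picard_sol i t).
Proof.
  set (r := Rabs t + 1).
  set (D := fun y => - r < y < r).
  assert (c0pos : 0 <= c0) by (eapply Rle_trans; [apply Rabs_pos | apply (x0_bound 0)]).
  set (E := c0 * exp (8 * K * r)).
  assert (HE : 0 <= E) by (apply Rmult_le_pos; [lra | left; apply exp_pos]).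
  assert (tail : forall n j y, D y -> Rabs (picard_sum n j y - picard_sol j y) <= E * (1/2)^n).
  { intros n j y [H1 H2]. eapply Rle_trans; [apply picard_sum_tail|].
    apply Rmult_le_compat_r; [apply pow_le; lra|]. apply Rmult_le_compat_l; [lra|].
    assert (Rabs y < r) by (apply Rabs_def1; lra).
    left. apply exp_increasing. nra. }
  assert (Dder : forall n y, Derive (picard_sum (S n) i) y = apply_L (picard_sum n) i y).
  { intros. apply is_derive_unique, picard_sum_derive. }
  assert (Lim1 : forall y, real (Lim_seq (fun n => picard_sum (S n) i y)) = picard_sol i y).
  { intros y. apply (f_equal real). apply (Lim_seq_incr_1 (fun n => picard_sum n i y)). }
  assert (Lim2 : forall y, real (Lim_seq (fun n => Derive (picard_sum (S n) i) y)) = apply_L picard_sol i y).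
  { intros y. erewrite Lim_seq_ext; [|intros n; apply Dder].
    now rewrite (is_lim_seq_unique _ _ (apply_L_lim i y)). }
  assert (G : is_derive (fun y => real (Lim_seq (fun n => picard_sum (S n) i y))) t
     (Lim_seq (fun n => Derive (picard_sum (S n) i) t))).
  { apply (CVU_Derive (fun n => picard_sum (S n) i) D).
    - apply open_and; [apply open_gt | apply open_lt].
    - intros a b y Ha Hb Hy; unfold D in *; lra.
    - intros eps. destruct (half_pow_small E eps HE) as [N HN]. exists N.
      intros n Hn y Hy. rewrite Lim1. eapply Rle_lt_trans; [apply tail, Hy|].
      apply HN. lia.
    - intros n y _. eexists. apply picard_sum_derive.
    - intros n y _. apply continuity_pt_filterlim.
      apply (continuous_ext (apply_L (picard_sum n) i)); [intros; symmetry; apply Dder|].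
      apply apply_L_continuous. intros j u.
      destruct n; [apply continuous_const|].
      apply (ex_derive_continuous (V := R_NormedModule)). eexists. apply picard_sum_derive.
    - intros eps. destruct (half_pow_small (4 * K * E) eps) as [N HN]; [nra|].
      exists N. intros n Hn y Hy. rewrite Lim2, Dder.
      replace (apply_L (picard_sum n) i y - apply_L picard_sol i y)
        with (apply_L (fun j y => picard_sum n j y - picard_sol j y) i y)
        by (unfold apply_L; simpl; ring).
      eapply Rle_lt_trans; [apply apply_L_bound; intros; apply tail, Hy|].
      specialize (HN n Hn). lra.
    - unfold D, r. pose proof (Rle_abs t). pose proof (Rle_abs (-t)) as H'. rewrite Rabs_Ropp in H'. lra. }
  rewrite Lim2 in G.
  apply (is_derive_ext (fun y => real (Lim_seq (fun n => picard_sum (S n) i y)))); [|exact G].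
  intros y. simpl. now rewrite Lim1.
Qed.

Lemma picard_sol_init i : picard_sol i 0 = x0 i.
Proof.
  unfold picard_sol. rewrite (Lim_seq_ext _ (fun _ => x0 i)); [now rewrite Lim_seq_const|].
  intros n. unfold picard_sum. induction n; simpl; [reflexivity|].
  rewrite IHn. rewrite (RInt_point (V := R_CompleteNormedModule)).
  apply Rplus_0_r.
Qed.
End Picard.

(** * Calculus of complex functions of a real variable *)

Definition Cd (f : R -> C) (t : R) (l : C) : Prop :=
  is_derive (fun s => fst (f s)) t (fst l) /\ is_derive (fun s => snd (f s)) t (snd l).

Definition Ccont (f : R -> C) (t : R) : Prop :=
  continuous (fun s => fst (f s)) t /\ continuous (fun s => snd (f s)) t.

Lemma C_ext (x y : C) : fst x = fst y -> snd x = snd y -> x = y.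
Proof. destruct x, y; simpl; intros -> ->; reflexivity. Qed.

(** Bridge from the derivative in [C_R_NormedModule], used by [solves_along], to the componentwise
    one, to which the real differentiation and mean value lemmas apply. *)
Lemma Cd_of_is_derive (f : R -> C) t l :
  @is_derive R_AbsRing C_R_NormedModule f t l -> Cd f t l.
Proof.
  intros H. split.
  - apply (filterdiff_comp f (fun z : R * R => fst z) _ (fun z => fst z)) in H; [exact H|].
    apply filterdiff_linear. apply (is_linear_fst (U := R_NormedModule) (V := R_NormedModule)).
  - apply (filterdiff_comp f (fun z : R * R => snd z) _ (fun z => snd z)) in H; [exact H|].
    apply filterdiff_linear. apply (is_linear_snd (U := R_NormedModule) (V := R_NormedModule)).
Qed.

Lemma Cd_eq f t l l' : Cd f t l -> l = l' -> Cd f t l'.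
Proof. intros H <-; exact H. Qed.

Lemma Cd_const c t : Cd (fun _ => c) t 0%C.
Proof. split; apply (is_derive_const (V := R_NormedModule)). Qed.

Lemma Cd_plus f g t l m : Cd f t l -> Cd g t m -> Cd (fun s => f s + g s)%C t (l + m)%C.
Proof. intros [A B] [A' B']. split; apply (is_derive_plus (V := R_NormedModule)); assumption. Qed.

Lemma Cd_minus f g t l m : Cd f t l -> Cd g t m -> Cd (fun s => f s - g s)%C t (l - m)%C.
Proof. intros [A B] [A' B']. split; apply (is_derive_minus (V := R_NormedModule)); assumption. Qed.

Lemma is_derive_Rmult (f g : R -> R) t l m : is_derive f t l -> is_derive g t m ->
  is_derive (fun s => f s * g s) t (l * g t + f t * m).
Proof. intros; apply (is_derive_mult f g); auto. intros; apply Rmult_comm. Qed.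

Lemma is_derive_eqR (f : R -> R) t l l' : is_derive f t l -> l = l' -> is_derive f t l'.
Proof. intros H <-; exact H. Qed.

Lemma Cd_mult f g t l m : Cd f t l -> Cd g t m ->
  Cd (fun s => f s * g s)%C t (l * g t + f t * m)%C.
Proof.
  intros [A B] [A' B']. split; simpl.
  - eapply is_derive_eqR;
      [apply (is_derive_minus (V := R_NormedModule)); apply is_derive_Rmult; eassumption|].
    unfold minus, plus, opp; simpl; ring.
  - eapply is_derive_eqR;
      [apply (is_derive_plus (V := R_NormedModule)); apply is_derive_Rmult; eassumption|].
    unfold plus; simpl; ring.
Qed.

Lemma Csqnorm_neq_0 (z : C) : z <> 0%C -> fst z ^ 2 + snd z ^ 2 <> 0.
Proof.
  intros H E. apply H. destruct z as [x y]; simpl in *.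
  apply C_ext; simpl; nra.
Qed.

Lemma Cd_inv f t l : Cd f t l -> f t <> 0%C -> Cd (fun s => / f s)%C t (- l / (f t * f t))%C.
Proof.
  intros [A B] Hn. pose proof (Csqnorm_neq_0 _ Hn) as Hs.
  assert (Hd : is_derive (fun s => fst (f s) ^ 2 + snd (f s) ^ 2) t
     (2 * fst (f t) * fst l + 2 * snd (f t) * snd l)).
  { eapply is_derive_eqR.
    - apply (is_derive_plus (V := R_NormedModule)); apply (is_derive_pow _ 2); eassumption.
    - unfold plus; simpl; ring. }
  assert (Hn2 : fst (f t * f t)%C ^ 2 + snd (f t * f t)%C ^ 2 <> 0).
  { simpl. replace ((fst (f t) * fst (f t) - snd (f t) * snd (f t)) *
      ((fst (f t) * fst (f t) - snd (f t) * snd (f t)) * 1) +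
      (fst (f t) * snd (f t) + snd (f t) * fst (f t)) *
      ((fst (f t) * snd (f t) + snd (f t) * fst (f t)) * 1)) with
      ((fst (f t) ^ 2 + snd (f t) ^ 2) ^ 2) by ring.
    apply pow_nonzero; exact Hs. }
  split.
  - eapply is_derive_eqR;
      [apply (is_derive_div (fun s => fst (f s)) (fun s => fst (f s) ^ 2 + snd (f s) ^ 2)); eassumption|].
    simpl in *. field. split; intros E; [apply Hn2|apply Hs]; rewrite <- E; ring.
  - eapply is_derive_eqR;
      [apply (is_derive_div (fun s => - snd (f s)) (fun s => fst (f s) ^ 2 + snd (f s) ^ 2));
       [apply (is_derive_opp (V := R_NormedModule)); eassumption|eassumption|exact Hs]|].
    unfold opp; simpl in *. field. split; intros E; [apply Hn2|apply Hs]; rewrite <- E; ring.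
Qed.

Lemma Cd_comp_affine f a b t l : Cd f (a + b * t) l ->
  Cd (fun s => f (a + b * s)) t (RtoC b * l)%C.
Proof.
  intros [A B].
  assert (D : is_derive (fun s => a + b * s) t b) by (auto_derive; [trivial|ring]).
  split.
  - eapply is_derive_eqR; [apply (is_derive_comp (fun s => fst (f s)) _ t _ _ A D)|].
    unfold scal; simpl; unfold mult; simpl; ring.
  - eapply is_derive_eqR; [apply (is_derive_comp (fun s => snd (f s)) _ t _ _ B D)|].
    unfold scal; simpl; unfold mult; simpl; ring.
Qed.

Lemma Ccont_const c t : Ccont (fun _ => c) t.
Proof. split; apply continuous_const. Qed.

Lemma Ccont_plus f g t : Ccont f t -> Ccont g t -> Ccont (fun s => f s + g s)%C t.
Proof. intros [A B] [A' B']. split; apply (continuous_plus (V := R_NormedModule)); assumption. Qed.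

Lemma Ccont_mult f g t : Ccont f t -> Ccont g t -> Ccont (fun s => f s * g s)%C t.
Proof.
  intros [A B] [A' B']. split; simpl.
  - apply (continuous_minus (V := R_NormedModule)); apply (continuous_mult (K := R_AbsRing)); assumption.
  - apply (continuous_plus (V := R_NormedModule)); apply (continuous_mult (K := R_AbsRing)); assumption.
Qed.

Lemma Ccont_of_Cd f t l : Cd f t l -> Ccont f t.
Proof.
  intros [A B]; split; apply (ex_derive_continuous (V := R_NormedModule)); eexists; eassumption.
Qed.

Lemma fst_le_Cmod (z : C) : Rabs (fst z) <= Cmod z.
Proof. eapply Rle_trans; [|apply Rmax_Cmod]. apply Rmax_l. Qed.

Lemma snd_le_Cmod (z : C) : Rabs (snd z) <= Cmod z.
Proof. eapply Rle_trans; [|apply Rmax_Cmod]. apply Rmax_r. Qed.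

Lemma Cmod_le_abs (z : C) : Cmod z <= Rabs (fst z) + Rabs (snd z).
Proof.
  destruct z as [x y].
  replace (x, y) with (RtoC x + Ci * RtoC y)%C by (apply C_ext; simpl; ring).
  eapply Rle_trans; [apply Cmod_triangle|].
  rewrite Cmod_mult, !Cmod_R, Cmod_Ci. simpl.
  replace (x + (0 * y - 1 * 0)) with x by ring. replace (0 + (0 * 0 + 1 * y)) with y by ring. lra.
Qed.

Lemma real_mean_value (f df : R -> R) (a b K : R) : a <= b ->
  (forall t, a <= t <= b -> is_derive f t (df t)) ->
  (forall t, a <= t <= b -> Rabs (df t) <= K) ->
  Rabs (f b - f a) <= K * (b - a).
Proof.
  intros Hab Hd HK.
  destruct (MVT_gen f a b df) as [c [Hc E]].
  - rewrite Rmin_left, Rmax_right by lra. intros x Hx; apply Hd; lra.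
  - rewrite Rmin_left, Rmax_right by lra. intros x Hx.
    apply derivable_continuous_pt. exists (df x). apply is_derive_Reals, Hd; lra.
  - rewrite Rmin_left, Rmax_right in Hc by lra.
    rewrite E, Rabs_mult, (Rabs_pos_eq (b - a)) by lra.
    apply Rmult_le_compat_r; [lra|auto].
Qed.

(** The mean value theorem holds for the two components at different points; adding their bounds
    gives the factor 2. *)
Lemma C_mean_value (f df : R -> C) (a b K : R) : a <= b ->
  (forall t, a <= t <= b -> Cd f t (df t)) ->
  (forall t, a <= t <= b -> Cmod (df t) <= K) ->
  Cmod (f b - f a)%C <= 2 * K * (b - a).
Proof.
  intros Hab Hd HK. eapply Rle_trans; [apply Cmod_le_abs|].
  assert (Rabs (fst (f b) - fst (f a)) <= K * (b - a)).
  { apply (real_mean_value (fun t => fst (f t)) (fun t => fst (df t))); [lra| |].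
    - intros; apply Hd; lra.
    - intros; eapply Rle_trans; [apply fst_le_Cmod|apply HK; lra]. }
  assert (Rabs (snd (f b) - snd (f a)) <= K * (b - a)).
  { apply (real_mean_value (fun t => snd (f t)) (fun t => snd (df t))); [lra| |].
    - intros; apply Hd; lra.
    - intros; eapply Rle_trans; [apply snd_le_Cmod|apply HK; lra]. }
  simpl. unfold Rminus in *. lra.
Qed.

Lemma C_constant (f : R -> C) (a b : R) : a <= b ->
  (forall t, a <= t <= b -> Cd f t 0%C) -> f b = f a.
Proof.
  intros Hab Hd.
  assert (H : Cmod (f b - f a)%C <= 2 * 0 * (b - a)).
  { apply (C_mean_value f (fun _ => 0%C)); auto. intros; rewrite Cmod_0; lra. }
  assert (E : (f b - f a)%C = 0%C).
  { apply Cmod_eq_0. pose proof (Cmod_ge_0 (f b - f a)%C). lra. }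
  replace (f b) with (f b - f a + f a)%C by ring. rewrite E. ring.
Qed.

Lemma dot_le_Cmod (x y : C) : fst x * fst y + snd x * snd y <= Cmod x * Cmod y.
Proof.
  rewrite <- (Cmod_conj y), <- Cmod_mult.
  eapply Rle_trans; [|apply fst_le_Cmod]. eapply Rle_trans; [|apply Rle_abs]. simpl. lra.
Qed.

Lemma Cmod_sq (x : C) : Cmod x ^ 2 = fst x ^ 2 + snd x ^ 2.
Proof. unfold Cmod. rewrite pow2_sqrt; [reflexivity|nra]. Qed.

(** With p = |a| and q = |b|, the derivative of p^2 + q^2 is at most 2 K (p + q)^2 <= 4 K (p^2 +
    q^2), and Gronwall applies. *)
Lemma row_bound (a b da db : R -> C) (K : R) : 0 <= K ->
  (forall t, 0 <= t <= 1 -> Cd a t (da t)) -> (forall t, 0 <= t <= 1 -> Cd b t (db t)) ->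
  (forall t, 0 <= t <= 1 -> Cmod (da t) <= K * (Cmod (a t) + Cmod (b t))) ->
  (forall t, 0 <= t <= 1 -> Cmod (db t) <= K * (Cmod (a t) + Cmod (b t))) ->
  forall t, 0 <= t <= 1 ->
    Cmod (a t) ^ 2 + Cmod (b t) ^ 2 <= (Cmod (a 0) ^ 2 + Cmod (b 0) ^ 2) * exp (4 * K).
Proof.
  intros HK Ha Hb Ba Bb t Ht. rewrite !Cmod_sq.
  set (f := fun t => fst (a t) ^ 2 + snd (a t) ^ 2 + (fst (b t) ^ 2 + snd (b t) ^ 2)).
  change (f t <= f 0 * exp (4 * K)).
  assert (G : f t <= f 0 * exp (4 * K * t)).
  { apply (gronwall f (fun t => 2 * (fst (a t) * fst (da t) + snd (a t) * snd (da t)) +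
              2 * (fst (b t) * fst (db t) + snd (b t) * snd (db t)))); [| |exact Ht].
    - intros x Hx. destruct (Ha x Hx) as [A1 A2], (Hb x Hx) as [B1 B2]. unfold f.
      eapply is_derive_eqR.
      + apply (is_derive_plus (V := R_NormedModule)); apply (is_derive_plus (V := R_NormedModule));
          apply (is_derive_pow _ 2); eassumption.
      + unfold plus; simpl; ring.
    - intros x Hx.
      pose proof (dot_le_Cmod (a x) (da x)). pose proof (dot_le_Cmod (b x) (db x)).
      pose proof (Ba x Hx). pose proof (Bb x Hx).
      pose proof (Cmod_ge_0 (a x)). pose proof (Cmod_ge_0 (b x)).
      assert (E : f x = Cmod (a x) ^ 2 + Cmod (b x) ^ 2) by (unfold f; rewrite !Cmod_sq; reflexivity).
      rewrite E. set (p := Cmod (a x)) in *. set (q := Cmod (b x)) in *.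
      assert (p * Cmod (da x) <= p * (K * (p + q))) by (apply Rmult_le_compat_l; assumption).
      assert (q * Cmod (db x) <= q * (K * (p + q))) by (apply Rmult_le_compat_l; assumption).
      assert (0 <= K * (p - q) ^ 2) by (apply Rmult_le_pos; [exact HK|apply pow2_ge_0]).
      nra. }
  eapply Rle_trans; [exact G|]. apply Rmult_le_compat_l.
  - unfold f. nra.
  - destruct (Req_dec (4 * K * t) (4 * K)) as [->|]; [lra|]. left. apply exp_increasing. nra.
Qed.

(** A retraction of R onto [0, 1]: coefficients controlled only on [0, 1] are precomposed with it to
    meet the global hypotheses of the Picard section. Absolute values make its continuity
    immediate. *)
Definition clamp (t : R) : R := (1 + Rabs t - Rabs (t - 1)) / 2.

Lemma clamp_range t : 0 <= clamp t <= 1.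
Proof. unfold clamp. unfold Rabs; destruct (Rcase_abs t), (Rcase_abs (t - 1)); lra. Qed.

Lemma clamp_id t : 0 <= t <= 1 -> clamp t = t.
Proof. intros. unfold clamp. unfold Rabs; destruct (Rcase_abs t), (Rcase_abs (t - 1)); lra. Qed.

Lemma clamp_continuous t : continuous clamp t.
Proof.
  unfold clamp, Rdiv. apply (continuous_mult (K := R_AbsRing)); [|apply continuous_const].
  apply (continuous_minus (V := R_NormedModule)); [apply (continuous_plus (V := R_NormedModule))|].
  - apply continuous_const.
  - apply continuous_Rabs.
  - apply (continuous_comp (fun t => t - 1) Rabs); [|apply continuous_Rabs].
    apply (continuous_minus (V := R_NormedModule)); [apply continuous_id|apply continuous_const].
Qed.

(* T' = T * [[0, g], [h, 0]] on [0, 1]. *)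
Definition solves (g h : R -> C) (T : R -> M2) : Prop := forall t, 0 <= t <= 1 ->
  Cd (fun s => m11 (T s)) t (m12 (T t) * h t)%C /\
  Cd (fun s => m12 (T s)) t (m11 (T t) * g t)%C /\
  Cd (fun s => m21 (T s)) t (m22 (T t) * h t)%C /\
  Cd (fun s => m22 (T s)) t (m21 (T t) * g t)%C.

Lemma row_exists (g h : R -> C) (K : R) (a0 b0 : C) : 0 < K ->
  (forall t, 0 <= t <= 1 -> Ccont g t) -> (forall t, 0 <= t <= 1 -> Ccont h t) ->
  (forall t, 0 <= t <= 1 -> Cmod (g t) <= K) -> (forall t, 0 <= t <= 1 -> Cmod (h t) <= K) ->
  exists a b : R -> C, a 0 = a0 /\ b 0 = b0 /\ forall t, 0 <= t <= 1 ->
    Cd a t (b t * h t)%C /\ Cd b t (a t * g t)%C.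
Proof.
  intros HK Cg Ch Bg Bh.
  (* Indices 0, 1 are the real and imaginary parts of a, and 2, 3 those of b; each nonzero 2 x 2
     block is multiplication by the complex number h or g. *)
  pose (L := fun i j : nat => match i, j with
    | 0%nat, 2%nat => fun t => fst (h (clamp t)) | 0%nat, 3%nat => fun t => - snd (h (clamp t))
    | 1%nat, 2%nat => fun t => snd (h (clamp t)) | 1%nat, 3%nat => fun t => fst (h (clamp t))
    | 2%nat, 0%nat => fun t => fst (g (clamp t)) | 2%nat, 1%nat => fun t => - snd (g (clamp t))
    | 3%nat, 0%nat => fun t => snd (g (clamp t)) | 3%nat, 1%nat => fun t => fst (g (clamp t))
    | _, _ => fun _ : R => 0 end).
  pose (x0 := fun i : nat => match i with
    | 0%nat => fst a0 | 1%nat => snd a0 | 2%nat => fst b0 | 3%nat => snd b0 | _ => 0 end).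
  assert (Hc : forall i j t, continuous (L i j) t).
  { intros i j t. unfold L.
    assert (G1 : continuous (fun t => fst (g (clamp t))) t) by
      (apply (continuous_comp clamp (fun s => fst (g s))); [apply clamp_continuous|apply Cg, clamp_range]).
    assert (G2 : continuous (fun t => snd (g (clamp t))) t) by
      (apply (continuous_comp clamp (fun s => snd (g s))); [apply clamp_continuous|apply Cg, clamp_range]).
    assert (H1 : continuous (fun t => fst (h (clamp t))) t) by
      (apply (continuous_comp clamp (fun s => fst (h s))); [apply clamp_continuous|apply Ch, clamp_range]).
    assert (H2 : continuous (fun t => snd (h (clamp t))) t) by
      (apply (continuous_comp clamp (fun s => snd (h s))); [apply clamp_continuous|apply Ch, clamp_range]).
    do 4 (destruct i as [|i]; [do 4 (destruct j as [|j];
      [first [assumption | apply continuous_const | apply (continuous_opp (V := R_NormedModule)); assumption]|]);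
      apply continuous_const|]); apply continuous_const. }
  assert (Hb : forall i j t, Rabs (L i j t) <= K).
  { intros i j t. unfold L. pose proof (clamp_range t) as Hr.
    pose proof (fst_le_Cmod (g (clamp t))). pose proof (snd_le_Cmod (g (clamp t))).
    pose proof (fst_le_Cmod (h (clamp t))). pose proof (snd_le_Cmod (h (clamp t))).
    pose proof (Bg _ Hr). pose proof (Bh _ Hr).
    do 4 (destruct i as [|i]; [do 4 (destruct j as [|j];
       [rewrite ?Rabs_Ropp, ?Rabs_R0; lra|]); rewrite Rabs_R0; lra|]); rewrite Rabs_R0; lra. }
  assert (Hx : forall i, Rabs (x0 i) <= Cmod a0 + Cmod b0).
  { intros i. pose proof (fst_le_Cmod a0). pose proof (snd_le_Cmod a0).
    pose proof (fst_le_Cmod b0). pose proof (snd_le_Cmod b0).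
    pose proof (Cmod_ge_0 a0). pose proof (Cmod_ge_0 b0).
    do 4 (destruct i as [|i]; [simpl; lra|]). simpl. rewrite Rabs_R0; lra. }
  pose proof (picard_sol_derive L K x0 Hc Hb HK _ Hx) as D.
  pose proof (picard_sol_init L x0) as I.
  set (x := picard_sol L x0) in *.
  exists (fun t => (x 0%nat t, x 1%nat t)), (fun t => (x 2%nat t, x 3%nat t)).
  split; [apply C_ext; simpl; apply I|]. split; [apply C_ext; simpl; apply I|].
  intros t Ht. split; split; simpl.
  - apply (is_derive_eqR _ _ _ _ (D 0%nat t)). unfold apply_L, L; simpl. rewrite clamp_id by lra. ring.
  - apply (is_derive_eqR _ _ _ _ (D 1%nat t)). unfold apply_L, L; simpl. rewrite clamp_id by lra. ring.
  - apply (is_derive_eqR _ _ _ _ (D 2%nat t)). unfold apply_L, L; simpl. rewrite clamp_id by lra. ring.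
  - apply (is_derive_eqR _ _ _ _ (D 3%nat t)). unfold apply_L, L; simpl. rewrite clamp_id by lra. ring.
Qed.

Lemma solves_exists (g h : R -> C) (K : R) : 0 < K ->
  (forall t, 0 <= t <= 1 -> Ccont g t) -> (forall t, 0 <= t <= 1 -> Ccont h t) ->
  (forall t, 0 <= t <= 1 -> Cmod (g t) <= K) -> (forall t, 0 <= t <= 1 -> Cmod (h t) <= K) ->
  exists T, T 0 = M2id /\ solves g h T.
Proof.
  intros HK Cg Ch Bg Bh.
  destruct (row_exists g h K 1%C 0%C HK Cg Ch Bg Bh) as (a & b & A0 & B0 & H).
  destruct (row_exists g h K 0%C 1%C HK Cg Ch Bg Bh) as (c & d & C0 & D0 & H').
  exists (fun t => mkM2 (a t) (b t) (c t) (d t)). split.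
  - now rewrite A0, B0, C0, D0.
  - intros t Ht. simpl. destruct (H t Ht), (H' t Ht). auto.
Qed.

(** Liouville's formula: the coefficient matrix has trace zero. *)
Lemma solves_det g h T : solves g h T -> forall t, 0 <= t <= 1 -> M2det (T t) = M2det (T 0).
Proof.
  intros H t Ht. apply (C_constant (fun s => M2det (T s))); [lra|]. intros s Hs.
  destruct (H s ltac:(lra)) as (A & B & D & E). unfold M2det.
  eapply Cd_eq; [apply Cd_minus; apply Cd_mult; eassumption|]. cbv beta. ring.
Qed.

Definition entries_le (A : M2) (e : R) : Prop :=
  Cmod (m11 A) <= e /\ Cmod (m12 A) <= e /\ Cmod (m21 A) <= e /\ Cmod (m22 A) <= e.

Lemma solves_bound g h T K : 0 <= K -> T 0 = M2id -> solves g h T ->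
  (forall t, 0 <= t <= 1 -> Cmod (g t) <= K) -> (forall t, 0 <= t <= 1 -> Cmod (h t) <= K) ->
  forall t, 0 <= t <= 1 -> entries_le (T t) (exp (4 * K)).
Proof.
  intros HK T0 HT Bg Bh t Ht.
  assert (P : forall x y b, 0 <= b -> Cmod x ^ 2 + Cmod y ^ 2 <= b ^ 2 -> Cmod x <= b /\ Cmod y <= b).
  { intros x y b H0 H. pose proof (Cmod_ge_0 x). pose proof (Cmod_ge_0 y). split; nra. }
  assert (E1 : 1 <= exp (4 * K)).
  { rewrite <- exp_0. destruct (Req_dec (4 * K) 0) as [->|]; [lra|].
    left; apply exp_increasing; lra. }
  assert (Mb : forall x y b, Cmod b <= K -> Cmod (x * b)%C <= K * (Cmod x + Cmod y)).
  { intros x y b Hb. rewrite Cmod_mult.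
    pose proof (Cmod_ge_0 x). pose proof (Cmod_ge_0 y). pose proof (Cmod_ge_0 b). nra. }
  destruct (P (m11 (T t)) (m12 (T t)) (exp (4 * K))) as [X1 X2]; [lra| |].
  { eapply Rle_trans; [apply (row_bound (fun s => m11 (T s)) (fun s => m12 (T s))
       (fun s => m12 (T s) * h s)%C (fun s => m11 (T s) * g s)%C K); try assumption|].
    - intros s Hs; apply HT, Hs.
    - intros s Hs; apply HT, Hs.
    - intros s Hs. rewrite Rplus_comm. apply Mb; auto.
    - intros s Hs. apply Mb; auto.
    - rewrite T0. simpl. rewrite Cmod_1, Cmod_0. nra. }
  destruct (P (m21 (T t)) (m22 (T t)) (exp (4 * K))) as [X3 X4]; [lra| |].
  { eapply Rle_trans; [apply (row_bound (fun s => m21 (T s)) (fun s => m22 (T s))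
       (fun s => m22 (T s) * h s)%C (fun s => m21 (T s) * g s)%C K); try assumption|].
    - intros s Hs; apply HT, Hs.
    - intros s Hs; apply HT, Hs.
    - intros s Hs. rewrite Rplus_comm. apply Mb; auto.
    - intros s Hs. apply Mb; auto.
    - rewrite T0. simpl. rewrite Cmod_1, Cmod_0. nra. }
  repeat split; assumption.
Qed.

Lemma Cmod_lin2 a b c d e n : Cmod a <= e -> Cmod b <= n -> Cmod c <= e -> Cmod d <= n ->
  Cmod (a * b + c * d)%C <= 2 * (e * n).
Proof.
  intros. eapply Rle_trans; [apply Cmod_triangle|]. rewrite !Cmod_mult.
  pose proof (Cmod_ge_0 a). pose proof (Cmod_ge_0 b). pose proof (Cmod_ge_0 c). pose proof (Cmod_ge_0 d).
  assert (Cmod a * Cmod b <= e * n) by (apply Rmult_le_compat; auto).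
  assert (Cmod c * Cmod d <= e * n) by (apply Rmult_le_compat; auto). lra.
Qed.

(* Variation of constants: with det T = 1, the matrix V := Z * adj T satisfies V' = E * adj T. *)
Lemma defect_row g h T (a b ea eb : R -> C) (n e : R) :
  T 0 = M2id -> solves g h T -> (forall t, 0 <= t <= 1 -> entries_le (T t) n) ->
  (forall t, 0 <= t <= 1 -> Cd a t (b t * h t + ea t)%C) ->
  (forall t, 0 <= t <= 1 -> Cd b t (a t * g t + eb t)%C) ->
  (forall t, 0 <= t <= 1 -> Cmod (ea t) <= e) -> (forall t, 0 <= t <= 1 -> Cmod (eb t) <= e) ->
  Cmod (a 1 - (a 0 * m11 (T 1) + b 0 * m21 (T 1)))%C <= 8 * n ^ 2 * e /\
  Cmod (b 1 - (a 0 * m12 (T 1) + b 0 * m22 (T 1)))%C <= 8 * n ^ 2 * e.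
Proof.
  intros T0 HT Bn Ha Hb Ea Eb.
  pose proof (solves_det g h T HT 1 ltac:(lra)) as Hdet.
  rewrite T0 in Hdet. unfold M2det in Hdet. simpl in Hdet.
  assert (Hdet' : (m11 (T 1) * m22 (T 1) - m12 (T 1) * m21 (T 1) = 1)%C) by (rewrite Hdet; ring).
  set (u := fun t => (a t * m22 (T t) - b t * m21 (T t))%C).
  set (v := fun t => (b t * m11 (T t) - a t * m12 (T t))%C).
  assert (Hu : Cmod (u 1 - u 0)%C <= 2 * (2 * (e * n)) * (1 - 0)).
  { apply (C_mean_value u (fun t => ea t * m22 (T t) + (- eb t) * m21 (T t))%C); [lra| |].
    - intros t Ht. destruct (HT t Ht) as (A & B & D & E). unfold u.
      eapply Cd_eq; [apply Cd_minus; apply Cd_mult; eauto|]. cbv beta. ring.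
    - intros t Ht. destruct (Bn t Ht) as (A & B & D & E).
      apply Cmod_lin2; rewrite ?Cmod_opp; auto. }
  assert (Hv : Cmod (v 1 - v 0)%C <= 2 * (2 * (e * n)) * (1 - 0)).
  { apply (C_mean_value v (fun t => eb t * m11 (T t) + (- ea t) * m12 (T t))%C); [lra| |].
    - intros t Ht. destruct (HT t Ht) as (A & B & D & E). unfold v.
      eapply Cd_eq; [apply Cd_minus; apply Cd_mult; eauto|]. cbv beta. ring.
    - intros t Ht. destruct (Bn t Ht) as (A & B & D & E).
      apply Cmod_lin2; rewrite ?Cmod_opp; auto. }
  assert (U0 : u 0 = a 0) by (unfold u; rewrite T0; simpl; ring).
  assert (V0 : v 0 = b 0) by (unfold v; rewrite T0; simpl; ring).
  destruct (Bn 1 ltac:(lra)) as (A & B & D & E).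
  split.
  - replace (a 1 - (a 0 * m11 (T 1) + b 0 * m21 (T 1)))%C
      with ((u 1 - u 0) * m11 (T 1) + (v 1 - v 0) * m21 (T 1))%C.
    + eapply Rle_trans; [apply Cmod_lin2; eassumption|]. lra.
    + rewrite U0, V0. unfold u, v.
      replace (a 1) with (a 1 * (m11 (T 1) * m22 (T 1) - m12 (T 1) * m21 (T 1)))%C at 3
        by (rewrite Hdet'; ring). ring.
  - replace (b 1 - (a 0 * m12 (T 1) + b 0 * m22 (T 1)))%C
      with ((u 1 - u 0) * m12 (T 1) + (v 1 - v 0) * m22 (T 1))%C.
    + eapply Rle_trans; [apply Cmod_lin2; eassumption|]. lra.
    + rewrite U0, V0. unfold u, v.
      replace (b 1) with (b 1 * (m11 (T 1) * m22 (T 1) - m12 (T 1) * m21 (T 1)))%C at 3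
        by (rewrite Hdet'; ring). ring.
Qed.

(** * Homotopy invariance of parallel transport *)

Lemma bound_mult x y a b : Cmod x <= a -> Cmod y <= b -> Cmod (x * y)%C <= a * b.
Proof. intros. rewrite Cmod_mult. apply Rmult_le_compat; auto using Cmod_ge_0. Qed.

Lemma bound_plus x y a b : Cmod x <= a -> Cmod y <= b -> Cmod (x + y)%C <= a + b.
Proof. intros. eapply Rle_trans; [apply Cmod_triangle|lra]. Qed.

Lemma bound_opp x a : Cmod x <= a -> Cmod (- x)%C <= a.
Proof. now rewrite Cmod_opp. Qed.

Lemma bound_minus x y a b : Cmod x <= a -> Cmod y <= b -> Cmod (x - y)%C <= a + b.
Proof. intros. apply bound_plus; auto using bound_opp. Qed.

(** When the right-hand side is an existential variable, this builds the bound from the shape of the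
    expression, so that no explicit constant has to be written. *)
Ltac bnd := repeat (eassumption || eapply bound_mult || eapply bound_plus ||
  eapply bound_minus || eapply bound_opp || apply Rle_refl).

(** Over n steps of length 1/n the errors add up to n c / n^2 = c / n. A relation P stands in for a
    function of u because transports are only known to exist; the case u = u' of the hypothesis
    makes the related value unique. *)
Lemma quadratic_closeness_constant (P : R -> C -> Prop) (c : R) :
  (forall u, 0 <= u <= 1 -> exists x, P u x) ->
  (forall u u' x x', 0 <= u <= 1 -> 0 <= u' <= 1 -> P u x -> P u' x' ->
     Cmod (x - x')%C <= c * (u - u') ^ 2) ->
  forall x y, P 0 x -> P 1 y -> x = y.
Proof.
  intros Hex Hq x y Hx Hy.
  assert (step : forall n : nat, (0 < n)%nat -> forall k, (k <= n)%nat -> forall z,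
     P (INR k / INR n) z -> Cmod (z - x)%C <= INR k * (c / INR n ^ 2)).
  { intros n Hn. assert (Hn' : 0 < INR n) by (apply lt_0_INR; lia).
    assert (Hrange : forall k, (k <= n)%nat -> 0 <= INR k / INR n <= 1).
    { intros k Hk. pose proof (pos_INR k). pose proof (le_INR _ _ Hk). split.
      - apply Rdiv_le_0_compat; lra.
      - apply (Rmult_le_reg_r (INR n)); [lra|]. field_simplify; lra. }
    assert (Hzero : forall z, P (INR 0 / INR n) z -> Cmod (z - x)%C <= 0).
    { intros z Hz. replace (INR 0 / INR n) with 0 in Hz by (simpl; field; lra).
      eapply Rle_trans; [apply (Hq 0 0); auto; lra|]. lra. }
    induction k; intros Hk z Hz.
    - simpl INR in *. rewrite Rmult_0_l. apply Hzero, Hz.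
    - destruct (Hex (INR k / INR n) (Hrange k ltac:(lia))) as [z' Hz'].
      specialize (IHk ltac:(lia) z' Hz').
      assert (Cmod (z - z')%C <= c / INR n ^ 2).
      { eapply Rle_trans; [apply (Hq (INR (S k) / INR n) (INR k / INR n)); auto; apply Hrange; lia|].
        rewrite S_INR. right. field. lra. }
      replace (z - x)%C with ((z - z') + (z' - x))%C by ring.
      eapply Rle_trans; [apply Cmod_triangle|]. rewrite S_INR. lra. }
  assert (H : forall n : nat, (0 < n)%nat -> Cmod (y - x)%C * INR n <= c).
  { intros n Hn. assert (Hn' : 0 < INR n) by (apply lt_0_INR; lia).
    assert (H1 : Cmod (y - x)%C <= INR n * (c / INR n ^ 2)).
    { apply (step n Hn n (Nat.le_refl n)).
      replace (INR n / INR n) with 1 by (field; lra). exact Hy. }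
    apply (Rmult_le_compat_r (INR n)) in H1; [|lra].
    replace (INR n * (c / INR n ^ 2) * INR n) with c in H1 by (field; lra). exact H1. }
  assert (E : (y - x)%C = 0%C).
  { apply Cmod_eq_0. destruct (Rle_lt_or_eq_dec 0 _ (Cmod_ge_0 (y - x)%C)) as [Hp|He]; [|auto].
    exfalso. destruct (INR_archimed (Cmod (y - x)%C) (Rabs c) Hp) as [n Hn].
    specialize (H (S n) ltac:(lia)). rewrite S_INR in H. pose proof (Rle_abs c). nra. }
  replace x with (y - (y - x))%C by ring. rewrite E. ring.
Qed.

(** The Fuchsian coefficient, with A and B the double-pole coefficients at 0 and 1, and A + B + G
    the limit of z^2 q at infinity. It is a polynomial in 1/z and 1/(z - 1), the two quantities
    bounded by N on [far] points. *)
Definition qpot (A B G z : C) : C :=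
  (A * (/ z * / z) + B * (/ (z - 1) * / (z - 1)) + G * (/ z * / (z - 1)))%C.

Definition is_path (p g : R -> C) : Prop := (forall t, Cd p t (g t)) /\ (forall t, Ccont g t).

Definition transport (A B G : C) (p g : R -> C) (T : R -> M2) : Prop :=
  T 0 = M2id /\ solves g (fun t => qpot A B G (p t) * g t)%C T.

(** One N serves as inverse distance to the punctures and, in the section below, as bound for
    coefficients and speeds; the error constants are then uniform in the path. *)
Definition far (N : R) (z : C) : Prop := / N <= Cmod z /\ / N <= Cmod (z - 1)%C.

Lemma far_inv N z : 0 < N -> far N z ->
  z <> 0%C /\ (z - 1)%C <> 0%C /\ Cmod (/ z)%C <= N /\ Cmod (/ (z - 1))%C <= N.
Proof.
  intros HN [H1 H2]. pose proof (Rinv_0_lt_compat _ HN).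
  assert (z <> 0%C) by (intros E; rewrite E, Cmod_0 in H1; lra).
  assert ((z - 1)%C <> 0%C) by (intros E; rewrite E, Cmod_0 in H2; lra).
  repeat split; auto; rewrite Cmod_inv by assumption;
    rewrite <- (Rinv_inv N); apply Rinv_le_contravar; auto.
Qed.

Section Homotopy.
Variables (A B G : C) (N : R).
Hypothesis N1 : 1 <= N.
Hypothesis (HA : Cmod A <= N) (HB : Cmod B <= N) (HG : Cmod G <= N).

Let q := qpot A B G.
Let Kq := N * (N * N) + N * (N * N) + N * (N * N).
Let K := Kq * N.

Lemma qpot_bound z : far N z -> Cmod (q z) <= Kq.
Proof. intros F. destruct (far_inv N z ltac:(lra) F) as (_ & _ & X & Y). unfold q, qpot, Kq. bnd. Qed.

Lemma NK : N <= K.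
Proof. unfold K, Kq. assert (1 <= N * N) by nra. assert (1 <= N * (N * N)) by nra. nra. Qed.

Definition tame (p g : R -> C) : Prop :=
  is_path p g /\ (forall t, 0 <= t <= 1 -> far N (p t)) /\
  (forall t, 0 <= t <= 1 -> Cmod (g t) <= N).

Lemma tame_h_bound p g : tame p g -> forall t, 0 <= t <= 1 -> Cmod (q (p t) * g t)%C <= K.
Proof. intros (_ & F & Hg) t Ht. apply bound_mult; [apply qpot_bound|]; auto. Qed.

Lemma tame_g_bound p g : tame p g -> forall t, 0 <= t <= 1 -> Cmod (g t) <= K.
Proof. intros (_ & F & Hg) t Ht. eapply Rle_trans; [apply Hg, Ht|apply NK]. Qed.

Lemma Cd_m1 p g t : Cd p t g -> Cd (fun s => p s - 1)%C t g.
Proof.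
  intros H. eapply Cd_eq; [apply Cd_minus; [exact H|apply (Cd_const 1%C)]|]. ring.
Qed.

(** The derivative of q as a polynomial in m0 = 1/z and m1 = 1/(z - 1). *)
Definition qpot_deriv (m0 m1 : C) : C :=
  (- (A * (2 * (m0 * m0 * m0)) + B * (2 * (m1 * m1 * m1)) + G * (m0 * m0 * m1 + m0 * m1 * m1)))%C.

Lemma qpot_Cd p g t : Cd p t g -> p t <> 0%C -> (p t - 1)%C <> 0%C ->
  Cd (fun s => q (p s)) t (qpot_deriv (/ p t) (/ (p t - 1)) * g)%C.
Proof.
  intros H H0 H1. pose proof (Cd_inv _ _ _ H H0) as I0.
  pose proof (Cd_inv _ _ _ (Cd_m1 _ _ _ H) H1) as I1.
  unfold q, qpot. eapply Cd_eq.
  - apply Cd_plus; [apply Cd_plus|]; (apply Cd_mult; [apply Cd_const | apply Cd_mult; eassumption]).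
  - cbv beta. unfold qpot_deriv. field. auto.
Qed.

Lemma transport_exists p g : tame p g -> exists T, transport A B G p g T.
Proof.
  intros Ht. pose proof Ht as ((Hp & Hc) & F & Hg).
  destruct (solves_exists g (fun t => q (p t) * g t)%C K) as [T [T0 HT]].
  - pose proof NK. lra.
  - auto.
  - intros t H. apply Ccont_mult; [|apply Hc].
    destruct (far_inv N (p t) ltac:(lra) (F t H)) as (X & Y & _).
    eapply Ccont_of_Cd. apply qpot_Cd; [apply Hp|auto|auto].
  - apply tame_g_bound with p. exact Ht.
  - apply tame_h_bound. exact Ht.
  - exists T. split; auto.
Qed.

(** Substituting 1/(z + d) = m - d m^2 + d^2 n with n = m^2 / (z + d) makes Taylor's formula for q
    an exact algebraic identity. These are the quotients by d^2 of what remains after the constant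
    and linear terms, for a square and for the mixed product. *)
Definition sq_rem (m n d : C) : C := (m * m * (m * m) + d * d * (n * n) + 2 * (m * n) - 2 * (d * (m * m * n)))%C.
Definition prod_rem (m0 m1 n0 n1 d : C) : C :=
  (m0 * m0 * (m1 * m1) + m0 * n1 + m1 * n0 - d * (m0 * m0 * n1 + m1 * m1 * n0) + d * d * (n0 * n1))%C.
Definition qpot_rem (m0 m1 n0 n1 d : C) : C :=
  (A * sq_rem m0 n0 d + B * sq_rem m1 n1 d + G * prod_rem m0 m1 n0 n1 d)%C.

Lemma inv_taylor (z d : C) : z <> 0%C -> (z + d)%C <> 0%C ->
  (/ (z + d) = / z - d * (/ z * / z) + d * d * (/ z * / z * / (z + d)))%C.
Proof. intros. field. auto. Qed.

Lemma qpot_taylor (z d : C) : z <> 0%C -> (z - 1)%C <> 0%C -> (z + d)%C <> 0%C -> (z + d - 1)%C <> 0%C ->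
  q (z + d)%C = (q z + qpot_deriv (/ z) (/ (z - 1)) * d +
    qpot_rem (/ z) (/ (z - 1)) (/ z * / z * / (z + d)) (/ (z - 1) * / (z - 1) * / (z + d - 1)) d * (d * d))%C.
Proof.
  intros Z0 Z1 W0 W1. unfold q, qpot, qpot_deriv, qpot_rem, sq_rem, prod_rem.
  pose proof (inv_taylor z d Z0 W0) as E0.
  assert (E1 : (/ (z + d - 1) = / (z - 1) - d * (/ (z - 1) * / (z - 1)) +
     d * d * (/ (z - 1) * / (z - 1) * / (z + d - 1)))%C).
  { replace (z + d - 1)%C with (z - 1 + d)%C in * by ring. apply inv_taylor; auto. }
  set (m0 := (/ z)%C) in *. set (m1 := (/ (z - 1))%C) in *.
  set (k0 := (/ (z + d))%C) in *. set (k1 := (/ (z + d - 1))%C) in *.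
  set (n0 := (m0 * m0 * k0)%C) in *. set (n1 := (m1 * m1 * k1)%C) in *.
  clearbody n0 n1 m0 m1. rewrite E0, E1. ring.
Qed.

Lemma qpot_deriv_bound : exists c, forall m0 m1 : C, Cmod m0 <= N -> Cmod m1 <= N -> Cmod (qpot_deriv m0 m1) <= c.
Proof.
  eexists. intros m0 m1 H0 H1. unfold qpot_deriv.
  assert (H2 : Cmod 2 <= 2) by (rewrite Cmod_R, Rabs_pos_eq; lra). bnd.
Qed.

Lemma qpot_rem_bound : exists c, forall z w d : C, far N z -> far N w -> Cmod d <= N ->
  Cmod (qpot_rem (/ z) (/ (z - 1)) (/ z * / z * / w) (/ (z - 1) * / (z - 1) * / (w - 1)) d) <= c.
Proof.
  eexists. intros z w d Fz Fw Hd. unfold qpot_rem, sq_rem, prod_rem.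
  destruct (far_inv N z ltac:(lra) Fz) as (_ & _ & X & Y).
  destruct (far_inv N w ltac:(lra) Fw) as (_ & _ & X' & Y').
  assert (H2 : Cmod 2 <= 2) by (rewrite Cmod_R, Rabs_pos_eq; lra). bnd.
Qed.

(* I + d * [[0, 1], [q, 0]], the transport along the segment from z to z + d up to O(d^2). *)
Definition first_order_transport (z d : C) : M2 := mkM2 1%C d (q z * d)%C 1%C.

Definition M2close (P Q : M2) (e : R) : Prop :=
  Cmod (m11 P - m11 Q)%C <= e /\ Cmod (m12 P - m12 Q)%C <= e /\
  Cmod (m21 P - m21 Q)%C <= e /\ Cmod (m22 P - m22 Q)%C <= e.

(** With delta = p' - p, the pair (a, b) is the row (x, y) times I + delta [[0, 1], [q, 0]]. In the
    equation along p' the terms of first order in delta and its derivative cancel; each term of [ea]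
    and [eb] carries delta^2 or delta times its derivative. *)
Lemma row_defect : exists c, forall p g p' g' e (x y : R -> C),
  tame p g -> tame p' g' -> 0 <= e <= 1 ->
  (forall t, 0 <= t <= 1 -> Cmod (p' t - p t)%C <= N * e) ->
  (forall t, 0 <= t <= 1 -> Cmod (g' t - g t)%C <= N * e) ->
  (forall t, 0 <= t <= 1 -> Cd x t (y t * (q (p t) * g t))%C) ->
  (forall t, 0 <= t <= 1 -> Cd y t (x t * g t)%C) ->
  (forall t, 0 <= t <= 1 -> Cmod (x t) <= exp (4 * K)) ->
  (forall t, 0 <= t <= 1 -> Cmod (y t) <= exp (4 * K)) ->
  let a := fun t => (x t + y t * (q (p t) * (p' t - p t)))%C in
  let b := fun t => (x t * (p' t - p t) + y t)%C in
  exists ea eb : R -> C,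
    (forall t, 0 <= t <= 1 -> Cd a t (b t * (q (p' t) * g' t) + ea t)%C) /\
    (forall t, 0 <= t <= 1 -> Cd b t (a t * g' t + eb t)%C) /\
    (forall t, 0 <= t <= 1 -> Cmod (ea t) <= c * e ^ 2) /\
    (forall t, 0 <= t <= 1 -> Cmod (eb t) <= c * e ^ 2).
Proof.
  destruct qpot_deriv_bound as [c1 Hc1]. destruct qpot_rem_bound as [c2 Hc2].
  set (X := exp (4 * K)).
  assert (HX : 0 < X) by apply exp_pos.
  set (k1 := X * Kq + X * c1). set (k2 := (X * c2 + X * (c1 + c2 * N)) * N).
  (* N N e^2 bounds delta^2 and delta times its derivative; k1 and k2 bound the cofactors in [ea],
     and X Kq the one in [eb]. Absolute values are taken because the signs of c1 and c2 are not
     recorded. *)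
  exists (N * N * (Rabs k1 + Rabs k2 + X * Kq)).
  assert (HKq : 0 <= Kq) by (unfold Kq; assert (0 <= N * N) by nra; nra).
  intros p g p' g' e x y Hp Hp' He Hd Hdd Hx Hy Bx By a b.
  pose proof Hp as ((Cp & _) & Fp & Gp). pose proof Hp' as ((Cp' & _) & Fp' & Gp').
  pose (dl := fun t => (p' t - p t)%C). pose (dd := fun t => (g' t - g t)%C).
  pose (Q1 := fun t => qpot_deriv (/ p t) (/ (p t - 1))).
  pose (RH := fun t => qpot_rem (/ p t) (/ (p t - 1)) (/ p t * / p t * / p' t)
                 (/ (p t - 1) * / (p t - 1) * / (p' t - 1)) (dl t)).
  assert (Cdl : forall t, Cd (fun s => p' s - p s)%C t (g' t - g t)%C)
    by (intros t; apply Cd_minus; auto).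
  assert (Bdl : forall t, 0 <= t <= 1 -> Cmod (dl t) <= N).
  { intros t Ht. eapply Rle_trans; [apply Hd, Ht|]. nra. }
  assert (Hq' : forall t, 0 <= t <= 1 ->
     q (p' t) = (q (p t) + Q1 t * dl t + RH t * (dl t * dl t))%C).
  { intros t Ht. destruct (far_inv N _ ltac:(lra) (Fp t Ht)) as (P0 & P1 & _).
    destruct (far_inv N _ ltac:(lra) (Fp' t Ht)) as (P0' & P1' & _).
    pose proof (qpot_taylor (p t) (dl t) P0 P1) as E.
    replace (p t + dl t)%C with (p' t) in E by (unfold dl; ring).
    rewrite E by auto. unfold Q1, RH. ring. }
  exists (fun t => (dl t * dd t * (- (x t * q (p t) + y t * Q1 t))
            + dl t * dl t * (- ((y t * RH t + x t * (Q1 t + RH t * dl t)) * g' t)))%C),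
         (fun t => (dl t * dd t * (- (y t * q (p t))))%C).
  assert (BQ1 : forall t, 0 <= t <= 1 -> Cmod (Q1 t) <= c1).
  { intros t Ht. destruct (far_inv N _ ltac:(lra) (Fp t Ht)) as (_ & _ & F0 & F1).
    exact (Hc1 _ _ F0 F1). }
  assert (BRH : forall t, 0 <= t <= 1 -> Cmod (RH t) <= c2) by (intros t Ht; exact (Hc2 (p t) (p' t) (dl t) (Fp t Ht) (Fp' t Ht) (Bdl t Ht))).
  assert (Bq : forall t, 0 <= t <= 1 -> Cmod (q (p t)) <= Kq) by (intros; apply qpot_bound; auto).
  assert (He2 : 0 <= e ^ 2) by apply pow2_ge_0.
  assert (HN2 : 0 <= N * N) by nra.
  split; [|split; [|split]].
  - intros t Ht. destruct (far_inv N _ ltac:(lra) (Fp t Ht)) as (P0 & P1 & _).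
    unfold a. eapply Cd_eq.
    + apply Cd_plus; [apply Hx, Ht|]. apply Cd_mult; [apply Hy, Ht|]. apply Cd_mult; [|apply Cdl].
      apply qpot_Cd; [apply Cp|auto|auto].
    + cbv beta. rewrite (Hq' t Ht). unfold b, dl, dd, Q1. ring.
  - intros t Ht. unfold b. eapply Cd_eq.
    + apply Cd_plus; [apply Cd_mult; [apply Hx, Ht|apply Cdl]|apply Hy, Ht].
    + cbv beta. unfold a, dl, dd. ring.
  - intros t Ht.
    assert (Y1 : Cmod (- (x t * q (p t) + y t * Q1 t))%C <= k1).
    { unfold k1. pose proof (Bx t Ht). pose proof (By t Ht). pose proof (Bq t Ht). pose proof (BQ1 t Ht). bnd. }
    assert (Y2 : Cmod (- ((y t * RH t + x t * (Q1 t + RH t * dl t)) * g' t))%C <= k2).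
    { unfold k2. pose proof (Bx t Ht). pose proof (By t Ht). pose proof (BRH t Ht). pose proof (BQ1 t Ht).
      pose proof (Bdl t Ht). pose proof (Gp' t Ht). bnd. }
    pose proof (Hd t Ht) as D1. pose proof (Hdd t Ht) as D2. fold (dl t) in D1. fold (dd t) in D2.
    assert (Z : Cmod (dl t * dd t * (- (x t * q (p t) + y t * Q1 t))
            + dl t * dl t * (- ((y t * RH t + x t * (Q1 t + RH t * dl t)) * g' t)))%C
        <= N * e * (N * e) * k1 + N * e * (N * e) * k2).
    { apply bound_plus; (apply bound_mult; [apply bound_mult; assumption|assumption]). }
    eapply Rle_trans; [exact Z|].
    pose proof (Rle_abs k1). pose proof (Rle_abs k2).
    replace (N * e * (N * e) * k1 + N * e * (N * e) * k2) with (N * N * (k1 + k2) * e ^ 2) by ring.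
    apply Rmult_le_compat_r; [exact He2|]. apply Rmult_le_compat_l; [exact HN2|]. assert (0 <= X * Kq) by nra. lra.
  - intros t Ht.
    assert (Y1 : Cmod (- (y t * q (p t)))%C <= X * Kq).
    { pose proof (By t Ht). pose proof (Bq t Ht). bnd. }
    pose proof (Hd t Ht) as D1. pose proof (Hdd t Ht) as D2. fold (dl t) in D1. fold (dd t) in D2.
    assert (Z : Cmod (dl t * dd t * (- (y t * q (p t))))%C <= N * e * (N * e) * (X * Kq)).
    { apply bound_mult; [apply bound_mult; assumption|assumption]. }
    eapply Rle_trans; [exact Z|].
    pose proof (Rabs_pos k1). pose proof (Rabs_pos k2).
    replace (N * e * (N * e) * (X * Kq)) with (N * N * (X * Kq) * e ^ 2) by ring.
    apply Rmult_le_compat_r; [exact He2|]. apply Rmult_le_compat_l; [exact HN2|]. lra.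
Qed.

Lemma transport_bound p g T : tame p g -> transport A B G p g T ->
  forall t, 0 <= t <= 1 -> entries_le (T t) (exp (4 * K)).
Proof.
  intros Hp [T0 HT]. apply (solves_bound g (fun t => q (p t) * g t)%C T K); auto.
  - pose proof NK; lra.
  - apply tame_g_bound with p; auto.
  - apply tame_h_bound; auto.
Qed.

Lemma transport_quadratic : exists c, forall p g p' g' e T T',
  tame p g -> tame p' g' -> 0 <= e <= 1 ->
  (forall t, 0 <= t <= 1 -> Cmod (p' t - p t)%C <= N * e) ->
  (forall t, 0 <= t <= 1 -> Cmod (g' t - g t)%C <= N * e) ->
  transport A B G p g T -> transport A B G p' g' T' ->
  M2close (M2mul (T 1) (first_order_transport (p 1) (p' 1 - p 1)%C)) (M2mul (first_order_transport (p 0) (p' 0 - p 0)%C) (T' 1)) (c * e ^ 2).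
Proof.
  destruct row_defect as [c Hc].
  exists (8 * exp (4 * K) ^ 2 * c). intros p g p' g' e T T' Hp Hp' He Hd Hdd HT HT'.
  pose proof (transport_bound p g T Hp HT) as BT.
  pose proof (transport_bound p' g' T' Hp' HT') as BT'.
  destruct HT as [T0 HT]. destruct HT' as [T0' HT'].
  destruct (Hc p g p' g' e (fun t => m11 (T t)) (fun t => m12 (T t)) Hp Hp' He Hd Hdd) as (ea & eb & H1 & H2 & H3 & H4).
  1-2: intros t Ht; apply HT, Ht. 1-2: intros t Ht; apply BT, Ht.
  destruct (Hc p g p' g' e (fun t => m21 (T t)) (fun t => m22 (T t)) Hp Hp' He Hd Hdd) as (fa & fb & K1 & K2 & K3 & K4).
  1-2: intros t Ht; apply HT, Ht. 1-2: intros t Ht; apply BT, Ht.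
  destruct (defect_row g' _ T' _ _ ea eb _ _ T0' HT' BT' H1 H2 H3 H4) as [R1 R2].
  destruct (defect_row g' _ T' _ _ fa fb _ _ T0' HT' BT' K1 K2 K3 K4) as [R3 R4].
  rewrite T0 in R1, R2, R3, R4. simpl in R1, R2, R3, R4.
  unfold M2close, M2mul, first_order_transport; simpl. rewrite !(Rmult_assoc (8 * _)). repeat split.
  - eapply Rle_trans; [right|exact R1]. f_equal. ring.
  - eapply Rle_trans; [right|exact R2]. f_equal. ring.
  - eapply Rle_trans; [right|exact R3]. f_equal. ring.
  - eapply Rle_trans; [right|exact R4]. f_equal. ring.
Qed.

(** * Invariance under straight-line homotopies *)

Section StraightLine.
Variables p0 g0 p1 g1 : R -> C.
Hypothesis P0 : is_path p0 g0.
Hypothesis P1 : is_path p1 g1.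

Definition line_path (u t : R) : C := (p0 t + RtoC u * (p1 t - p0 t))%C.
Definition line_speed (u t : R) : C := (g0 t + RtoC u * (g1 t - g0 t))%C.

Hypothesis Hfar : forall u t, 0 <= u <= 1 -> 0 <= t <= 1 -> far N (line_path u t).
Hypothesis Hg0 : forall t, 0 <= t <= 1 -> Cmod (g0 t) <= N.
Hypothesis Hg1 : forall t, 0 <= t <= 1 -> Cmod (g1 t) <= N.
Hypothesis Hp01 : forall t, 0 <= t <= 1 -> Cmod (p1 t - p0 t)%C <= N.
Hypothesis Hg01 : forall t, 0 <= t <= 1 -> Cmod (g1 t - g0 t)%C <= N.

Lemma tame_line u : 0 <= u <= 1 -> tame (line_path u) (line_speed u).
Proof.
  intros Hu. destruct P0 as [D0 C0], P1 as [D1 C1]. split; [split|split].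
  - intros t. unfold line_path, line_speed. eapply Cd_eq.
    + apply Cd_plus; [apply D0|apply Cd_mult; [apply Cd_const|apply Cd_minus; auto]].
    + cbv beta. ring.
  - intros t. unfold line_speed. apply Ccont_plus; auto. apply Ccont_mult; [apply Ccont_const|].
    unfold Cminus. apply Ccont_plus; auto.
    destruct (C0 t). split; apply (continuous_opp (V := R_NormedModule)); assumption.
  - auto.
  - intros t Ht. unfold line_speed.
    replace (g0 t + RtoC u * (g1 t - g0 t))%C with (RtoC (1 - u) * g0 t + RtoC u * g1 t)%C.
    + eapply Rle_trans; [apply Cmod_triangle|]. rewrite !Cmod_mult, !Cmod_R, !Rabs_pos_eq by lra.
      pose proof (Hg0 t Ht). pose proof (Hg1 t Ht). nra.
    + rewrite RtoC_minus. ring.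
Qed.

Lemma straight_quadratic : exists c, forall u u' T T', 0 <= u <= 1 -> 0 <= u' <= 1 ->
  transport A B G (line_path u) (line_speed u) T -> transport A B G (line_path u') (line_speed u') T' ->
  M2close (M2mul (T 1) (first_order_transport (line_path u 1) (RtoC (u' - u) * (p1 1 - p0 1))%C))
          (M2mul (first_order_transport (line_path u 0) (RtoC (u' - u) * (p1 0 - p0 0))%C) (T' 1)) (c * (u - u') ^ 2).
Proof.
  destruct transport_quadratic as [c Hc]. exists c. intros u u' T T' Hu Hu' HT HT'.
  pose proof (Hc _ _ _ _ (Rabs (u' - u)) T T' (tame_line u Hu) (tame_line u' Hu')) as H.
  assert (E : forall t, (line_path u' t - line_path u t = RtoC (u' - u) * (p1 t - p0 t))%C).
  { intros t. unfold line_path. rewrite RtoC_minus. ring. }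
  rewrite !E in H. rewrite pow2_abs in H. replace ((u - u') ^ 2) with ((u' - u) ^ 2) by ring.
  apply H; auto.
  - split; [apply Rabs_pos|]. apply Rabs_le; lra.
  - intros t Ht. rewrite E, Cmod_mult, Cmod_R. pose proof (Hp01 t Ht). pose proof (Rabs_pos (u' - u)). nra.
  - intros t Ht. replace (line_speed u' t - line_speed u t)%C with (RtoC (u' - u) * (g1 t - g0 t))%C.
    + rewrite Cmod_mult, Cmod_R. pose proof (Hg01 t Ht). pose proof (Rabs_pos (u' - u)). nra.
    + unfold line_speed. rewrite RtoC_minus. ring.
Qed.

Lemma transport_ext p g p' g' T : (forall t, p t = p' t) -> (forall t, g t = g' t) ->
  transport A B G p g T -> transport A B G p' g' T.
Proof.
  intros Ep Eg [T0 HT]. split; [exact T0|]. intros t Ht. specialize (HT t Ht).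
  rewrite <- Ep, <- Eg. exact HT.
Qed.

Lemma line_path_0 T : transport A B G p0 g0 T -> transport A B G (line_path 0) (line_speed 0) T.
Proof. apply transport_ext; intros t; unfold line_path, line_speed; ring. Qed.

Lemma line_path_1 T : transport A B G p1 g1 T -> transport A B G (line_path 1) (line_speed 1) T.
Proof. apply transport_ext; intros t; unfold line_path, line_speed; ring. Qed.

Lemma M2_ext X Y : m11 X = m11 Y -> m12 X = m12 Y -> m21 X = m21 Y -> m22 X = m22 Y -> X = Y.
Proof. destruct X, Y; simpl; congruence. Qed.

(** With common end points the correction matrices at t = 0 and t = 1 are the identity, so the
    transports themselves are close to second order. *)
Lemma homotopy_fixed_ends T0 T1 : p0 0 = p1 0 -> p0 1 = p1 1 ->
  transport A B G p0 g0 T0 -> transport A B G p1 g1 T1 -> T0 1 = T1 1.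
Proof.
  intros E0 E1 HT0 HT1. destruct straight_quadratic as [c Hc].
  assert (Hcl : forall u u' T T', 0 <= u <= 1 -> 0 <= u' <= 1 ->
    transport A B G (line_path u) (line_speed u) T -> transport A B G (line_path u') (line_speed u') T' ->
    M2close (T 1) (T' 1) (c * (u - u') ^ 2)).
  { intros u u' T T' Hu Hu' HT HT'. pose proof (Hc u u' T T' Hu Hu' HT HT') as H.
    rewrite E0, E1 in H.
    destruct H as (H1 & H2 & H3 & H4). unfold M2mul, first_order_transport in *; simpl in *.
    repeat split; [eapply Rle_trans; [right|exact H1] | eapply Rle_trans; [right|exact H2] |
      eapply Rle_trans; [right|exact H3] | eapply Rle_trans; [right|exact H4]]; f_equal; ring. }
  assert (main : forall f : M2 -> C,
     (forall X Y e, M2close X Y e -> Cmod (f X - f Y)%C <= e) -> f (T0 1) = f (T1 1)).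
  { intros f Hf.
    apply (quadratic_closeness_constant
      (fun u x => exists T, transport A B G (line_path u) (line_speed u) T /\ x = f (T 1)) c).
    - intros u Hu. destruct (transport_exists _ _ (tame_line u Hu)) as [T HT]. eauto.
    - intros u u' x x' Hu Hu' [T [HT ->]] [T' [HT' ->]]. apply Hf. apply Hcl; auto.
    - exists T0. split; auto using line_path_0.
    - exists T1. split; auto using line_path_1. }
  apply M2_ext; apply main; intros X Y e (?&?&?&?); assumption.
Qed.

(** For closed loops the correction F is the same matrix at both ends: T F and F T' agree to second
    order, so T and T' are nearly conjugate. *)
Lemma homotopy_closed_trace T0 T1 : p0 0 = p0 1 -> p1 0 = p1 1 ->
  transport A B G p0 g0 T0 -> transport A B G p1 g1 T1 ->
  (m11 (T0 1) + m22 (T0 1) = m11 (T1 1) + m22 (T1 1))%C.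
Proof.
  intros E0 E1 HT0 HT1. destruct straight_quadratic as [c Hc].
  set (X := exp (4 * K)).
  set (c' := c + N * c + Kq * N * c + c + Kq * N * N * (X + X + (X + X))).
  apply (quadratic_closeness_constant
    (fun u x => exists T, transport A B G (line_path u) (line_speed u) T /\ x = (m11 (T 1) + m22 (T 1))%C) c').
  - intros u Hu. destruct (transport_exists _ _ (tame_line u Hu)) as [T HT]. eauto.
  - intros u u' x x' Hu Hu' [T [HT ->]] [T' [HT' ->]].
    pose proof (Hc u u' T T' Hu Hu' HT HT') as H.
    pose proof (transport_bound _ _ _ (tame_line u Hu) HT 1 ltac:(lra)) as (B1 & _ & _ & B2).
    pose proof (transport_bound _ _ _ (tame_line u' Hu') HT' 1 ltac:(lra)) as (B3 & _ & _ & B4).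
    assert (Eh : line_path u 0 = line_path u 1) by (unfold line_path; rewrite E0, E1; reflexivity).
    rewrite E0, E1, Eh in H. set (d := (RtoC (u' - u) * (p1 1 - p0 1))%C) in *.
    assert (Hd1 : Cmod d <= N * Rabs (u' - u)).
    { unfold d. rewrite Cmod_mult, Cmod_R. pose proof (Hp01 1 ltac:(lra)). pose proof (Rabs_pos (u' - u)). nra. }
    assert (Hd : Cmod d <= N).
    { eapply Rle_trans; [exact Hd1|]. assert (Rabs (u' - u) <= 1) by (apply Rabs_le; lra). nra. }
    pose proof (qpot_bound (line_path u 1) (Hfar u 1 Hu ltac:(lra))) as Hq.
    destruct H as (H1 & H2 & H3 & H4).
    set (P := M2mul (T 1) (first_order_transport (line_path u 1) d)) in *. set (P' := M2mul (first_order_transport (line_path u 1) d) (T' 1)) in *.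
    set (e2 := (u - u') ^ 2) in *.
    (* Here F = [[1, d], [q d, 1]] has determinant 1 - q d^2, and tr((T F - F T') adj F) = (1 - q
       d^2) (tr T - tr T'). Moving the q d^2 term to the right avoids a division, as it is already
       of second order. The constant [c'] has one summand for each term of this identity. *)
    assert (Z : (m11 (T 1) + m22 (T 1) - (m11 (T' 1) + m22 (T' 1)) =
       (m11 P - m11 P') - d * (m21 P - m21 P') - q (line_path u 1) * d * (m12 P - m12 P') + (m22 P - m22 P')
       + q (line_path u 1) * (d * d) * (m11 (T 1) + m22 (T 1) - (m11 (T' 1) + m22 (T' 1))))%C).
    { unfold P, P', M2mul, first_order_transport; simpl. ring. }
    rewrite Z.
    assert (Hdd : Cmod (d * d)%C <= N * N * e2).
    { eapply Rle_trans; [apply bound_mult; exact Hd1|]. right.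
      unfold e2. replace ((u - u') ^ 2) with ((u' - u) ^ 2) by ring. rewrite <- (pow2_abs (u' - u)). ring. }
    eapply Rle_trans.
    + apply bound_plus; [apply bound_plus; [apply bound_minus; [apply bound_minus|]|]|].
      * exact H1.
      * apply bound_mult; eassumption.
      * apply bound_mult; [apply bound_mult; eassumption|eassumption].
      * exact H4.
      * apply bound_mult; [apply bound_mult; eassumption|].
        apply bound_minus; apply bound_plus; eassumption.
    + unfold c'. fold X. right. ring.
  - exists T0. split; auto using line_path_0.
  - exists T1. split; auto using line_path_1.
Qed.
End StraightLine.
End Homotopy.

(** * Monodromy traces *)

Lemma Cexpi_plus a b : Cexpi (a + b) = (Cexpi a * Cexpi b)%C.
Proof. unfold Cexpi. apply C_ext; simpl; [rewrite cos_plus|rewrite sin_plus]; ring. Qed.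

Lemma Cexpi_0 : Cexpi 0 = 1%C.
Proof. unfold Cexpi. rewrite cos_0, sin_0. reflexivity. Qed.

Lemma Cexpi_2PI : Cexpi (2 * PI) = 1%C.
Proof. unfold Cexpi. rewrite cos_2PI, sin_2PI. reflexivity. Qed.

Lemma Cmod_Cexpi a : Cmod (Cexpi a) = 1.
Proof.
  unfold Cexpi, Cmod; simpl. replace (_ + _) with 1; [apply sqrt_1|].
  pose proof (sin2_cos2 a) as H. unfold Rsqr in H. lra.
Qed.

Lemma Cexpi_opp a : (Cexpi a * Cexpi (- a))%C = 1%C.
Proof. rewrite <- Cexpi_plus, Rplus_opp_r. apply Cexpi_0. Qed.

Lemma Cexpi_Cd a t : Cd (fun s => Cexpi (a * s)) t (Ci * RtoC a * Cexpi (a * t))%C.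
Proof. unfold Cexpi. split; simpl; auto_derive; trivial; ring. Qed.

Lemma Cmod_Ci_mult a z : 0 <= a -> Cmod (Ci * RtoC a * z)%C = a * Cmod z.
Proof. intros. rewrite !Cmod_mult, Cmod_Ci, Cmod_R, Rabs_pos_eq by lra. ring. Qed.

Lemma circ_path c v : is_path (circ c v) (dcirc v).
Proof.
  assert (D : forall t, Cd (circ c v) t (dcirc v t)).
  { intros t. unfold circ, dcirc. eapply Cd_eq.
    - apply Cd_plus; [apply Cd_const|apply Cd_mult; [apply Cd_const|apply Cexpi_Cd]].
    - cbv beta. ring. }
  split; [exact D|]. intros t. unfold dcirc. apply Ccont_mult; [apply Ccont_const|].
  eapply Ccont_of_Cd, Cexpi_Cd.
Qed.

Lemma circ_closed c v : circ c v 0 = circ c v 1.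
Proof. unfold circ. rewrite Rmult_0_r, Rmult_1_r, Cexpi_0, Cexpi_2PI. reflexivity. Qed.

Lemma dcirc_bound v t : Cmod (dcirc v t) = 2 * PI * Cmod v.
Proof.
  unfold dcirc. rewrite Cmod_mult, Cmod_Ci_mult, Cmod_Cexpi by (pose proof PI_RGT_0; lra). ring.
Qed.

(* In the frame diag(zeta, 1) the system on a circle is 2 pi i [[1, 1], [zeta^2 q, 0]];
   when zeta^2 q is close to k = mu (mu - 1), the vector (1, mu - 1) is almost an
   eigenvector of the monodromy, with eigenvalue exp(2 pi i mu). *)
Lemma circle_char_estimate A B G (mu : R) : exists cst, forall (c v : C) T e, v <> 0%C -> 0 <= e <= 1 ->
  (forall t, 0 <= t <= 1 ->
    Cmod (v * Cexpi (2 * PI * t) * (v * Cexpi (2 * PI * t)) * qpot A B G (circ c v t)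
          - RtoC mu * (RtoC mu - 1))%C <= e) ->
  transport A B G (circ c v) (dcirc v) T ->
  Cmod (1 - Cexpi (2 * PI * mu) * (m11 (T 1) + m22 (T 1))
     + Cexpi (2 * PI * mu) * Cexpi (2 * PI * mu))%C <= cst * e.
Proof.
  set (kap := (RtoC mu * (RtoC mu - 1))%C).
  set (K := 2 * PI * (2 + Cmod kap)).
  set (X := exp (4 * K)).
  pose proof PI_RGT_0 as HPI. pose proof (Cmod_ge_0 kap) as Hkap.
  assert (HK : 0 <= K) by (unfold K; nra).
  exists (2 * (2 * PI * X) * (X + 1) + X * (2 * (2 * PI * X))).
  intros c v T e Hv He Hp [T0 HT].
  set (E := fun t => Cexpi (2 * PI * t)).
  set (p := fun t => (v * E t * (v * E t) * qpot A B G (circ c v t))%C).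
  assert (Hp' : forall t, 0 <= t <= 1 -> Cmod (p t - kap)%C <= e) by exact Hp.
  assert (Bp : forall t, 0 <= t <= 1 -> Cmod (p t) <= 1 + Cmod kap).
  { intros t Ht. replace (p t) with ((p t - kap) + kap)%C by ring.
    eapply Rle_trans; [apply Cmod_triangle|]. pose proof (Hp' t Ht). lra. }
  set (I2 := (Ci * RtoC (2 * PI))%C).
  assert (BI2 : forall z, Cmod (I2 * z)%C = 2 * PI * Cmod z) by (intros; apply Cmod_Ci_mult; lra).
  assert (CdE : forall t, Cd E t (I2 * E t)%C) by (intros; apply Cexpi_Cd).
  assert (row : forall a b : R -> C,
    (forall t, 0 <= t <= 1 -> Cd a t (I2 * (a t + b t * p t))%C) ->
    (forall t, 0 <= t <= 1 -> Cd b t (I2 * a t)%C) ->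
    Cmod (a 0) ^ 2 + Cmod (b 0) ^ 2 = 1 ->
    Cmod (a 1) <= X /\ Cmod (b 1) <= X /\
    Cmod (a 1 + b 1 * (RtoC mu - 1) - E mu * (a 0 + b 0 * (RtoC mu - 1)))%C <= 2 * (2 * PI * X) * e).
  { intros a b Ha Hb Hi.
    assert (Bab : forall t, 0 <= t <= 1 -> Cmod (a t) <= X /\ Cmod (b t) <= X).
    { intros t Ht. pose proof (row_bound a b _ _ K HK Ha Hb) as RB. rewrite Hi in RB.
      assert (X1 : 1 <= X).
      { unfold X. rewrite <- exp_0. destruct (Req_dec (4 * K) 0) as [->|]; [lra|].
        left; apply exp_increasing; lra. }
      assert (RB' : Cmod (a t) ^ 2 + Cmod (b t) ^ 2 <= 1 * X).
      { apply RB; auto.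
        - intros s Hs. rewrite BI2. unfold K. rewrite (Rmult_assoc (2 * PI) (2 + Cmod kap)).
          apply Rmult_le_compat_l; [lra|].
          eapply Rle_trans; [apply Cmod_triangle|]. rewrite Cmod_mult.
          pose proof (Bp s Hs). pose proof (Cmod_ge_0 (a s)). pose proof (Cmod_ge_0 (b s)). nra.
        - intros s Hs. rewrite BI2. unfold K. rewrite (Rmult_assoc (2 * PI) (2 + Cmod kap)).
          apply Rmult_le_compat_l; [lra|].
          pose proof (Cmod_ge_0 (a s)). pose proof (Cmod_ge_0 (b s)). nra. }
      pose proof (Cmod_ge_0 (a t)). pose proof (Cmod_ge_0 (b t)). split; nra. }
    destruct (Bab 1 ltac:(lra)) as [Ba1 Bb1]. repeat split; auto.
    (* Since (1, mu - 1) is a right eigenvector of [[1, 1], [kap, 0]] for mu, the derivative of w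
       contains only p - kap. *)
    set (w := fun t => (Cexpi (2 * PI * - mu * t) * (a t + b t * (RtoC mu - 1)))%C).
    assert (Hw : Cmod (w 1 - w 0)%C <= 2 * (2 * PI * X * e) * (1 - 0)).
    { apply (C_mean_value w (fun t => Cexpi (2 * PI * - mu * t) * (I2 * (b t * (p t - kap))))%C); [lra| |].
      - intros t Ht. unfold w. eapply Cd_eq.
        + apply Cd_mult; [apply Cexpi_Cd|].
          apply Cd_plus; [apply Ha, Ht|apply Cd_mult; [apply Hb, Ht|apply Cd_const]].
        + cbv beta. unfold kap, I2.
          rewrite !RtoC_mult, RtoC_opp. ring.
      - intros t Ht. rewrite Cmod_mult, Cmod_Cexpi, BI2, Rmult_1_l, Cmod_mult, (Rmult_assoc (2 * PI) X e).
        apply Rmult_le_compat_l; [lra|].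
        apply Rmult_le_compat; auto using Cmod_ge_0. apply Bab, Ht. }
    replace (a 1 + b 1 * (RtoC mu - 1) - E mu * (a 0 + b 0 * (RtoC mu - 1)))%C
      with (E mu * (w 1 - w 0))%C.
    - rewrite Cmod_mult. unfold E. rewrite Cmod_Cexpi. lra.
    - unfold w. rewrite Rmult_0_r, Cexpi_0, Rmult_1_r.
      assert (EE : (E mu * Cexpi (2 * PI * - mu) = 1)%C).
      { unfold E. replace (2 * PI * - mu) with (- (2 * PI * mu)) by ring. apply Cexpi_opp. }
      replace (a 1 + b 1 * (RtoC mu - 1))%C
        with ((E mu * Cexpi (2 * PI * - mu)) * (a 1 + b 1 * (RtoC mu - 1)))%C at 2
        by (rewrite EE; ring). ring. }
  (* Dividing the first row by v makes the initial matrix the identity in the rescaled frame, so the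
     estimates are uniform as the radius tends to 0 or infinity. *)
  destruct (row (fun t => m11 (T t) * E t)%C (fun t => m12 (T t) * / v)%C) as (_ & R2 & R3).
  { intros t Ht. destruct (HT t Ht) as (H1 & _). eapply Cd_eq; [apply Cd_mult; [exact H1|apply CdE]|].
    cbv beta. unfold p, dcirc, I2. fold (E t). field. exact Hv. }
  { intros t Ht. destruct (HT t Ht) as (_ & H1 & _).
    eapply Cd_eq; [apply Cd_mult; [exact H1|apply Cd_const]|].
    cbv beta. unfold dcirc, I2. fold (E t). field. exact Hv. }
  { rewrite T0. simpl m11. simpl m12. unfold E. rewrite Rmult_0_r, Cexpi_0.
    rewrite !Cmod_mult, Cmod_1, Cmod_0. ring. }
  destruct (row (fun t => m21 (T t) * (v * E t))%C (fun t => m22 (T t))%C) as (_ & R5 & R6).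
  { intros t Ht. destruct (HT t Ht) as (_ & _ & H1 & _).
    eapply Cd_eq; [apply Cd_mult; [exact H1|apply Cd_mult; [apply Cd_const|apply CdE]]|].
    cbv beta. unfold p, dcirc, I2. fold (E t). ring. }
  { intros t Ht. destruct (HT t Ht) as (_ & _ & _ & H1).
    eapply Cd_eq; [exact H1|]. unfold dcirc, I2. fold (E t). ring. }
  { rewrite T0. simpl m21. simpl m22. rewrite !Cmod_mult, Cmod_1, Cmod_0. ring. }
  pose proof (solves_det _ _ _ HT 1 ltac:(lra)) as Hdet. rewrite T0 in Hdet.
  unfold M2det in Hdet; simpl in Hdet.
  assert (E1 : E 1 = 1%C) by (unfold E; rewrite Rmult_1_r; apply Cexpi_2PI).
  assert (E00 : E 0 = 1%C) by (unfold E; rewrite Rmult_0_r; apply Cexpi_0).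
  cbv beta in *. rewrite E1, E00, T0 in *. simpl m11 in *. simpl m12 in *. simpl m21 in *. simpl m22 in *.
  fold (E mu) in *.
  match type of R3 with Cmod ?z <= _ => set (x := z) in * end.
  match type of R6 with Cmod ?z <= _ => set (y := z) in * end.
  (* For the rescaled monodromy M, x and y are the entries of (M - E mu) applied to (1, mu - 1).
     Replacing the first column of M - E mu by this vector leaves the determinant unchanged, so the
     characteristic polynomial is linear in x and y. *)
  replace (1 - E mu * (m11 (T 1) + m22 (T 1)) + E mu * E mu)%C
    with (x * (m22 (T 1) - E mu) - (m12 (T 1) * / v) * y)%C.
  - eapply Rle_trans.
    + apply bound_minus; apply bound_mult; [exact R3| |exact R2|exact R6].
      apply bound_minus; [exact R5|]. unfold E. rewrite Cmod_Cexpi. apply Rle_refl.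
    + right. ring.
  - unfold x, y.
    replace (1 - E mu * (m11 (T 1) + m22 (T 1)) + E mu * E mu)%C
      with ((m11 (T 1) * m22 (T 1) - m12 (T 1) * m21 (T 1)) - E mu * (m11 (T 1) + m22 (T 1)) + E mu * E mu)%C
      by (rewrite Hdet; ring).
    field. exact Hv.
Qed.

Lemma far_mono N N' z : 0 < N <= N' -> far N z -> far N' z.
Proof.
  intros H [F1 F2]. assert (/ N' <= / N) by (apply Rinv_le_contravar; lra). split; lra.
Qed.

(** The straight-line homotopy passes through the concentric circles with radius factor 1 + u (x -
    1). *)
Lemma concentric_trace A B G c v x N T T' : 1 <= N -> 0 < x ->
  (forall r t, (x <= r <= 1 \/ 1 <= r <= x) -> far N (c + RtoC r * v * Cexpi (2 * PI * t))%C) ->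
  transport A B G (circ c v) (dcirc v) T ->
  transport A B G (circ c (RtoC x * v)) (dcirc (RtoC x * v)) T' ->
  (m11 (T 1) + m22 (T 1) = m11 (T' 1) + m22 (T' 1))%C.
Proof.
  intros HN Hx HF HT HT'. pose proof PI_RGT_0.
  pose proof (Cmod_ge_0 A). pose proof (Cmod_ge_0 B). pose proof (Cmod_ge_0 G). pose proof (Cmod_ge_0 v).
  set (V := 2 * PI * Cmod v + Cmod v).
  assert (HV : 0 <= V) by (unfold V; nra).
  set (N' := N + Cmod A + Cmod B + Cmod G + V * (1 + x)).
  assert (0 <= V * x) by nra.
  assert (Hpi : 0 <= 2 * PI * Cmod v) by nra.
  assert (Hpx : 0 <= 2 * PI * Cmod v * x) by (apply Rmult_le_pos; lra).
  assert (Hvx : 0 <= Cmod v * x) by nra.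
  apply (homotopy_closed_trace A B G N' ltac:(unfold N'; lra) ltac:(unfold N'; lra) ltac:(unfold N'; lra)
     ltac:(unfold N'; lra) (circ c v) (dcirc v) (circ c (RtoC x * v)) (dcirc (RtoC x * v)));
     auto using circ_path, circ_closed.
  - intros u t Hu Ht. apply far_mono with N; [unfold N'; lra|].
    replace (line_path (circ c v) (circ c (RtoC x * v)) u t)
      with (c + RtoC (1 + u * (x - 1)) * v * Cexpi (2 * PI * t))%C.
    + apply HF. destruct (Rle_dec x 1); [left|right]; nra.
    + unfold line_path, circ. rewrite RtoC_plus, RtoC_mult, RtoC_minus. ring.
  - intros t _. rewrite dcirc_bound. unfold N', V. lra.
  - intros t _. rewrite dcirc_bound, Cmod_mult, Cmod_R, Rabs_pos_eq by lra. unfold N', V. lra.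
  - intros t _. replace (circ c (RtoC x * v) t - circ c v t)%C
      with (RtoC x * (v * Cexpi (2 * PI * t)) - v * Cexpi (2 * PI * t))%C by (unfold circ; ring).
    eapply Rle_trans; [apply bound_minus; apply Rle_refl|].
    rewrite !Cmod_mult, Cmod_Cexpi, Cmod_R, Rabs_pos_eq by lra. unfold N', V. lra.
  - intros t _. eapply Rle_trans; [apply bound_minus; apply Rle_refl|].
    rewrite !dcirc_bound, Cmod_mult, Cmod_R, Rabs_pos_eq by lra. unfold N', V. lra.
Qed.

Lemma circle_transport_exists A B G c v N : 1 <= N ->
  (forall t, far N (circ c v t)) -> exists T, transport A B G (circ c v) (dcirc v) T.
Proof.
  intros HN HF. pose proof PI_RGT_0.
  pose proof (Cmod_ge_0 A). pose proof (Cmod_ge_0 B). pose proof (Cmod_ge_0 G). pose proof (Cmod_ge_0 v).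
  assert (0 <= 2 * PI * Cmod v) by nra.
  set (N' := N + Cmod A + Cmod B + Cmod G + 2 * PI * Cmod v).
  apply (transport_exists A B G N' ltac:(unfold N'; lra) ltac:(unfold N'; lra) ltac:(unfold N'; lra)
     ltac:(unfold N'; lra)).
  split; [apply circ_path|split].
  - intros t _. apply far_mono with N; [unfold N'; lra|auto].
  - intros t _. rewrite dcirc_bound. unfold N'; lra.
Qed.

Lemma trace_of_char (tr : C) (mu : R) :
  (1 - Cexpi (2 * PI * mu) * tr + Cexpi (2 * PI * mu) * Cexpi (2 * PI * mu) = 0)%C ->
  tr = RtoC (2 * cos (2 * PI * mu)).
Proof.
  intros H. pose proof (Cexpi_opp (2 * PI * mu)) as E.
  assert (Z : tr = (Cexpi (- (2 * PI * mu)) + Cexpi (2 * PI * mu))%C).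
  { set (e := Cexpi (2 * PI * mu)) in *. set (f := Cexpi (- (2 * PI * mu))) in *.
    assert (X : (f * (1 - e * tr + e * e) = f * 0)%C) by (rewrite H; reflexivity).
    replace (f * (1 - e * tr + e * e))%C with (f - (e * f) * tr + (e * f) * e)%C in X by ring.
    rewrite E in X. replace tr with (f + e - (f - 1 * tr + 1 * e))%C by ring. rewrite X. ring. }
  rewrite Z. unfold Cexpi. rewrite cos_neg, sin_neg. apply C_ext; simpl; ring.
Qed.

(** The characteristic expression depends on the trace alone, which passing to v' does not change,
    while the estimate holds for every e with a constant independent of v'. *)
Lemma trace_from_limit A B G c v (mu : R) T :
  (forall e, 0 < e <= 1 -> exists (v' : C) T', v' <> 0%C /\
     transport A B G (circ c v') (dcirc v') T' /\
     (m11 (T 1) + m22 (T 1) = m11 (T' 1) + m22 (T' 1))%C /\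
     forall t, Cmod (v' * Cexpi (2 * PI * t) * (v' * Cexpi (2 * PI * t)) * qpot A B G (circ c v' t)
          - RtoC mu * (RtoC mu - 1))%C <= e) ->
  transport A B G (circ c v) (dcirc v) T ->
  (m11 (T 1) + m22 (T 1))%C = RtoC (2 * cos (2 * PI * mu)).
Proof.
  intros Hlim HT. apply trace_of_char.
  destruct (circle_char_estimate A B G mu) as [k Hk].
  apply Cmod_eq_0.
  set (z := (1 - _ + _)%C).
  destruct (Rle_lt_or_eq_dec 0 _ (Cmod_ge_0 z)) as [Hp|He]; [|auto]. exfalso.
  set (e := Rmin 1 (Cmod z / (2 * (Rabs k + 1)))).
  pose proof (Rabs_pos k). pose proof (Rle_abs k).
  assert (He : 0 < e <= 1).
  { unfold e. split; [apply Rmin_glb_lt; [lra|apply Rdiv_lt_0_compat; lra]|apply Rmin_l]. }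
  destruct (Hlim e He) as (v' & T' & Hv' & HT' & Etr & Hest).
  pose proof (Hk c v' T' e Hv' ltac:(lra) (fun t _ => Hest t) HT') as F.
  rewrite <- Etr in F. fold z in F.
  assert (e <= Cmod z / (2 * (Rabs k + 1))) by apply Rmin_r.
  assert (e * (2 * (Rabs k + 1)) <= Cmod z).
  { apply (Rmult_le_compat_r (2 * (Rabs k + 1))) in H1; [|lra].
    replace (Cmod z / (2 * (Rabs k + 1)) * (2 * (Rabs k + 1))) with (Cmod z) in H1 by (field; lra).
    exact H1. }
  nra.
Qed.

Lemma Cmod_minus_ge x y : Cmod x - Cmod y <= Cmod (x - y)%C.
Proof.
  pose proof (Cmod_triangle (x - y)%C y) as H.
  replace (x - y + y)%C with x in H by ring. lra.
Qed.

Lemma Cmod_plus_ge x y : Cmod x - Cmod y <= Cmod (x + y)%C.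
Proof.
  pose proof (Cmod_minus_ge x (- y)%C) as H. rewrite Cmod_opp in H.
  replace (x - - y)%C with (x + y)%C in H by ring. lra.
Qed.

(** The value 13/16 is |z0|^2 = |z0 - 1|^2. The bound 91/100 keeps the loop about 0 or 1 at distance
    9/100 > 1/12 from the other finite puncture. *)
Lemma small_radius_ineq (v : C) : Cmod v ^ 2 = 13 / 16 -> 1/2 <= Cmod v <= 91/100.
Proof. intros H. pose proof (Cmod_ge_0 v). split; nra. Qed.

Lemma neq0_of_Cmod z : 0 < Cmod z -> z <> 0%C.
Proof. intros H E. rewrite E, Cmod_0 in H. lra. Qed.

(** As z tends to 0, z^2 q - A = B (z / (z - 1))^2 + G z / (z - 1) tends to 0. *)
Lemma trace_at_0 A B G mu T : A = (RtoC mu * (RtoC mu - 1))%C ->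
  transport A B G (circ ctr0 (v_of ctr0)) (dcirc (v_of ctr0)) T ->
  (m11 (T 1) + m22 (T 1))%C = RtoC (2 * cos (2 * PI * mu)).
Proof.
  intros HA HT. apply (trace_from_limit A B G ctr0 (v_of ctr0) mu T); [|exact HT].
  set (v := v_of ctr0) in *.
  assert (Hv : 1/2 <= Cmod v <= 91/100).
  { apply small_radius_ineq. rewrite Cmod_sq. unfold v, v_of, z0, ctr0; simpl. field. }
  intros e He. pose proof (Cmod_ge_0 B). pose proof (Cmod_ge_0 G).
  set (eta := e / (1 + Cmod B + Cmod G)).
  assert (Heta : 0 < eta) by (apply Rdiv_lt_0_compat; lra).
  assert (Heta1 : eta * (1 + Cmod B + Cmod G) = e) by (unfold eta; field; lra).
  assert (eta <= 1) by nra.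
  (* From |z| <= x and |z - 1| >= 1/12 follows |z / (z - 1)| <= 12 x = eta. *)
  set (x := eta / 12).
  assert (Hx : 0 < x <= 1/12) by (unfold x; lra).
  assert (HF : forall r t, 0 < x <= r -> r <= 1 -> far (12 + 2 / x) (ctr0 + RtoC r * v * Cexpi (2 * PI * t))%C).
  { intros r t Hr Hr1. set (z := (RtoC r * v * Cexpi (2 * PI * t))%C).
    assert (Hz : Cmod z = r * Cmod v).
    { unfold z. rewrite !Cmod_mult, Cmod_Cexpi, Cmod_R, Rabs_pos_eq by lra. ring. }
    replace (ctr0 + z)%C with z by (unfold ctr0; ring).
    assert (0 < 2 / x) by (apply Rdiv_lt_0_compat; lra).
    split.
    - rewrite Hz. apply Rle_trans with (/ (2 / x)); [apply Rinv_le_contravar; lra|].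
      replace (/ (2 / x)) with (x / 2) by (field; lra). nra.
    - apply Rle_trans with (/ 12); [apply Rinv_le_contravar; lra|].
      replace (z - 1)%C with (- (1 - z))%C by ring. rewrite Cmod_opp.
      pose proof (Cmod_minus_ge 1 z). rewrite Cmod_1 in *. nra. }
  assert (0 < 2 / x) by (apply Rdiv_lt_0_compat; lra).
  destruct (circle_transport_exists A B G ctr0 (RtoC x * v) (12 + 2 / x)) as [T' HT'].
  { lra. } { intros t. apply HF; lra. }
  exists (RtoC x * v)%C, T'. split; [|split; [exact HT'|split]].
  - apply neq0_of_Cmod. rewrite Cmod_mult, Cmod_R, Rabs_pos_eq by lra. nra.
  - apply (concentric_trace A B G ctr0 v x (12 + 2 / x)); auto; try lra.
    intros r t [Hr|Hr]; [apply HF; lra | lra].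
  - intros t. set (z := (RtoC x * v * Cexpi (2 * PI * t))%C).
    assert (Hz : Cmod z <= x).
    { unfold z. rewrite !Cmod_mult, Cmod_Cexpi, Cmod_R, Rabs_pos_eq by lra. nra. }
    assert (Hz1 : 1/12 <= Cmod (z - 1)%C).
    { replace (z - 1)%C with (- (1 - z))%C by ring. rewrite Cmod_opp.
      pose proof (Cmod_minus_ge 1 z). rewrite Cmod_1 in *. lra. }
    assert (Zn : (z - 1)%C <> 0%C) by (apply neq0_of_Cmod; lra).
    assert (Zn0 : z <> 0%C).
    { apply neq0_of_Cmod. unfold z. rewrite !Cmod_mult, Cmod_Cexpi, Cmod_R, Rabs_pos_eq by lra. nra. }
    replace (circ ctr0 (RtoC x * v) t) with z by (unfold circ, ctr0, z; ring).
    rewrite <- HA.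
    replace (z * z * qpot A B G z - A)%C with (B * ((z / (z - 1)) * (z / (z - 1))) + G * (z / (z - 1)))%C
      by (unfold qpot; field; auto).
    assert (Ha : Cmod (z / (z - 1))%C <= eta).
    { unfold Cdiv. rewrite Cmod_mult, Cmod_inv by exact Zn.
      apply Rle_trans with (x * 12); [|unfold x; lra].
      apply Rmult_le_compat; [apply Cmod_ge_0|left; apply Rinv_0_lt_compat; lra|exact Hz|].
      replace 12 with (/ (1/12)) by field. apply Rinv_le_contravar; lra. }
    assert (Hee : eta * eta <= eta) by nra.
    assert (HXe : Cmod B * (eta * eta) <= Cmod B * eta) by (apply Rmult_le_compat_l; lra).
    eapply Rle_trans; [bnd|]. lra.
Qed.

Lemma trace_at_1 A B G mu T : B = (RtoC mu * (RtoC mu - 1))%C ->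
  transport A B G (circ ctr1 (v_of ctr1)) (dcirc (v_of ctr1)) T ->
  (m11 (T 1) + m22 (T 1))%C = RtoC (2 * cos (2 * PI * mu)).
Proof.
  intros HB HT. apply (trace_from_limit A B G ctr1 (v_of ctr1) mu T); [|exact HT].
  set (v := v_of ctr1) in *.
  assert (Hv : 1/2 <= Cmod v <= 91/100).
  { apply small_radius_ineq. rewrite Cmod_sq. unfold v, v_of, z0, ctr1; simpl. field. }
  intros e He. pose proof (Cmod_ge_0 A). pose proof (Cmod_ge_0 G).
  set (eta := e / (1 + Cmod A + Cmod G)).
  assert (Heta : 0 < eta) by (apply Rdiv_lt_0_compat; lra).
  assert (Heta1 : eta * (1 + Cmod A + Cmod G) = e) by (unfold eta; field; lra).
  assert (eta <= 1) by nra.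
  set (x := eta / 12).
  assert (Hx : 0 < x <= 1/12) by (unfold x; lra).
  assert (HF : forall r t, 0 < x <= r -> r <= 1 -> far (12 + 2 / x) (ctr1 + RtoC r * v * Cexpi (2 * PI * t))%C).
  { intros r t Hr Hr1. set (z := (RtoC r * v * Cexpi (2 * PI * t))%C).
    assert (Hz : Cmod z = r * Cmod v).
    { unfold z. rewrite !Cmod_mult, Cmod_Cexpi, Cmod_R, Rabs_pos_eq by lra. ring. }
    assert (0 < 2 / x) by (apply Rdiv_lt_0_compat; lra).
    unfold ctr1. split.
    - apply Rle_trans with (/ 12); [apply Rinv_le_contravar; lra|].
      pose proof (Cmod_plus_ge 1 z). rewrite Cmod_1 in *. nra.
    - replace (1 + z - 1)%C with z by ring.
      rewrite Hz. apply Rle_trans with (/ (2 / x)); [apply Rinv_le_contravar; lra|].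
      replace (/ (2 / x)) with (x / 2) by (field; lra). nra. }
  assert (0 < 2 / x) by (apply Rdiv_lt_0_compat; lra).
  destruct (circle_transport_exists A B G ctr1 (RtoC x * v) (12 + 2 / x)) as [T' HT'].
  { lra. } { intros t. apply HF; lra. }
  exists (RtoC x * v)%C, T'. split; [|split; [exact HT'|split]].
  - apply neq0_of_Cmod. rewrite Cmod_mult, Cmod_R, Rabs_pos_eq by lra. nra.
  - apply (concentric_trace A B G ctr1 v x (12 + 2 / x)); auto; try lra.
    intros r t [Hr|Hr]; [apply HF; lra | lra].
  - intros t. set (z := (RtoC x * v * Cexpi (2 * PI * t))%C).
    assert (Hz : Cmod z <= x).
    { unfold z. rewrite !Cmod_mult, Cmod_Cexpi, Cmod_R, Rabs_pos_eq by lra. nra. }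
    assert (Hz1 : 1/12 <= Cmod (1 + z)%C).
    { pose proof (Cmod_plus_ge 1 z). rewrite Cmod_1 in *. lra. }
    assert (Zn : (1 + z)%C <> 0%C) by (apply neq0_of_Cmod; lra).
    assert (Zn0 : z <> 0%C).
    { apply neq0_of_Cmod. unfold z. rewrite !Cmod_mult, Cmod_Cexpi, Cmod_R, Rabs_pos_eq by lra. nra. }
    replace (circ ctr1 (RtoC x * v) t) with (1 + z)%C by (unfold circ, ctr1, z; ring).
    rewrite <- HB.
    replace (z * z * qpot A B G (1 + z) - B)%C with (A * ((z / (1 + z)) * (z / (1 + z))) + G * (z / (1 + z)))%C.
    2:{ unfold qpot. replace (1 + z - 1)%C with z by ring. field; auto. }
    assert (Ha : Cmod (z / (1 + z))%C <= eta).
    { unfold Cdiv. rewrite Cmod_mult, Cmod_inv by exact Zn.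
      apply Rle_trans with (x * 12); [|unfold x; lra].
      apply Rmult_le_compat; [apply Cmod_ge_0|left; apply Rinv_0_lt_compat; lra|exact Hz|].
      replace 12 with (/ (1/12)) by field. apply Rinv_le_contravar; lra. }
    assert (Hee : eta * eta <= eta) by nra.
    assert (HXe : Cmod A * (eta * eta) <= Cmod A * eta) by (apply Rmult_le_compat_l; lra).
    eapply Rle_trans; [bnd|]. lra.
Qed.

(** Here the radius grows: z^2 q tends to A + B + G at infinity. *)
Lemma trace_at_inf A B G mu T : (A + B + G)%C = (RtoC mu * (RtoC mu - 1))%C ->
  transport A B G (circ ctrInf (v_of ctrInf)) (dcirc (v_of ctrInf)) T ->
  (m11 (T 1) + m22 (T 1))%C = RtoC (2 * cos (2 * PI * mu)).
Proof.
  intros HS HT. apply (trace_from_limit A B G ctrInf (v_of ctrInf) mu T); [|exact HT].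
  set (v := v_of ctrInf) in *.
  assert (Hv : Cmod v = 3/4).
  { assert (Cmod v ^ 2 = 9/16) by (rewrite Cmod_sq; unfold v, v_of, z0, ctrInf; simpl; field).
    pose proof (Cmod_ge_0 v). nra. }
  intros e He. pose proof (Cmod_ge_0 A). pose proof (Cmod_ge_0 B). pose proof (Cmod_ge_0 G).
  set (S := 1 + 3 * (Cmod A + Cmod B + Cmod G)).
  set (eta := e / S).
  assert (HS1 : 1 <= S) by (unfold S; lra).
  assert (Heta : 0 < eta) by (apply Rdiv_lt_0_compat; lra).
  assert (Heta1 : eta * S = e) by (unfold eta; field; lra).
  assert (eta <= 1) by nra.
  set (x := 4 / eta).
  assert (Hx : x * eta = 4) by (unfold x; field; lra).
  assert (Hx4 : 4 <= x) by nra.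
  assert (Hhalf : Cmod (1/2)%R = 1/2) by (rewrite Cmod_R, Rabs_pos_eq; lra).
  assert (HF : forall r t, 1 <= r -> far 4 (ctrInf + RtoC r * v * Cexpi (2 * PI * t))%C).
  { intros r t Hr. set (z := (RtoC r * v * Cexpi (2 * PI * t))%C).
    assert (Hz : Cmod z = r * (3/4)).
    { unfold z. rewrite !Cmod_mult, Cmod_Cexpi, Cmod_R, Rabs_pos_eq, Hv by lra. ring. }
    unfold ctrInf. split.
    - pose proof (Cmod_plus_ge z (1/2)%R). rewrite Cplus_comm. lra.
    - pose proof (Cmod_minus_ge z (1/2)%R).
      replace (RtoC (1/2) + z - 1)%C with (z - RtoC (1/2))%C by (apply C_ext; simpl; field). lra. }
  destruct (circle_transport_exists A B G ctrInf (RtoC x * v) 4) as [T' HT'].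
  { lra. } { intros t. apply HF; lra. }
  exists (RtoC x * v)%C, T'. split; [|split; [exact HT'|split]].
  - apply neq0_of_Cmod. rewrite Cmod_mult, Cmod_R, Rabs_pos_eq by lra. nra.
  - apply (concentric_trace A B G ctrInf v x 4); auto; try lra.
    intros r t [Hr|Hr]; [lra | apply HF; lra].
  - intros t. set (z := (RtoC x * v * Cexpi (2 * PI * t))%C).
    assert (Hz : Cmod z = x * (3/4)).
    { unfold z. rewrite !Cmod_mult, Cmod_Cexpi, Cmod_R, Rabs_pos_eq, Hv by lra. ring. }
    set (h := RtoC (1/2)) in *.
    pose proof (Cmod_plus_ge z h) as Hp. pose proof (Cmod_minus_ge z h) as Hm.
    assert (Zp : (z + h)%C <> 0%C) by (apply neq0_of_Cmod; lra).
    assert (Zm : (z - h)%C <> 0%C) by (apply neq0_of_Cmod; lra).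
    assert (Hh : (h + h = 1)%C) by (unfold h; apply C_ext; simpl; field).
    replace (circ ctrInf (RtoC x * v) t) with (z + h)%C by (unfold circ, ctrInf, z, h; ring).
    rewrite <- HS.
    assert (small : forall w, x * (3/4) - 1/2 <= Cmod w -> w <> 0%C -> Cmod (h / w)%C <= eta).
    { intros w Hw Hw0. unfold Cdiv. rewrite Cmod_mult, Cmod_inv, Hhalf by exact Hw0.
      assert (0 < Cmod w) by lra.
      apply (Rmult_le_reg_r (Cmod w)); [lra|]. field_simplify; [|lra]. nra. }
    assert (Sa := small (z + h)%C ltac:(lra) Zp). assert (Sb := small (z - h)%C ltac:(lra) Zm).
    set (al := (h / (z + h))%C) in *. set (be := (h / (z - h))%C) in *.
    (* In the coordinate centred at 1/2 the poles are -h and h, and z / (z + h) = 1 - al, z / (z -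
       h) = 1 + be. Each bracket is at most eta^2 + 2 eta <= 3 eta, whence the 3 in [S]. *)
    replace (z * z * qpot A B G (z + h) - (A + B + G))%C
      with (A * (al * al - (al + al)) + B * (be * be + (be + be)) + G * (be - al - al * be))%C.
    2:{ unfold qpot, al, be. replace (z + h - 1)%C with (z - h)%C by (rewrite <- Hh; ring).
        field. auto. }
    eapply Rle_trans.
    + apply bound_plus; [apply bound_plus|]; (apply bound_mult; [apply Rle_refl|]).
      * bnd.
      * bnd.
      * bnd.
    + assert (eta * eta <= eta) by nra.
      assert (P1 : Cmod A * (eta * eta + (eta + eta)) <= Cmod A * (3 * eta)) by (apply Rmult_le_compat_l; lra).
      assert (P2 : Cmod B * (eta * eta + (eta + eta)) <= Cmod B * (3 * eta)) by (apply Rmult_le_compat_l; lra).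
      assert (P3 : Cmod G * (eta + eta + eta * eta) <= Cmod G * (3 * eta)) by (apply Rmult_le_compat_l; lra).
      unfold S in Heta1. lra.
Qed.

(** * The product relation of the three loops *)

Definition adjg (A : M2) : M2 := mkM2 (m22 A) (- m12 A)%C (- m21 A)%C (m11 A).

Lemma M2mul_assoc A B D : M2mul A (M2mul B D) = M2mul (M2mul A B) D.
Proof. apply M2_ext; unfold M2mul; simpl; ring. Qed.

Lemma M2mul_1_l A : M2mul M2id A = A.
Proof. apply M2_ext; unfold M2mul, M2id; simpl; ring. Qed.

Lemma M2mul_1_r A : M2mul A M2id = A.
Proof. apply M2_ext; unfold M2mul, M2id; simpl; ring. Qed.

Lemma mul_adjg_r A : M2det A = 1%C -> M2mul A (adjg A) = M2id.
Proof.
  unfold M2det. intros H. apply M2_ext; unfold M2mul, M2id, adjg; simpl; try (rewrite <- H); ring.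
Qed.

Lemma mul_adjg_l A : M2det A = 1%C -> M2mul (adjg A) A = M2id.
Proof.
  unfold M2det. intros H. apply M2_ext; unfold M2mul, M2id, adjg; simpl; try (rewrite <- H); ring.
Qed.

Lemma M2det_id : M2det M2id = 1%C.
Proof. unfold M2det, M2id; simpl. ring. Qed.

Lemma transport_det A B G p g T : transport A B G p g T ->
  forall t, 0 <= t <= 1 -> M2det (T t) = 1%C.
Proof. intros [T0 HT] t Ht. rewrite (solves_det _ _ _ HT t Ht), T0. apply M2det_id. Qed.

(** Transport along a sub-arc is T(a)^{-1} T(a + b s); a negative b runs the arc backwards. *)
Lemma transport_reparam A B G p g T a b : transport A B G p g T ->
  (forall s, 0 <= s <= 1 -> 0 <= a + b * s <= 1) ->
  transport A B G (fun s => p (a + b * s)) (fun s => RtoC b * g (a + b * s)%R)%C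
    (fun s => M2mul (adjg (T a)) (T (a + b * s))).
Proof.
  intros HT Hr. split.
  - rewrite Rmult_0_r, Rplus_0_r. apply mul_adjg_l. apply (transport_det A B G p g T HT).
    specialize (Hr 0 ltac:(lra)). lra.
  - destruct HT as [_ HT]. intros s Hs. destruct (HT _ (Hr s Hs)) as (H1 & H2 & H3 & H4).
    apply Cd_comp_affine in H1, H2, H3, H4.
    unfold M2mul; simpl.
    split; [|split; [|split]]; (eapply Cd_eq;
      [apply Cd_plus; (apply Cd_mult; [apply Cd_const|eassumption])|cbv beta; ring]).
Qed.

Lemma path_reparam p g a b : is_path p g ->
  is_path (fun s => p (a + b * s)) (fun s => RtoC b * g (a + b * s)%R)%C.
Proof.
  intros [D Cc]. split.
  - intros t. apply Cd_comp_affine, D.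
  - intros t. apply Ccont_mult; [apply Ccont_const|].
    assert (Cl : continuous (fun s => a + b * s) t).
    { apply (ex_derive_continuous (V := R_NormedModule)). auto_derive. trivial. }
    destruct (Cc (a + b * t)) as [C1 C2]. split.
    + apply (continuous_comp (fun s => a + b * s) (fun s => fst (g s))); assumption.
    + apply (continuous_comp (fun s => a + b * s) (fun s => snd (g s))); assumption.
Qed.

Lemma circ_bound c v t : Cmod (circ c v t) <= Cmod c + Cmod v.
Proof.
  unfold circ. eapply Rle_trans; [apply Cmod_triangle|].
  rewrite Cmod_mult, Cmod_Cexpi. lra.
Qed.

Lemma arc_homotopy A B G c c' v v' a b a' b' T T' :
  Cmod c <= 1 -> Cmod c' <= 1 -> Cmod v <= 1 -> Cmod v' <= 1 -> Rabs b <= 1 -> Rabs b' <= 1 ->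
  (forall s, 0 <= s <= 1 -> 0 <= a + b * s <= 1) -> (forall s, 0 <= s <= 1 -> 0 <= a' + b' * s <= 1) ->
  transport A B G (circ c v) (dcirc v) T -> transport A B G (circ c' v') (dcirc v') T' ->
  circ c v a = circ c' v' a' -> circ c v (a + b) = circ c' v' (a' + b') ->
  (forall u s, 0 <= u <= 1 -> 0 <= s <= 1 ->
     far 12 (circ c v (a + b * s) + RtoC u * (circ c' v' (a' + b' * s) - circ c v (a + b * s)))%C) ->
  M2mul (adjg (T a)) (T (a + b)) = M2mul (adjg (T' a')) (T' (a' + b')).
Proof.
  intros Hc Hc' Hv Hv' Hb Hb' Hr Hr' HT HT' E0 E1 HF.
  pose proof PI_4. pose proof PI_RGT_0.
  pose proof (Cmod_ge_0 A). pose proof (Cmod_ge_0 B). pose proof (Cmod_ge_0 G).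
  (* Each speed is at most 2 pi <= 8, so 20 covers the difference of speeds (16), the distance of
     the arcs (4) and the margin 12. *)
  set (N := 20 + Cmod A + Cmod B + Cmod G).
  assert (Bg : forall b v t, Rabs b <= 1 -> Cmod v <= 1 -> Cmod (RtoC b * dcirc v t)%C <= 8).
  { intros k w t Hk Hw. rewrite Cmod_mult, Cmod_R, dcirc_bound.
    apply Rle_trans with (1 * 8); [|lra]. pose proof (Cmod_ge_0 w).
    apply Rmult_le_compat; auto using Rabs_pos; nra. }
  replace (T (a + b)) with (T (a + b * 1)) by (f_equal; ring).
  replace (T' (a' + b')) with (T' (a' + b' * 1)) by (f_equal; ring).
  apply (homotopy_fixed_ends A B G N ltac:(unfold N; lra) ltac:(unfold N; lra) ltac:(unfold N; lra)
     ltac:(unfold N; lra)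
     (fun s => circ c v (a + b * s)) (fun s => RtoC b * dcirc v (a + b * s))%C
     (fun s => circ c' v' (a' + b' * s)) (fun s => RtoC b' * dcirc v' (a' + b' * s))%C
     (path_reparam _ _ _ _ (circ_path _ _)) (path_reparam _ _ _ _ (circ_path _ _)))
    with (T0 := fun s => M2mul (adjg (T a)) (T (a + b * s)))
         (T1 := fun s => M2mul (adjg (T' a')) (T' (a' + b' * s))).
  - intros u t Hu Ht. apply far_mono with 12; [unfold N; lra|]. apply HF; auto.
  - intros t _. eapply Rle_trans; [apply Bg; auto|unfold N; lra].
  - intros t _. eapply Rle_trans; [apply Bg; auto|unfold N; lra].
  - intros t _. eapply Rle_trans; [apply bound_minus; apply circ_bound|unfold N; lra].
  - intros t _. eapply Rle_trans; [apply bound_minus; apply Bg; auto|unfold N; lra].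
  - rewrite !Rmult_0_r, !Rplus_0_r. exact E0.
  - rewrite !Rmult_1_r. exact E1.
  - apply transport_reparam; auto.
  - apply transport_reparam; auto.
Qed.

(** Polar coordinates of z0, with tan th = 3/2. *)
Lemma polar_z0 : exists r th, 0 < r /\ r ^ 2 = 13/16 /\ 0 < th < PI / 2 /\
  r * cos th = 1/2 /\ r * sin th = 3/4.
Proof.
  exists (sqrt 13 / 4), (atan (3/2)).
  assert (S : sqrt 13 * sqrt 13 = 13) by (apply sqrt_sqrt; lra).
  assert (P : 0 < sqrt 13) by (apply sqrt_lt_R0; lra).
  assert (E : sqrt (1 + (3/2)²) = sqrt 13 / 2).
  { replace (1 + (3/2)²) with ((sqrt 13 / 2)²) by (unfold Rsqr; nra). apply sqrt_Rsqr. lra. }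
  split; [lra|]. split; [nra|]. split.
  - split; [|apply atan_bound]. rewrite <- atan_0. apply atan_increasing. lra.
  - rewrite cos_atan, sin_atan, E. split; field; lra.
Qed.

(** Half planes are convex, so checking the two arcs settles the segments between them. The boundary
    line lies at distance 1 / (4 sqrt 2) from 0, and x <= 1/2 keeps away from 1. *)
Lemma far_of_halfplane (x y s : R) : s = 1 \/ s = -1 ->
  x - s * y <= - (1/4) -> x <= 1/2 -> far 12 (x, y).
Proof.
  intros Hs H1 H2. split.
  - assert (Q : (1/12) ^ 2 <= Cmod (x, y) ^ 2).
    { rewrite Cmod_sq; simpl fst; simpl snd.
      assert (1/16 <= (x - s * y) ^ 2) by nra.
      assert (0 <= (x + s * y) ^ 2) by apply pow2_ge_0.
      destruct Hs; subst s; lra. }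
    pose proof (Cmod_ge_0 (x, y)). nra.
  - eapply Rle_trans; [|apply fst_le_Cmod]. simpl.
    rewrite Rabs_left by lra. lra.
Qed.

(** The symmetry z -> 1 - z exchanges the punctures 0 and 1 and carries the left arcs to the right
    ones. *)
Lemma far_reflect z : far 12 z -> far 12 (1 - z)%C.
Proof.
  intros [F1 F2]. split.
  - replace (1 - z)%C with (- (z - 1))%C by ring. rewrite Cmod_opp. exact F2.
  - replace (1 - z - 1)%C with (- z)%C by ring. rewrite Cmod_opp. exact F1.
Qed.

Lemma far_of_strip z : 9/100 <= fst z <= 91/100 -> far 12 z.
Proof.
  intros H. split; (eapply Rle_trans; [|apply fst_le_Cmod]); simpl.
  - rewrite Rabs_pos_eq; lra.
  - rewrite Rabs_left; lra.
Qed.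

(** * Arcs of the three circles between z0 and its conjugate *)

Section Arcs.
Variables (r th : R).
Hypothesis (Hr : 0 < r) (Hr2 : r ^ 2 = 13/16) (Hth : 0 < th < PI / 2)
  (Hc : r * cos th = 1/2) (Hs : r * sin th = 3/4).

Lemma circ0_polar t : circ ctr0 (v_of ctr0) t = (RtoC r * Cexpi (th + 2 * PI * t))%C.
Proof.
  assert (F1 : r * cos th * cos (2 * PI * t) = 1/2 * cos (2 * PI * t)) by (rewrite Hc; ring).
  assert (F2 : r * cos th * sin (2 * PI * t) = 1/2 * sin (2 * PI * t)) by (rewrite Hc; ring).
  assert (F3 : r * sin th * cos (2 * PI * t) = 3/4 * cos (2 * PI * t)) by (rewrite Hs; ring).
  assert (F4 : r * sin th * sin (2 * PI * t) = 3/4 * sin (2 * PI * t)) by (rewrite Hs; ring).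
  rewrite Cexpi_plus. unfold circ, ctr0, v_of, z0, Cexpi. apply C_ext; simpl; lra.
Qed.

Lemma circ1_polar t : circ ctr1 (v_of ctr1) t = (1 - RtoC r * Cexpi (- th + 2 * PI * t))%C.
Proof.
  assert (F1 : r * cos th * cos (2 * PI * t) = 1/2 * cos (2 * PI * t)) by (rewrite Hc; ring).
  assert (F2 : r * cos th * sin (2 * PI * t) = 1/2 * sin (2 * PI * t)) by (rewrite Hc; ring).
  assert (F3 : r * sin th * cos (2 * PI * t) = 3/4 * cos (2 * PI * t)) by (rewrite Hs; ring).
  assert (F4 : r * sin th * sin (2 * PI * t) = 3/4 * sin (2 * PI * t)) by (rewrite Hs; ring).
  rewrite Cexpi_plus. unfold circ, ctr1, v_of, z0, Cexpi. rewrite cos_neg, sin_neg.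
  apply C_ext; simpl; lra.
Qed.

Lemma circI_polar t : circ ctrInf (v_of ctrInf) t =
  (1/2 - 3/4 * sin (2 * PI * t), 3/4 * cos (2 * PI * t)).
Proof. unfold circ, ctrInf, v_of, z0, Cexpi. apply C_ext; simpl; field. Qed.

(** The long arc about 0 and the left half of the large circle cross the real axis at the same s =
    1/2, so on each half one half plane contains both. The bound -1/4 is attained at z0. *)
Lemma left_outer_arc s : 0 <= s <= 1 ->
  let x := r * cos (th + (2 * PI - 2 * th) * s) in let y := r * sin (th + (2 * PI - 2 * th) * s) in
  x <= 1/2 /\ (s <= 1/2 -> x - y <= - (1/4)) /\ (1/2 <= s -> x + y <= - (1/4)).
Proof.
  intros Hs1 x y.
  assert (Hxy : x ^ 2 + y ^ 2 = 13/16).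
  { unfold x, y. pose proof (sin2_cos2 (th + (2 * PI - 2 * th) * s)) as E. unfold Rsqr in E.
    replace (_ + _) with (r ^ 2 * (sin (th + (2 * PI - 2 * th) * s) * sin (th + (2 * PI - 2 * th) * s) +
      cos (th + (2 * PI - 2 * th) * s) * cos (th + (2 * PI - 2 * th) * s))) by ring. rewrite E, Hr2. ring. }
  assert (half1 : s <= 1/2 -> x <= 1/2 /\ 0 <= y).
  { intros H. set (a := th + (2 * PI - 2 * th) * s) in *.
    assert (Ha : th <= a <= PI) by (unfold a; split; nra). split.
    - unfold x. rewrite <- Hc. apply Rmult_le_compat_l; [lra|].
      destruct (Req_dec a th) as [->|]; [lra|]. left. apply cos_decreasing_1; lra.
    - unfold y. apply Rmult_le_pos; [lra|]. apply sin_ge_0; lra. }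
  assert (half2 : 1/2 <= s -> x <= 1/2 /\ y <= 0).
  { intros H. set (a := th + (2 * PI - 2 * th) * s) in *.
    assert (Ha : th <= 2 * PI - a <= PI) by (unfold a; split; nra).
    assert (Ec : cos a = cos (2 * PI - a)).
    { rewrite cos_minus, cos_2PI, sin_2PI. ring. }
    assert (Es : sin a = - sin (2 * PI - a)).
    { rewrite sin_minus, cos_2PI, sin_2PI. ring. }
    split.
    - unfold x. rewrite Ec, <- Hc. apply Rmult_le_compat_l; [lra|].
      destruct (Req_dec (2 * PI - a) th) as [->|]; [lra|]. left. apply cos_decreasing_1; lra.
    - unfold y. rewrite Es. pose proof (sin_ge_0 (2 * PI - a) ltac:(lra) ltac:(lra)). nra. }
  split; [|split].
  - destruct (Rle_dec s (1/2)); [apply half1|apply half2]; lra.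
  - intros H. destruct (half1 H) as [Hx Hy]. nra.
  - intros H. destruct (half2 H) as [Hx Hy]. nra.
Qed.

Lemma left_inner_arc s : 0 <= s <= 1 ->
  let x := 1/2 - 3/4 * sin (PI * s) in let y := 3/4 * cos (PI * s) in
  x <= 1/2 /\ (s <= 1/2 -> x - y <= - (1/4)) /\ (1/2 <= s -> x + y <= - (1/4)).
Proof.
  intros Hs1 x y. pose proof PI_RGT_0.
  pose proof (sin2_cos2 (PI * s)) as E. unfold Rsqr in E.
  pose proof (sin_ge_0 (PI * s) ltac:(nra) ltac:(nra)) as S0.
  unfold x, y. split; [lra|split]; intros Hh.
  - pose proof (cos_ge_0 (PI * s) ltac:(nra) ltac:(nra)). nra.
  - assert (cos (PI * s) <= 0) by (apply cos_le_0; nra). nra.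
Qed.

(** Left half of the circle of radius 3/4 about 1/2, on which z0 and its conjugate are antipodal;
    the right half is 1 - [inner]. *)
Definition inner (s : R) : C := (1/2 - 3/4 * sin (PI * s), 3/4 * cos (PI * s)).

Lemma left_far u s : 0 <= u <= 1 -> 0 <= s <= 1 ->
  far 12 (RtoC r * Cexpi (th + (2 * PI - 2 * th) * s) + RtoC u *
    (inner s - RtoC r * Cexpi (th + (2 * PI - 2 * th) * s)))%C.
Proof.
  intros Hu Hs1. destruct (left_outer_arc s Hs1) as (A1 & A2 & A3).
  destruct (left_inner_arc s Hs1) as (B1 & B2 & B3).
  set (x := r * cos (th + (2 * PI - 2 * th) * s)) in *. set (y := r * sin (th + (2 * PI - 2 * th) * s)) in *.
  set (x' := 1/2 - 3/4 * sin (PI * s)) in *. set (y' := 3/4 * cos (PI * s)) in *.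
  match goal with |- far 12 ?z => replace z with ((x + u * (x' - x), y + u * (y' - y)) : C)
    by (unfold Cexpi, inner, x, y, x', y'; apply C_ext; simpl; ring) end.
  destruct (Rle_dec s (1/2)) as [H|H].
  - apply (far_of_halfplane _ _ 1); [lra| |nra]. specialize (A2 H). specialize (B2 H). nra.
  - apply (far_of_halfplane _ _ (-1)); [lra| |nra].
    specialize (A3 ltac:(lra)). specialize (B3 ltac:(lra)). nra.
Qed.

(** The short arc about 0 has real part in [1/2, 91/100]; by reflection the one about 1 lies in
    [9/100, 1/2], so the segments between them stay in a strip off both punctures. *)
Lemma middle_arc s : 0 <= s <= 1 -> 1/2 <= r * cos (th - 2 * th * s) <= 91/100.
Proof.
  intros Hs1. split.
  - rewrite <- Hc. apply Rmult_le_compat_l; [lra|].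
    set (b := th - 2 * th * s). assert (Hb : - th <= b <= th) by (unfold b; split; nra).
    destruct (Rle_dec 0 b).
    + destruct (Req_dec b th) as [->|]; [lra|]. left. apply cos_decreasing_1; lra.
    + rewrite <- (cos_neg b). destruct (Req_dec (- b) th) as [->|]; [lra|]. left. apply cos_decreasing_1; lra.
  - pose proof (COS_bound (th - 2 * th * s)). assert (r <= 91/100) by nra. nra.
Qed.

Lemma Cmod_v_bound c : (c = ctr0 \/ c = ctr1 \/ c = ctrInf) -> Cmod (v_of c) <= 1.
Proof.
  intros H. assert (Cmod (v_of c) ^ 2 <= 1).
  { rewrite Cmod_sq. unfold v_of, z0. destruct H as [->|[->| ->]]; simpl; lra. }
  pose proof (Cmod_ge_0 (v_of c)). nra.
Qed.

Lemma Cmod_ctr_bound c : (c = ctr0 \/ c = ctr1 \/ c = ctrInf) -> Cmod c <= 1.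
Proof.
  intros [->|[->| ->]]; unfold ctr0, ctr1, ctrInf; rewrite Cmod_R, Rabs_pos_eq; lra.
Qed.

(** From z0 the first circle runs along its left arc and returns by a middle arc; the second runs
    down a middle arc and returns along its right arc. In T1 T2 the middle arcs cancel, and the left
    and right arcs together deform to the third circle. *)
Lemma circles_product A B G T1 T2 T3 :
  transport A B G (circ ctr0 (v_of ctr0)) (dcirc (v_of ctr0)) T1 ->
  transport A B G (circ ctr1 (v_of ctr1)) (dcirc (v_of ctr1)) T2 ->
  transport A B G (circ ctrInf (v_of ctrInf)) (dcirc (v_of ctrInf)) T3 ->
  T3 1 = M2mul (T1 1) (T2 1).
Proof.
  intros HT1 HT2 HT3. pose proof PI_RGT_0 as HPI.
  (* A middle arc has angle 2 th, the fraction th / PI of a full turn. *)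
  set (t2 := th / PI). set (t1 := 1 - t2).
  assert (Ht2 : 0 < t2 < 1/2).
  { unfold t2. split; [apply Rdiv_lt_0_compat; lra|].
    apply (Rmult_lt_reg_r PI); [lra|]. replace (th / PI * PI) with th by (field; lra). lra. }
  assert (E2 : 2 * PI * t2 = 2 * th) by (unfold t2; field; lra).
  assert (E1 : 2 * PI * t1 = 2 * PI - 2 * th) by (unfold t1; rewrite Rmult_minus_distr_l, E2; ring).
  assert (A1 : forall s, circ ctr0 (v_of ctr0) (0 + t1 * s) = (RtoC r * Cexpi (th + (2 * PI - 2 * th) * s))%C).
  { intros s. rewrite circ0_polar. do 3 f_equal. rewrite <- E1. ring. }
  assert (A3 : forall s, circ ctrInf (v_of ctrInf) (0 + 1/2 * s) =
     inner s).
  { intros s. rewrite circI_polar. replace (2 * PI * (0 + 1/2 * s)) with (PI * s) by field. reflexivity. }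
  assert (R2 : forall s, circ ctr1 (v_of ctr1) (t2 + t1 * s) = (1 - RtoC r * Cexpi (th + (2 * PI - 2 * th) * s))%C).
  { intros s. rewrite circ1_polar.
    replace (2 * PI * (t2 + t1 * s)) with (2 * PI * t2 + 2 * PI * t1 * s) by ring. rewrite E1, E2.
    replace (- th + (2 * th + (2 * PI - 2 * th) * s)) with (th + (2 * PI - 2 * th) * s) by ring. reflexivity. }
  assert (R3 : forall s, circ ctrInf (v_of ctrInf) (1/2 + 1/2 * s) =
     (1 - inner s)%C).
  { intros s. rewrite circI_polar. replace (2 * PI * (1/2 + 1/2 * s)) with (PI * s + PI) by field.
    rewrite neg_sin, neg_cos. unfold inner. apply C_ext; simpl; field. }
  assert (M1 : forall s, circ ctr0 (v_of ctr0) (1 + - t2 * s) = (RtoC r * Cexpi (th - 2 * th * s))%C).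
  { intros s. rewrite circ0_polar.
    replace (th + 2 * PI * (1 + - t2 * s)) with ((th - 2 * PI * t2 * s) + 2 * PI) by ring.
    rewrite E2, Cexpi_plus, Cexpi_2PI. ring. }
  assert (M2 : forall s, circ ctr1 (v_of ctr1) (0 + t2 * s) = (1 - RtoC r * Cexpi (- (th - 2 * th * s)))%C).
  { intros s. rewrite circ1_polar.
    replace (2 * PI * (0 + t2 * s)) with (2 * PI * t2 * s) by ring. rewrite E2.
    replace (- th + 2 * th * s) with (- (th - 2 * th * s)) by ring. reflexivity. }
  assert (Ends : (RtoC r * Cexpi th)%C = (1/2, 3/4) /\ (RtoC r * Cexpi (- th))%C = (1/2, - (3/4))).
  { unfold Cexpi. rewrite cos_neg, sin_neg. split; apply C_ext; simpl; lra. }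
  assert (End2 : (RtoC r * Cexpi (th + (2 * PI - 2 * th) * 1))%C = (1/2, - (3/4))).
  { replace (th + (2 * PI - 2 * th) * 1) with (- th + 2 * PI) by ring.
    rewrite Cexpi_plus, Cexpi_2PI, <- (proj2 Ends). ring. }
  assert (left : M2mul (adjg (T1 0)) (T1 (0 + t1)) = M2mul (adjg (T3 0)) (T3 (0 + 1/2))).
  { apply (arc_homotopy A B G ctr0 ctrInf (v_of ctr0) (v_of ctrInf)); auto using Cmod_v_bound, Cmod_ctr_bound.
    - rewrite Rabs_pos_eq; unfold t1; lra.
    - rewrite Rabs_pos_eq; lra.
    - intros s Hs1. unfold t1. nra.
    - intros s Hs1. nra.
    - pose proof (A1 0) as X. pose proof (A3 0) as Y. repeat rewrite Rmult_0_r in X, Y. repeat rewrite Rplus_0_r in X, Y.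
      repeat rewrite Rmult_0_r in X. repeat rewrite Rplus_0_r in X.
      unfold inner in Y. rewrite !Rmult_0_r in Y. rewrite X, Y, sin_0, cos_0, (proj1 Ends). apply C_ext; simpl; field.
    - pose proof (A1 1) as X. pose proof (A3 1) as Y. rewrite End2 in X. repeat rewrite Rmult_1_r in X. repeat rewrite Rmult_1_r in Y.
      unfold inner in Y. rewrite !Rmult_1_r in Y. rewrite X, Y, sin_PI, cos_PI. apply C_ext; simpl; field.
    - intros u s Hu Hs1. rewrite A1, A3. apply left_far; auto. }
  assert (right : M2mul (adjg (T2 t2)) (T2 (t2 + t1)) = M2mul (adjg (T3 (1/2))) (T3 (1/2 + 1/2))).
  { apply (arc_homotopy A B G ctr1 ctrInf (v_of ctr1) (v_of ctrInf)); auto using Cmod_v_bound, Cmod_ctr_bound.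
    - rewrite Rabs_pos_eq; unfold t1; lra.
    - rewrite Rabs_pos_eq; lra.
    - intros s Hs1. unfold t1. nra.
    - intros s Hs1. nra.
    - pose proof (R2 0) as X. pose proof (R3 0) as Y. repeat rewrite Rmult_0_r in X, Y. repeat rewrite Rplus_0_r in X, Y.
      repeat rewrite Rmult_0_r in X. repeat rewrite Rplus_0_r in X.
      unfold inner in Y. rewrite !Rmult_0_r in Y. rewrite X, Y, sin_0, cos_0, (proj1 Ends). apply C_ext; simpl; field.
    - pose proof (R2 1) as X. pose proof (R3 1) as Y. rewrite End2 in X. repeat rewrite Rmult_1_r in X. repeat rewrite Rmult_1_r in Y.
      unfold inner in Y. rewrite !Rmult_1_r in Y. rewrite X, Y, sin_PI, cos_PI. apply C_ext; simpl; field.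
    - intros u s Hu Hs1. rewrite R2, R3.
      set (p := (RtoC r * Cexpi (th + (2 * PI - 2 * th) * s))%C).
      match goal with |- far 12 ?z => replace z with (1 - (p + RtoC u * (inner s - p)))%C by ring end.
      apply far_reflect, left_far; auto. }
  (* The middle arc of the first circle is run backwards from time 1, so that both arcs go from z0
     to its conjugate. *)
  assert (mid : M2mul (adjg (T1 1)) (T1 (1 + - t2)) = M2mul (adjg (T2 0)) (T2 (0 + t2))).
  { apply (arc_homotopy A B G ctr0 ctr1 (v_of ctr0) (v_of ctr1)); auto using Cmod_v_bound, Cmod_ctr_bound.
    - rewrite Rabs_Ropp, Rabs_pos_eq; lra.
    - rewrite Rabs_pos_eq; lra.
    - intros s Hs1. nra.
    - intros s Hs1. nra.
    - pose proof (M1 0) as X. pose proof (M2 0) as Y. repeat rewrite Rmult_0_r in X. repeat rewrite Rmult_0_r in Y.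
      rewrite Rplus_0_r, Rminus_0_r in X. rewrite Rplus_0_r, Rminus_0_r in Y.
      rewrite X, Y, (proj1 Ends), (proj2 Ends). apply C_ext; simpl; field.
    - pose proof (M1 1) as X. pose proof (M2 1) as Y. repeat rewrite Rmult_1_r in X. repeat rewrite Rmult_1_r in Y.
      replace (th - 2 * th) with (- th) in X, Y by ring. rewrite Ropp_involutive in Y.
      rewrite X, Y, (proj1 Ends), (proj2 Ends). apply C_ext; simpl; field.
    - intros u s Hu Hs1. rewrite M1, M2. apply far_of_strip.
      pose proof (middle_arc s Hs1). unfold Cexpi; simpl. rewrite cos_neg. nra. }
  replace (0 + t1) with t1 in left by ring. replace (0 + 1/2) with (1/2) in left by ring.
  replace (1 + - t2) with t1 in mid by (unfold t1; ring). replace (0 + t2) with t2 in mid by ring.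
  replace (t2 + t1) with 1 in right by (unfold t1; ring). replace (1/2 + 1/2) with 1 in right by field.
  assert (Z : forall X, M2mul (adjg M2id) X = X)
    by (intros X; apply M2_ext; unfold M2mul, adjg, M2id; simpl; ring).
  rewrite (proj1 HT1), (proj1 HT3), !Z in left. rewrite (proj1 HT2), Z in mid.
  assert (D1 : M2det (T1 1) = 1%C) by (apply (transport_det _ _ _ _ _ _ HT1); lra).
  assert (D1' : M2det (T1 t1) = 1%C) by (apply (transport_det _ _ _ _ _ _ HT1); unfold t1; lra).
  assert (D2 : M2det (T2 t2) = 1%C) by (apply (transport_det _ _ _ _ _ _ HT2); lra).
  rewrite <- left in right.
  assert (F : T2 1 = M2mul (T2 t2) (M2mul (adjg (T1 t1)) (T3 1))).
  { rewrite <- right, M2mul_assoc, mul_adjg_r, M2mul_1_l by exact D2. reflexivity. }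
  rewrite F, <- mid, !M2mul_assoc, mul_adjg_r, M2mul_1_l, mul_adjg_r, M2mul_1_l by assumption. reflexivity.
Qed.
End Arcs.

Lemma monodromy_product A B G T1 T2 T3 :
  transport A B G (circ ctr0 (v_of ctr0)) (dcirc (v_of ctr0)) T1 ->
  transport A B G (circ ctr1 (v_of ctr1)) (dcirc (v_of ctr1)) T2 ->
  transport A B G (circ ctrInf (v_of ctrInf)) (dcirc (v_of ctrInf)) T3 ->
  T3 1 = M2mul (T1 1) (T2 1).
Proof.
  destruct polar_z0 as (r & th & H1 & H2 & H3 & H4 & H5).
  apply (circles_product r th); auto.
Qed.

(** * Unitarizable pairs in SL(2) *)

Definition M2conj (P A : M2) : M2 := M2mul (M2mul P A) (M2inv P).
Definition M2tr (A : M2) : C := (m11 A + m22 A)%C.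
(** The Gram determinant of three unit vectors with inner products x, y, z; for half-traces of A, B
    and AB in SL(2) it equals (2 - tr(A B A^{-1} B^{-1})) / 4. *)
Definition gram (x y z : R) : R := 1 - x ^ 2 - y ^ 2 - z ^ 2 + 2 * x * y * z.

Lemma M2mul_inv_r P : M2det P <> 0%C -> M2mul P (M2inv P) = M2id.
Proof.
  intros H. unfold M2inv, M2scal. apply M2_ext; unfold M2mul, M2id; simpl;
    unfold M2det in *; field; exact H.
Qed.

Lemma M2mul_inv_l P : M2det P <> 0%C -> M2mul (M2inv P) P = M2id.
Proof.
  intros H. unfold M2inv, M2scal. apply M2_ext; unfold M2mul, M2id; simpl;
    unfold M2det in *; field; exact H.
Qed.

Lemma M2det_mul P Q : M2det (M2mul P Q) = (M2det P * M2det Q)%C.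
Proof. unfold M2det, M2mul; simpl. ring. Qed.

Lemma M2det_mul_neq_0 P Q : M2det P <> 0%C -> M2det Q <> 0%C -> M2det (M2mul P Q) <> 0%C.
Proof. intros. rewrite M2det_mul. apply Cmult_neq_0; assumption. Qed.

Lemma M2inv_unique P X : M2det P <> 0%C -> M2mul P X = M2id -> X = M2inv P.
Proof.
  intros HP H. rewrite <- (M2mul_1_l X), <- (M2mul_inv_l P HP), <- M2mul_assoc, H. apply M2mul_1_r.
Qed.

Lemma M2inv_mul P Q : M2det P <> 0%C -> M2det Q <> 0%C ->
  M2inv (M2mul P Q) = M2mul (M2inv Q) (M2inv P).
Proof.
  intros HP HQ. symmetry. apply M2inv_unique; [apply M2det_mul_neq_0; assumption|].
  rewrite M2mul_assoc, <- (M2mul_assoc P), M2mul_inv_r, M2mul_1_r, M2mul_inv_r by assumption. reflexivity.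
Qed.

Lemma M2conj_mul P Q A : M2det P <> 0%C -> M2det Q <> 0%C ->
  M2conj (M2mul P Q) A = M2conj P (M2conj Q A).
Proof. intros. unfold M2conj. rewrite M2inv_mul by assumption. rewrite !M2mul_assoc. reflexivity. Qed.

Lemma M2conj_prod P A B : M2det P <> 0%C ->
  M2conj P (M2mul A B) = M2mul (M2conj P A) (M2conj P B).
Proof.
  intros H. unfold M2conj. rewrite !M2mul_assoc.
  rewrite <- (M2mul_assoc (M2mul P A) (M2inv P) P), M2mul_inv_l, M2mul_1_r by assumption. reflexivity.
Qed.

Lemma M2tr_comm A B : M2tr (M2mul A B) = M2tr (M2mul B A).
Proof. unfold M2tr, M2mul; simpl. ring. Qed.

Lemma M2conj_tr P A : M2det P <> 0%C -> M2tr (M2conj P A) = M2tr A.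
Proof.
  intros H. unfold M2conj. rewrite M2tr_comm, M2mul_assoc, M2mul_inv_l, M2mul_1_l by assumption. reflexivity.
Qed.

Lemma M2det_inv P : M2det P <> 0%C -> (M2det P * M2det (M2inv P) = 1)%C.
Proof. intros H. rewrite <- M2det_mul, M2mul_inv_r by assumption. apply M2det_id. Qed.

Lemma M2conj_det P A : M2det P <> 0%C -> M2det (M2conj P A) = M2det A.
Proof.
  intros H. unfold M2conj. rewrite !M2det_mul.
  replace (M2det P * M2det A * M2det (M2inv P))%C with (M2det P * M2det (M2inv P) * M2det A)%C by ring.
  rewrite M2det_inv by assumption. ring.
Qed.

Lemma M2conj_of_eigen P A D : M2det P <> 0%C -> M2mul P A = M2mul D P -> M2conj P A = D.
Proof.
  intros H E. unfold M2conj. rewrite E, <- M2mul_assoc, M2mul_inv_r by assumption. apply M2mul_1_r.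
Qed.

Lemma M2conj_inv P A D : M2det P <> 0%C -> M2conj P A = D -> A = M2mul (M2mul (M2inv P) D) P.
Proof.
  intros H <-. unfold M2conj. rewrite !M2mul_assoc, M2mul_inv_l, M2mul_1_l by assumption.
  rewrite <- M2mul_assoc, M2mul_inv_l, M2mul_1_r by assumption. reflexivity.
Qed.

Lemma M2conj_inj P A B : M2det P <> 0%C -> M2conj P A = M2conj P B -> A = B.
Proof.
  intros H E. rewrite (M2conj_inv P A _ H E). symmetry. apply M2conj_inv; auto.
Qed.

(** The adjoint and the adjugate both invert U, hence coincide. *)
Lemma su2_form U : unitary U -> M2det U = 1%C ->
  m21 U = (- Cconj (m12 U))%C /\ m22 U = Cconj (m11 U).
Proof.
  intros HU HD.
  assert (E : M2adj U = adjg U).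
  { rewrite <- (M2mul_1_l (M2adj U)), <- (mul_adjg_l U HD), <- M2mul_assoc, HU, M2mul_1_r. reflexivity. }
  pose proof (f_equal m21 E) as E3. pose proof (f_equal m11 E) as E4. simpl in E3, E4.
  split; [rewrite E3; ring | now rewrite E4].
Qed.

Lemma unitary_su2_form p q : fst p ^ 2 + snd p ^ 2 + fst q ^ 2 + snd q ^ 2 = 1 ->
  unitary (mkM2 p q (- Cconj q)%C (Cconj p)).
Proof.
  intros H. unfold unitary. destruct p as [a b], q as [c d]; simpl in H.
  apply M2_ext; unfold M2mul, M2adj, M2id, Cconj; apply C_ext; simpl; nra.
Qed.

(* In SU(2) = unit quaternions, gram is the squared norm of the cross product of the imaginary parts. *)
Lemma gram_pos_of_unitary A B x y z :
  unitary A -> unitary B -> M2det A = 1%C -> M2det B = 1%C ->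
  M2tr A = RtoC (2 * x) -> M2tr B = RtoC (2 * y) -> M2tr (M2mul A B) = RtoC (2 * z) ->
  M2mul A B <> M2mul B A -> 0 < gram x y z.
Proof.
  intros UA UB DA DB TA TB TAB Hnc.
  destruct (su2_form A UA DA) as [A1 A2]. destruct (su2_form B UB DB) as [B1 B2].
  destruct A as [[p1 p2] [q1 q2] a21 a22]. destruct B as [[r1 r2] [s1 s2] b21 b22].
  unfold M2tr, M2det, M2mul in *. simpl in *. subst.
  apply (f_equal fst) in TA, TB, TAB, DA, DB. simpl in TA, TB, TAB, DA, DB.
  assert (Ex : x = p1) by lra. assert (Ey : y = r1) by lra. subst x y.
  assert (Ez : z = p1 * r1 - p2 * r2 - q1 * s1 - q2 * s2) by lra. subst z.
  set (c1 := p2 * s1 - q1 * r2). set (c2 := p2 * s2 - q2 * r2). set (c3 := q1 * s2 - q2 * s1).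
  assert (HA : p1 ^ 2 = 1 - p2 ^ 2 - q1 ^ 2 - q2 ^ 2) by lra.
  assert (HB : r1 ^ 2 = 1 - r2 ^ 2 - s1 ^ 2 - s2 ^ 2) by lra.
  assert (E : gram p1 r1 (p1 * r1 - p2 * r2 - q1 * s1 - q2 * s2) = c1 ^ 2 + c2 ^ 2 + c3 ^ 2).
  { unfold gram.
    replace (1 - p1 ^ 2 - r1 ^ 2 - (p1 * r1 - p2 * r2 - q1 * s1 - q2 * s2) ^ 2 +
      2 * p1 * r1 * (p1 * r1 - p2 * r2 - q1 * s1 - q2 * s2))
      with ((1 - p1 ^ 2) * (1 - r1 ^ 2) - (p2 * r2 + q1 * s1 + q2 * s2) ^ 2) by ring.
    rewrite HA, HB. unfold c1, c2, c3. ring. }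
  rewrite E. destruct (Rlt_le_dec 0 (c1 ^ 2 + c2 ^ 2 + c3 ^ 2)) as [H|H]; [exact H|exfalso].
  assert (Z1 : c1 = 0) by nra. assert (Z2 : c2 = 0) by nra. assert (Z3 : c3 = 0) by nra.
  unfold c1, c2, c3 in *. apply Hnc. apply M2_ext; apply C_ext; simpl; lra.
Qed.

(** Fricke's formula for the trace of a commutator, made homogeneous with adjugates and determinants
    so that it is a polynomial identity; a trivial commutator has trace 2. *)
Lemma gram_zero_of_commute A B x y z :
  M2det A = 1%C -> M2det B = 1%C ->
  M2tr A = RtoC (2 * x) -> M2tr B = RtoC (2 * y) -> M2tr (M2mul A B) = RtoC (2 * z) ->
  M2mul A B = M2mul B A -> gram x y z = 0.
Proof.
  intros DA DB TA TB TAB Hc.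
  assert (I : M2tr (M2mul (M2mul A B) (M2mul (adjg A) (adjg B))) =
    (M2tr A * M2tr A * M2det B + M2tr B * M2tr B * M2det A + M2tr (M2mul A B) * M2tr (M2mul A B)
     - M2tr A * M2tr B * M2tr (M2mul A B) - 2 * M2det A * M2det B)%C).
  { unfold M2tr, M2mul, M2det, adjg; simpl. ring. }
  assert (J : M2mul (M2mul A B) (M2mul (adjg A) (adjg B)) = M2id).
  { rewrite Hc, M2mul_assoc, <- (M2mul_assoc B), mul_adjg_r, M2mul_1_r by assumption. apply mul_adjg_r, DB. }
  rewrite J, DA, DB, TA, TB, TAB in I. apply (f_equal fst) in I. unfold M2tr, M2id in I. simpl in I.
  unfold gram. lra.
Qed.


(** The eigenvalues are distinct conjugates, and the rows of P are left eigenvectors, read off from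
    a nonzero off-diagonal entry. If A is already diagonal, e is its entry a, with imaginary part of
    either sign; hence only [snd e <> 0] is claimed. *)
Lemma diagonalize A x : M2det A = 1%C -> M2tr A = RtoC (2 * x) -> x ^ 2 < 1 ->
  exists (P : M2) (e : C), M2det P <> 0%C /\ M2conj P A = mkM2 e 0%C 0%C (Cconj e) /\
    fst e = x /\ snd e <> 0 /\ x ^ 2 + snd e ^ 2 = 1.
Proof.
  intros DA TA Hx. destruct A as [a b c d]. unfold M2det in DA. unfold M2tr in TA. simpl in DA, TA.
  set (w := sqrt (1 - x ^ 2)).
  assert (Hw : w * w = 1 - x ^ 2) by (apply sqrt_sqrt; lra).
  assert (Hw0 : w <> 0) by (intros E; rewrite E in Hw; lra).
  set (e := (x, w) : C).
  assert (Hd : d = (RtoC (2 * x) - a)%C) by (rewrite <- TA; ring).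
  assert (Hee : (e - Cconj e)%C <> 0%C).
  { intros E. apply (f_equal snd) in E. simpl in E. apply Hw0. lra. }
  assert (He : (e * e - RtoC (2 * x) * e + 1)%C = 0%C) by (unfold e; apply C_ext; simpl; nra).
  assert (He' : (Cconj e * Cconj e - RtoC (2 * x) * Cconj e + 1)%C = 0%C) by (unfold e; apply C_ext; simpl; nra).
  assert (char : forall f : C, (f * f - RtoC (2 * x) * f + 1)%C = 0%C -> (b * c)%C = ((f - a) * (f - d))%C).
  { intros f Hf. replace ((f - a) * (f - d))%C with ((f * f - (a + d) * f + 1) + (a * d - b * c - 1) + b * c)%C by ring.
    rewrite TA, Hf, DA. ring. }
  pose proof (char _ He) as Ce. pose proof (char _ He') as Ce'.
  assert (Hsq : x ^ 2 + w ^ 2 = 1) by (simpl; lra).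
  destruct (Ceq_dec c 0%C) as [Hc0|Hc0]; [destruct (Ceq_dec b 0%C) as [Hb0|Hb0]|].
  - subst b c. exists M2id, a. rewrite M2det_id.
    destruct a as [u v]. subst d. clear Ce Ce'.
    pose proof (f_equal fst DA) as D1. pose proof (f_equal snd DA) as D2. simpl in D1, D2.
    assert (Hv : v <> 0).
    { intros E. pose proof (pow2_ge_0 (u - x)). rewrite E in D1. lra. }
    assert (Hu : u = x) by (apply (Rmult_eq_reg_r v); [lra|exact Hv]). subst u.
    split; [apply C1_nz|]. split; [|split; [reflexivity|split; [exact Hv|simpl; nra]]].
    apply M2conj_of_eigen; [rewrite M2det_id; apply C1_nz|].
    rewrite M2mul_1_l, M2mul_1_r. apply M2_ext; simpl; auto. apply C_ext; simpl; ring.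
  - exists (mkM2 (e - d) b (Cconj e - d) b)%C, e.
    assert (Dn : M2det (mkM2 (e - d) b (Cconj e - d) b)%C <> 0%C).
    { unfold M2det; simpl. replace ((e - d) * b - b * (Cconj e - d))%C with (b * (e - Cconj e))%C by ring.
      apply Cmult_neq_0; assumption. }
    split; [exact Dn|]. split; [|repeat split; auto].
    apply M2conj_of_eigen; [exact Dn|]. apply M2_ext; unfold M2mul; simpl.
    + rewrite Ce. ring.
    + ring.
    + rewrite Ce'. ring.
    + ring.
  - exists (mkM2 c (e - a) c (Cconj e - a))%C, e.
    assert (Dn : M2det (mkM2 c (e - a) c (Cconj e - a))%C <> 0%C).
    { unfold M2det; simpl. replace (c * (Cconj e - a) - (e - a) * c)%C with (- (c * (e - Cconj e)))%C by ring.
      intros E. apply (Cmult_neq_0 _ _ Hc0 Hee). replace (c * (e - Cconj e))%C with (- - (c * (e - Cconj e)))%C by ring. rewrite E. ring. }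
    split; [exact Dn|]. split; [|repeat split; auto].
    apply M2conj_of_eigen; [exact Dn|]. apply M2_ext; unfold M2mul; simpl.
    + ring.
    + rewrite (Cmult_comm c b), Ce. ring.
    + ring.
    + rewrite (Cmult_comm c b), Ce'. ring.
Qed.

(** With A diagonal, the real traces force B = [[p, q], [r, conj p]]. Positivity of [gram] means |p|
    < 1, so q r is negative, and conjugation by a suitable diag(d, 1) turns r into - conj q while
    fixing A. *)
Lemma unitarize_pair A B x y z :
  M2det A = 1%C -> M2det B = 1%C ->
  M2tr A = RtoC (2 * x) -> M2tr B = RtoC (2 * y) -> M2tr (M2mul A B) = RtoC (2 * z) ->
  x ^ 2 <= 1 -> y ^ 2 <= 1 -> 0 < gram x y z ->
  exists P, M2det P <> 0%C /\ unitary (M2conj P A) /\ unitary (M2conj P B).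
Proof.
  intros DA DB TA TB TAB Hx Hy HD.
  assert (HD' : (z - x * y) ^ 2 < (1 - x ^ 2) * (1 - y ^ 2)) by (unfold gram in HD; nra).
  assert (Hx1 : x ^ 2 < 1).
  { destruct (Req_dec (x ^ 2) 1) as [E|]; [|lra]. exfalso.
    rewrite E, Rminus_diag, Rmult_0_l in HD'. pose proof (pow2_ge_0 (z - x * y)). lra. }
  destruct (diagonalize A x DA TA Hx1) as (P & e & HP & EA & Ex & Ew & Exw).
  assert (DB' : M2det (M2conj P B) = 1%C) by (rewrite M2conj_det; assumption).
  assert (TB' : M2tr (M2conj P B) = RtoC (2 * y)) by (rewrite M2conj_tr; assumption).
  assert (TAB' : M2tr (M2mul (M2conj P A) (M2conj P B)) = RtoC (2 * z))
    by (rewrite <- M2conj_prod, M2conj_tr; assumption).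
  rewrite EA in TAB'. destruct (M2conj P B) as [p q r t] eqn:EB.
  unfold M2tr in TB', TAB'. unfold M2det in DB'. unfold M2mul in TAB'. simpl in TB', TAB', DB'.
  destruct e as [ex w]. simpl in Ex, Ew, Exw, TAB'. subst ex.
  destruct p as [p1 p2], t as [t1 t2].
  pose proof (f_equal fst TB') as T1. pose proof (f_equal snd TB') as T2.
  pose proof (f_equal fst TAB') as T3. pose proof (f_equal snd TAB') as T4.
  simpl in T1, T2, T3, T4.
  assert (Et2 : t2 = - p2) by lra. subst t2.
  assert (Et1 : t1 = p1).
  { apply (Rmult_eq_reg_r w); [|exact Ew]. lra. }
  subst t1. assert (Ep1 : p1 = y) by lra. subst p1.
  assert (Ep2 : w * p2 = x * y - z) by lra.
  (* In fact w^2 (1 - |p|^2) is [gram x y z]. *)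
  assert (Hpn : y ^ 2 + p2 ^ 2 < 1).
  { assert (w ^ 2 * (y ^ 2 + p2 ^ 2) < w ^ 2 * 1).
    { replace (w ^ 2 * (y ^ 2 + p2 ^ 2)) with (w ^ 2 * y ^ 2 + (w * p2) ^ 2) by ring.
      rewrite Ep2. replace (w ^ 2) with (1 - x ^ 2) by lra. nra. }
    assert (0 < w ^ 2) by nra. apply (Rmult_lt_reg_l (w ^ 2)); assumption. }
  set (k := 1 - y ^ 2 - p2 ^ 2) in *.
  assert (Hk : 0 < k) by (unfold k; lra).
  assert (Eqr : (q * r)%C = RtoC (- k)).
  { replace (q * r)%C with ((y, p2) * (y, (- p2)%R) - ((y, p2) * (y, (- p2)%R) - q * r))%C by ring.
    rewrite DB'. unfold k. apply C_ext; simpl; ring. }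
  assert (Hq : q <> 0%C).
  { intros ->. rewrite Cmult_0_l in Eqr. apply (f_equal fst) in Eqr. simpl in Eqr. lra. }
  destruct q as [q1 q2]. pose proof (Csqnorm_neq_0 _ Hq) as Hqn. simpl fst in Hqn. simpl snd in Hqn.
  assert (Hqp : 0 < q1 ^ 2 + q2 ^ 2) by nra.
  (* Chosen so that |d q|^2 = k = 1 - |p|^2, which makes the new first row a unit vector. *)
  set (d := sqrt (k / (q1 ^ 2 + q2 ^ 2))).
  assert (Hd2 : d * d = k / (q1 ^ 2 + q2 ^ 2)) by (apply sqrt_sqrt; left; apply Rdiv_lt_0_compat; lra).
  assert (Hd2' : d * d * (q1 ^ 2 + q2 ^ 2) = k) by (rewrite Hd2; field; lra).
  assert (Hd : d <> 0) by (intros E; rewrite E in Hd2'; lra).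
  assert (Er : r = (RtoC (- (d * d)) * (q1, (- q2)%R))%C).
  { assert (X : ((q1, q2) * r)%C = ((q1, q2) * (RtoC (- (d * d)) * (q1, (- q2)%R)))%C).
    { rewrite Eqr, <- Hd2'. apply C_ext; simpl; ring. }
    replace r with (/ (q1, q2) * ((q1, q2) * r))%C by (field; exact Hq).
    rewrite X. field. exact Hq. }
  set (Dg := mkM2 (RtoC d) 0%C 0%C 1%C).
  assert (HDg : M2det Dg <> 0%C).
  { unfold M2det, Dg; simpl. replace (RtoC d * 1 - 0 * 0)%C with (RtoC d) by ring. intros E. apply Hd, (f_equal fst E). }
  exists (M2mul Dg P). split; [apply M2det_mul_neq_0; assumption|].
  rewrite !M2conj_mul, EA, EB by assumption. split.
  - replace (M2conj Dg _) with (mkM2 (x, w) 0%C (- Cconj 0)%C (Cconj (x, w))).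
    + apply unitary_su2_form. simpl. lra.
    + symmetry. apply M2conj_of_eigen; [exact HDg|].
      apply M2_ext; unfold M2mul, Dg; apply C_ext; simpl; ring.
  - replace (M2conj Dg _) with (mkM2 (y, p2) (RtoC d * (q1, q2))%C (- Cconj (RtoC d * (q1, q2)))%C (Cconj (y, p2))).
    + apply unitary_su2_form. simpl. replace ((d * q1 - 0 * q2)) with (d * q1) by ring.
      unfold k in Hd2'. nra.
    + symmetry. apply M2conj_of_eigen; [exact HDg|]. rewrite Er.
      apply M2_ext; unfold M2mul, Dg; apply C_ext; simpl; ring.
Qed.

Lemma unitary_mul U V : unitary U -> unitary V -> unitary (M2mul U V).
Proof.
  unfold unitary. intros HU HV.
  assert (E : M2adj (M2mul U V) = M2mul (M2adj V) (M2adj U)).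
  { unfold M2adj, M2mul; simpl. apply M2_ext; simpl; rewrite Cplus_conj, !Cmult_conj; ring. }
  rewrite E, M2mul_assoc, <- (M2mul_assoc U), HV, M2mul_1_r. exact HU.
Qed.

(** The third matrix is the product of the first two, so nondegeneracy and unitarizability of the
    triple reduce to those of the pair. *)
Lemma trinoid_unitarizable_iff P T1 T2 x y z :
  M2det P <> 0%C -> M2det T1 = 1%C -> M2det T2 = 1%C ->
  M2tr T1 = RtoC (2 * x) -> M2tr T2 = RtoC (2 * y) -> M2tr (M2mul T1 T2) = RtoC (2 * z) ->
  x ^ 2 <= 1 -> y ^ 2 <= 1 ->
  (nondegenerate (M2conj P T1) (M2conj P T2) (M2conj P (M2mul T1 T2)) /\
   simult_unitarizable (M2conj P T1) (M2conj P T2) (M2conj P (M2mul T1 T2)))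
  <-> 0 < gram x y z.
Proof.
  intros HP D1 D2 E1 E2 E3 Hx Hy. rewrite M2conj_prod by assumption.
  set (A := M2conj P T1). set (B := M2conj P T2).
  assert (DA : M2det A = 1%C) by (unfold A; rewrite M2conj_det; assumption).
  assert (DB : M2det B = 1%C) by (unfold B; rewrite M2conj_det; assumption).
  assert (TA : M2tr A = RtoC (2 * x)) by (unfold A; rewrite M2conj_tr; assumption).
  assert (TB : M2tr B = RtoC (2 * y)) by (unfold B; rewrite M2conj_tr; assumption).
  assert (TAB : M2tr (M2mul A B) = RtoC (2 * z))
    by (unfold A, B; rewrite <- M2conj_prod, M2conj_tr; assumption).
  split.
  - intros [ND (Q & HQ & UA & UB & _)].
    assert (NC : M2mul A B <> M2mul B A).
    { intros E. destruct ND as [N|[N|N]]; apply N; [exact E| |].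
      - rewrite <- M2mul_assoc, E. reflexivity.
      - rewrite M2mul_assoc, E. reflexivity. }
    fold (M2conj Q A) in UA. fold (M2conj Q B) in UB.
    apply (gram_pos_of_unitary (M2conj Q A) (M2conj Q B)); auto;
      rewrite <- ?M2conj_prod by assumption; rewrite ?M2conj_det, ?M2conj_tr by assumption; auto.
    intros E. apply NC. apply (M2conj_inj Q); [exact HQ|]. exact E.
  - intros HD. split.
    + left. intros E. pose proof (gram_zero_of_commute A B x y z DA DB TA TB TAB E). lra.
    + destruct (unitarize_pair A B x y z) as (Q & HQ & UA & UB); auto.
      exists Q. repeat split; auto.
      change (unitary (M2conj Q (M2mul A B))). rewrite M2conj_prod by assumption. apply unitary_mul; assumption.
Qed.

(** * The inequalities *)

(** It factors as (cos(2a - 2b) - cos 2c) (cos 2c - cos(2a + 2b)); each factor is a product of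
    sines. *)
Lemma gram_trig a b c : gram (cos (2 * a)) (cos (2 * b)) (cos (2 * c)) =
  4 * sin (a + b + c) * sin (- a + b + c) * sin (a - b + c) * sin (a + b - c).
Proof.
  assert (E : gram (cos (2 * a)) (cos (2 * b)) (cos (2 * c)) =
    (cos (2 * a - 2 * b) - cos (2 * c)) * (cos (2 * c) - cos (2 * a + 2 * b))).
  { rewrite cos_minus, cos_plus. unfold gram.
    pose proof (sin2_cos2 (2 * a)) as Ha. pose proof (sin2_cos2 (2 * b)) as Hb. unfold Rsqr in *.
    set (x := cos (2 * a)) in *. set (y := cos (2 * b)) in *.
    set (u := sin (2 * a)) in *. set (v := sin (2 * b)) in *. set (z := cos (2 * c)) in *.
    replace ((x * y + u * v - z) * (z - (x * y - u * v))) with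
      ((u * u) * (v * v) - (z - x * y) ^ 2) by ring.
    replace (u * u) with (1 - x * x) by lra. replace (v * v) with (1 - y * y) by lra. ring. }
  rewrite E, !form2.
  replace ((2 * a - 2 * b - 2 * c) / 2) with (- (- a + b + c)) by field.
  replace ((2 * a - 2 * b + 2 * c) / 2) with (a - b + c) by field.
  replace ((2 * c - (2 * a + 2 * b)) / 2) with (- (a + b - c)) by field.
  replace ((2 * c + (2 * a + 2 * b)) / 2) with (a + b + c) by field.
  rewrite !sin_neg. ring.
Qed.

(** * The exponents as functions of s *)

Definition nu (w s : R) : R := (1 - sqrt (1 - s * w)) / 2.
Definition abs_nu (w s : R) : R := Rabs (nu w s).

Lemma nu_eq w s : w < 1 -> 0 <= s <= 1 -> nu w s * (nu w s - 1) = - (s * w) / 4.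
Proof.
  intros Hw Hs. unfold nu. assert (H : sqrt (1 - s * w) * sqrt (1 - s * w) = 1 - s * w)
    by (apply sqrt_sqrt; nra). lra.
Qed.

(** Replaces the square root by a quadratic relation, m - m^2 = s |w| / 4 or m + m^2 = s |w| / 4
    according to the sign of w; the later estimates work from these. *)
Lemma abs_nu_spec w s : w < 1 -> w <> 0 -> 0 <= s <= 1 -> 0 <= abs_nu w s /\
  ((0 < w /\ Rabs w = w /\ abs_nu w s < 1/2 /\ abs_nu w s - abs_nu w s ^ 2 = s * w / 4) \/
   (w < 0 /\ Rabs w = - w /\ abs_nu w s + abs_nu w s ^ 2 = s * (- w) / 4)).
Proof.
  intros Hw Hw0 Hs. split; [apply Rabs_pos|]. unfold abs_nu, nu.
  assert (Hp : 0 < 1 - s * w) by nra.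
  pose proof (sqrt_sqrt (1 - s * w) ltac:(lra)) as Hq. pose proof (sqrt_lt_R0 _ Hp).
  set (q := sqrt (1 - s * w)) in *.
  destruct (Rlt_le_dec 0 w) as [H1|H1]; [left|right].
  - assert (q <= 1) by nra. rewrite (Rabs_pos_eq w), Rabs_pos_eq by lra. repeat split; lra.
  - assert (1 <= q) by nra. rewrite (Rabs_left w) by lra. rewrite Rabs_left1 by lra. repeat split; lra.
Qed.

Lemma abs_nu_pos w s : w < 1 -> w <> 0 -> 0 < s <= 1 -> 0 < abs_nu w s.
Proof.
  intros Hw Hw0 Hs. destruct (abs_nu_spec w s Hw Hw0 ltac:(lra)) as [H0 H].
  destruct (Req_dec (abs_nu w s) 0) as [E|]; [|lra]. rewrite E in H.
  destruct H as [H|H]; nra.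
Qed.

Lemma abs_nu_lt w s s' : w < 1 -> w <> 0 -> 0 <= s < s' -> s' <= 1 -> abs_nu w s < abs_nu w s'.
Proof.
  intros Hw Hw0 Hs Hs'. destruct (abs_nu_spec w s Hw Hw0 ltac:(lra)) as [H0 H].
  destruct (abs_nu_spec w s' Hw Hw0 ltac:(lra)) as [H0' H'].
  set (a := abs_nu w s) in *. set (b := abs_nu w s') in *.
  destruct H as [H|H], H' as [H'|H']; try lra.
  - assert (s * w < s' * w) by nra.
    destruct (Rlt_le_dec a b); [assumption|exfalso].
    assert ((a - b) * (1 - a - b) < 0) by nra. nra.
  - assert (s * - w < s' * - w) by nra.
    destruct (Rlt_le_dec a b); [assumption|exfalso]. nra.
Qed.

Lemma abs_nu_continuous w s : continuous (abs_nu w) s.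
Proof.
  unfold abs_nu, nu. apply (continuous_comp (fun s => (1 - sqrt (1 - s * w)) / 2) Rabs); [|apply continuous_Rabs].
  unfold Rdiv. apply (continuous_mult (K := R_AbsRing)); [|apply continuous_const].
  apply (continuous_minus (V := R_NormedModule)); [apply continuous_const|].
  apply (continuous_comp (fun s => 1 - s * w) sqrt); [|apply continuous_sqrt].
  apply (continuous_minus (V := R_NormedModule)); [apply continuous_const|].
  apply (continuous_mult (K := R_AbsRing)); [apply continuous_id|apply continuous_const].
Qed.

Lemma abs_nu_0 w : abs_nu w 0 = 0.
Proof. unfold abs_nu, nu. rewrite Rmult_0_l, Rminus_0_r, sqrt_1, Rminus_diag. unfold Rdiv. rewrite Rmult_0_l. apply Rabs_R0. Qed.

Lemma abs_nu_1 w : abs_nu w 1 = Rabs (nW w).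
Proof. unfold abs_nu, nu, nW. rewrite Rmult_1_l. reflexivity. Qed.

Lemma abs_nu_small w s : w < 1 -> w <> 0 -> 0 <= s <= 1 -> abs_nu w s <= s * Rabs w.
Proof.
  intros Hw Hw0 Hs. destruct (abs_nu_spec w s Hw Hw0 Hs) as [H0 H].
  destruct H as [(H1 & E & H2 & H3)|(H1 & E & H2)]; rewrite E; nra.
Qed.

Definition trinoid_gram (w1 w2 w3 s : R) : R :=
  gram (cos (2 * PI * nu w1 s)) (cos (2 * PI * nu w2 s)) (cos (2 * PI * nu w3 s)).

Lemma cos_abs_mult a x : cos (a * x) = cos (a * Rabs x).
Proof.
  unfold Rabs. destruct (Rcase_abs x); [|reflexivity].
  replace (a * - x) with (- (a * x)) by ring. now rewrite cos_neg.
Qed.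

Lemma trinoid_gram_sin w1 w2 w3 s : trinoid_gram w1 w2 w3 s =
  4 * sin (PI * (abs_nu w1 s + abs_nu w2 s + abs_nu w3 s)) * sin (PI * (- abs_nu w1 s + abs_nu w2 s + abs_nu w3 s)) *
  sin (PI * (abs_nu w1 s - abs_nu w2 s + abs_nu w3 s)) * sin (PI * (abs_nu w1 s + abs_nu w2 s - abs_nu w3 s)).
Proof.
  unfold trinoid_gram. rewrite (cos_abs_mult _ (nu w1 s)), (cos_abs_mult _ (nu w2 s)), (cos_abs_mult _ (nu w3 s)).
  fold (abs_nu w1 s) (abs_nu w2 s) (abs_nu w3 s). rewrite !Rmult_assoc, gram_trig.
  rewrite !Rmult_plus_distr_l, !Rmult_minus_distr_l, !Rmult_plus_distr_l, Ropp_mult_distr_r. ring.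
Qed.

Lemma gram_swap12 x y z : gram x y z = gram y x z.
Proof. unfold gram. ring. Qed.

Lemma gram_swap13 x y z : gram x y z = gram z y x.
Proof. unfold gram. ring. Qed.

Lemma sin_PI_pos x : 0 < x < 1 -> 0 < sin (PI * x).
Proof. intros H. pose proof PI_RGT_0. apply sin_gt_0; nra. Qed.

Lemma sin_PI_nonneg x : 0 <= x <= 1 -> 0 <= sin (PI * x).
Proof. intros H. pose proof PI_RGT_0. apply sin_ge_0; nra. Qed.

Lemma sin_PI_neg x : -1 < x < 0 -> sin (PI * x) < 0.
Proof.
  intros H. replace (PI * x) with (- (PI * - x)) by ring. rewrite sin_neg.
  pose proof (sin_PI_pos (- x) ltac:(lra)). lra.
Qed.

Lemma trinoid_gram_pos w1 w2 w3 s :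
  abs_nu w1 s < abs_nu w2 s + abs_nu w3 s -> abs_nu w2 s < abs_nu w1 s + abs_nu w3 s -> abs_nu w3 s < abs_nu w1 s + abs_nu w2 s ->
  abs_nu w1 s + abs_nu w2 s + abs_nu w3 s < 1 -> 0 < trinoid_gram w1 w2 w3 s.
Proof.
  intros H1 H2 H3 H4. rewrite trinoid_gram_sin.
  pose proof (Rabs_pos (nu w1 s)). pose proof (Rabs_pos (nu w2 s)). pose proof (Rabs_pos (nu w3 s)).
  unfold abs_nu in *.
  repeat apply Rmult_lt_0_compat; try lra; apply sin_PI_pos; lra.
Qed.

(** Exactly one of the four sines is negative. *)
Lemma trinoid_gram_neg w1 w2 w3 s : w2 < 1 -> w3 < 1 -> w2 <> 0 -> w3 <> 0 -> 0 < s <= 1 ->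
  abs_nu w2 s + abs_nu w3 s < abs_nu w1 s -> abs_nu w1 s + abs_nu w2 s + abs_nu w3 s < 1 -> trinoid_gram w1 w2 w3 s < 0.
Proof.
  intros A2 A3 B2 B3 Hs H1 H2. rewrite trinoid_gram_sin.
  pose proof (abs_nu_pos w2 s A2 B2 Hs). pose proof (abs_nu_pos w3 s A3 B3 Hs).
  pose proof (sin_PI_pos (abs_nu w1 s + abs_nu w2 s + abs_nu w3 s) ltac:(lra)) as S1.
  pose proof (sin_PI_neg (- abs_nu w1 s + abs_nu w2 s + abs_nu w3 s) ltac:(lra)) as S2.
  pose proof (sin_PI_pos (abs_nu w1 s - abs_nu w2 s + abs_nu w3 s) ltac:(lra)) as S3.
  pose proof (sin_PI_pos (abs_nu w1 s + abs_nu w2 s - abs_nu w3 s) ltac:(lra)) as S4.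
  set (p := sin _) in S1 |- *. set (q := sin _) in S2 |- *. set (r := sin _) in S3 |- *. set (t := sin _) in S4 |- *.
  assert (0 < 4 * p * (- q) * r * t) by (repeat apply Rmult_lt_0_compat; lra). lra.
Qed.

Lemma trinoid_gram_nonpos w1 w2 w3 s : 1 < abs_nu w1 s + abs_nu w2 s + abs_nu w3 s < 2 ->
  0 <= - abs_nu w1 s + abs_nu w2 s + abs_nu w3 s <= 1 -> 0 <= abs_nu w1 s - abs_nu w2 s + abs_nu w3 s <= 1 ->
  0 <= abs_nu w1 s + abs_nu w2 s - abs_nu w3 s <= 1 -> trinoid_gram w1 w2 w3 s <= 0.
Proof.
  intros H1 H2 H3 H4. rewrite trinoid_gram_sin.
  assert (S1 : sin (PI * (abs_nu w1 s + abs_nu w2 s + abs_nu w3 s)) < 0).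
  { pose proof PI_RGT_0. apply sin_lt_0; nra. }
  pose proof (sin_PI_nonneg _ H2) as S2. pose proof (sin_PI_nonneg _ H3) as S3. pose proof (sin_PI_nonneg _ H4) as S4.
  set (p := sin _) in S1 |- *. set (q := sin _) in S2 |- *. set (r := sin _) in S3 |- *. set (t := sin _) in S4 |- *.
  assert (0 <= 4 * (- p) * q * r * t) by (repeat apply Rmult_le_pos; lra). lra.
Qed.

(* For w1 < 0 the identity abs_nu + abs_nu^2 = s |w| / 4 makes the triangle inequality for |w| force the one for abs_nu. *)
Lemma triangle_of_neg w1 w2 w3 s : w1 < 0 -> w2 < 1 -> w3 < 1 -> w2 <> 0 -> w3 <> 0 -> 0 < s <= 1 ->
  Rabs w1 <= Rabs w2 + Rabs w3 -> abs_nu w1 s < abs_nu w2 s + abs_nu w3 s.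
Proof.
  intros H1 A2 A3 B2 B3 Hs HW.
  destruct (abs_nu_spec w1 s ltac:(lra) ltac:(lra) ltac:(lra)) as [P1 [Q1|Q1]]; [lra|].
  pose proof (abs_nu_pos w2 s A2 B2 Hs) as P2. pose proof (abs_nu_pos w3 s A3 B3 Hs) as P3.
  assert (Q2 : s * Rabs w2 / 4 <= abs_nu w2 s + abs_nu w2 s ^ 2).
  { destruct (abs_nu_spec w2 s A2 B2 ltac:(lra)) as [_ [(_ & E & _ & Q)|(_ & E & Q)]]; rewrite E; nra. }
  assert (Q3 : s * Rabs w3 / 4 <= abs_nu w3 s + abs_nu w3 s ^ 2).
  { destruct (abs_nu_spec w3 s A3 B3 ltac:(lra)) as [_ [(_ & E & _ & Q)|(_ & E & Q)]]; rewrite E; nra. }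
  destruct Q1 as (_ & E1 & Q1). rewrite E1 in HW.
  destruct (Rlt_le_dec (abs_nu w1 s) (abs_nu w2 s + abs_nu w3 s)) as [|HH]; [assumption|exfalso].
  assert (s * (- w1) / 4 <= s * Rabs w2 / 4 + s * Rabs w3 / 4) by nra.
  assert (0 < abs_nu w2 s * abs_nu w3 s) by nra. nra.
Qed.

(** As a function of s vanishing at 0, [abs_nu] is strictly convex for w > 0 and strictly concave
    for w < 0. *)
Lemma abs_nu_scaling w s : w < 1 -> w <> 0 -> 0 < s < 1 ->
  (0 < w -> s * (abs_nu w 1 - abs_nu w 1 ^ 2) = abs_nu w s - abs_nu w s ^ 2 /\ abs_nu w s < s * abs_nu w 1 /\ abs_nu w 1 < 1/2) /\
  (w < 0 -> s * abs_nu w 1 < abs_nu w s).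
Proof.
  intros Hw Hw0 Hs.
  destruct (abs_nu_spec w s Hw Hw0 ltac:(lra)) as [P H]. destruct (abs_nu_spec w 1 Hw Hw0 ltac:(lra)) as [P' H'].
  pose proof (abs_nu_lt w s 1 Hw Hw0 ltac:(lra) ltac:(lra)) as L. pose proof (abs_nu_pos w s Hw Hw0 ltac:(lra)) as Q.
  set (a := abs_nu w s) in *. set (b := abs_nu w 1) in *. split; intros Hsg.
  - destruct H as [(_ & _ & H1 & H2)|]; [|lra]. destruct H' as [(_ & _ & H1' & H2')|]; [|lra].
    assert (E : s * (b - b ^ 2) = a - a ^ 2) by nra. repeat split; auto.
    apply (Rmult_lt_reg_r (1 - b)); [lra|]. nra.
  - destruct H as [|(_ & _ & H1)]; [lra|]. destruct H' as [|(_ & _ & H1')]; [lra|].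
    assert (E : s * (b + b ^ 2) = a + a ^ 2) by nra.
    apply (Rmult_lt_reg_r (1 + b)); [lra|]. nra.
Qed.

(** For w1 < 0 the inequality of the |w| decides. For w1 > 0 the one at s = 1 is carried down to s,
    and the argument depends on how many of w2, w3 share the convexity of w1. *)
Lemma triangle_strict w1 w2 w3 s :
  w1 < 1 -> w2 < 1 -> w3 < 1 -> w1 <> 0 -> w2 <> 0 -> w3 <> 0 -> 0 < s < 1 ->
  abs_nu w1 1 + abs_nu w2 1 + abs_nu w3 1 <= 1 -> abs_nu w1 1 <= abs_nu w2 1 + abs_nu w3 1 ->
  Rabs w1 <= Rabs w2 + Rabs w3 -> abs_nu w1 s < abs_nu w2 s + abs_nu w3 s.
Proof.
  intros A1 A2 A3 B1 B2 B3 Hs HS HT HW.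
  destruct (Rlt_le_dec w1 0) as [Hw1|Hw1]; [apply triangle_of_neg; auto; lra|].
  destruct (Rlt_le_dec (abs_nu w1 s) (abs_nu w2 s + abs_nu w3 s)) as [|HH]; [assumption|exfalso].
  destruct (abs_nu_scaling w1 s A1 B1 Hs) as [F1 _]. destruct (F1 ltac:(lra)) as (E1 & L1 & U1). clear F1.
  destruct (abs_nu_scaling w2 s A2 B2 Hs) as [F2 G2]. destruct (abs_nu_scaling w3 s A3 B3 Hs) as [F3 G3].
  pose proof (abs_nu_pos w2 s A2 B2 ltac:(lra)) as P2. pose proof (abs_nu_pos w3 s A3 B3 ltac:(lra)) as P3.
  pose proof (abs_nu_lt w1 s 1 A1 B1 ltac:(lra) ltac:(lra)) as M1.
  pose proof (abs_nu_lt w2 s 1 A2 B2 ltac:(lra) ltac:(lra)) as M2.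
  pose proof (abs_nu_lt w3 s 1 A3 B3 ltac:(lra) ltac:(lra)) as M3.
  set (a1 := abs_nu w1 s) in *. set (a2 := abs_nu w2 s) in *. set (a3 := abs_nu w3 s) in *.
  set (b1 := abs_nu w1 1) in *. set (b2 := abs_nu w2 1) in *. set (b3 := abs_nu w3 1) in *.
  (* Here a, b belong to the positive partner and c, d to the negative one. Subtracting quadratic
     relations gives s (b1 - b) (1 - b1 - b) = (a1 - a) (1 - a1 - a), and 1 - a1 - a > 1 - b1 - b
     yields s (b1 - b) > a1 - a >= c > s d >= s (b1 - b). *)
  assert (mixed : forall a b c d, 0 < a -> a < b -> b < 1/2 -> s * (b - b ^ 2) = a - a ^ 2 -> s * d < c ->
     a + c <= a1 -> 0 < c -> b1 <= b + d -> False).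
  { intros a b c d Ha Hab Hb E Hd Hc Hc0 Hbd.
    assert (X : s * (b1 - b) * (1 - b1 - b) = (a1 - a) * (1 - a1 - a)) by lra.
    assert (Y : (a1 - a) * (1 - a1 - a) > (a1 - a) * (1 - b1 - b)) by (apply Rmult_lt_compat_l; lra).
    assert (s * (b1 - b) > a1 - a).
    { apply (Rmult_lt_reg_r (1 - b1 - b)); [lra|]. lra. }
    assert (s * (b1 - b) <= s * d) by (apply Rmult_le_compat_l; lra). lra. }
  destruct (Rlt_le_dec w2 0) as [S2|S2], (Rlt_le_dec w3 0) as [S3|S3].
  - specialize (G2 S2). specialize (G3 S3).
    assert (s * b1 <= s * (b2 + b3)) by (apply Rmult_le_compat_l; lra). lra.
  - specialize (G2 S2). destruct (F3 ltac:(lra)) as (E3 & L3 & U3).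
    apply (mixed a3 b3 a2 b2); lra.
  - specialize (G3 S3). destruct (F2 ltac:(lra)) as (E2 & L2 & U2).
    apply (mixed a2 b2 a3 b3); lra.
  - destruct (F2 ltac:(lra)) as (E2 & L2 & U2). destruct (F3 ltac:(lra)) as (E3 & L3 & U3).
    (* With f(m) = m - m^2, adding f(a1) >= f(a2 + a3) to s f(b2 + b3) >= s f(b1) leaves a2 a3 >= s
       b2 b3, which convexity excludes. *)
    assert (Q : a2 * a3 < s * b2 * (s * b3)) by (apply Rmult_le_0_lt_compat; lra).
    assert (Q' : a2 * a3 < s * (b2 * b3)).
    { assert (0 < b2 * b3) by (apply Rmult_lt_0_compat; lra).
      assert (0 < s * (b2 * b3)) by (apply Rmult_lt_0_compat; lra).
      assert (s * (s * (b2 * b3)) <= 1 * (s * (b2 * b3))) by (apply Rmult_le_compat_r; lra). lra. }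
    assert (Z2 : 0 <= (a1 - (a2 + a3)) * (1 - a1 - (a2 + a3))) by (apply Rmult_le_pos; lra).
    assert (Z3 : 0 <= s * ((b2 + b3 - b1) * (1 - b1 - (b2 + b3)))) by (repeat apply Rmult_le_pos; lra).
    lra.
Qed.

Lemma trinoid_gram_of_ineqs w1 w2 w3 s :
  w1 < 1 -> w2 < 1 -> w3 < 1 -> w1 <> 0 -> w2 <> 0 -> w3 <> 0 -> 0 < s < 1 ->
  trinoid_ineqs w1 w2 w3 -> 0 < trinoid_gram w1 w2 w3 s.
Proof.
  intros A1 A2 A3 B1 B2 B3 Hs H. unfold trinoid_ineqs in H. rewrite <- !abs_nu_1 in H.
  destruct H as (H0 & H1 & H2 & H3 & K1 & K2 & K3).
  apply trinoid_gram_pos.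
  - apply triangle_strict; auto; lra.
  - apply triangle_strict; auto; lra.
  - apply triangle_strict; auto; lra.
  - pose proof (abs_nu_lt w1 s 1 A1 B1 ltac:(lra) ltac:(lra)).
    pose proof (abs_nu_lt w2 s 1 A2 B2 ltac:(lra) ltac:(lra)).
    pose proof (abs_nu_lt w3 s 1 A3 B3 ltac:(lra) ltac:(lra)). lra.
Qed.

(** * From positivity on a dense set to the inequalities *)

Lemma neg_nearby (f : R -> R) s0 : continuous f s0 -> f s0 < 0 ->
  exists d, 0 < d /\ forall s, Rabs (s - s0) < d -> f s < 0.
Proof.
  intros Hc H. destruct (Hc (fun y => y < 0)) as [d Hd].
  - apply (open_lt 0). exact H.
  - exists d. split; [apply cond_pos|]. intros s Hs. apply Hd. exact Hs.
Qed.

Definition gram_pos_dense (w1 w2 w3 : R) : Prop :=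
  forall a b, 0 <= a < b -> b <= 1 -> exists s, a < s < b /\ 0 < trinoid_gram w1 w2 w3 s.

Lemma gram_pos_dense_swap12 w1 w2 w3 : gram_pos_dense w1 w2 w3 -> gram_pos_dense w2 w1 w3.
Proof.
  intros H a b Hab Hb. destruct (H a b Hab Hb) as [s [Hs Hp]]. exists s. split; auto.
  unfold trinoid_gram in *. rewrite gram_swap12. exact Hp.
Qed.

Lemma gram_pos_dense_swap13 w1 w2 w3 : gram_pos_dense w1 w2 w3 -> gram_pos_dense w3 w2 w1.
Proof.
  intros H a b Hab Hb. destruct (H a b Hab Hb) as [s [Hs Hp]]. exists s. split; auto.
  unfold trinoid_gram in *. rewrite gram_swap13. exact Hp.
Qed.

(** A strict violation persists just below s0, where the sine product is then negative. Only s < s0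
    is used, so that s0 = 1 is allowed. *)
Lemma no_violation w1 w2 w3 s0 : w2 < 1 -> w3 < 1 -> w2 <> 0 -> w3 <> 0 -> gram_pos_dense w1 w2 w3 ->
  0 < s0 <= 1 -> abs_nu w1 s0 + abs_nu w2 s0 + abs_nu w3 s0 < 1 -> abs_nu w1 s0 <= abs_nu w2 s0 + abs_nu w3 s0.
Proof.
  intros A2 A3 B2 B3 HG Hs0 HS.
  destruct (Rle_lt_dec (abs_nu w1 s0) (abs_nu w2 s0 + abs_nu w3 s0)) as [|Hv]; [assumption|exfalso].
  destruct (neg_nearby (fun s => abs_nu w2 s + abs_nu w3 s - abs_nu w1 s) s0) as (d1 & Hd1 & N1).
  { apply (continuous_minus (V := R_NormedModule)); [apply (continuous_plus (V := R_NormedModule))|]; apply abs_nu_continuous. }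
  { lra. }
  destruct (neg_nearby (fun s => abs_nu w1 s + abs_nu w2 s + abs_nu w3 s - 1) s0) as (d2 & Hd2 & N2).
  { apply (continuous_minus (V := R_NormedModule)); [|apply continuous_const].
    apply (continuous_plus (V := R_NormedModule)); [apply (continuous_plus (V := R_NormedModule))|]; apply abs_nu_continuous. }
  { lra. }
  set (a := Rmax 0 (Rmax (s0 - d1) (s0 - d2))).
  assert (Ha : 0 <= a < s0).
  { unfold a. split; [apply Rmax_l|]. repeat apply Rmax_lub_lt; lra. }
  assert (Ha1 : s0 - d1 <= a) by (unfold a; eapply Rle_trans; [apply Rmax_l|apply Rmax_r]).
  assert (Ha2 : s0 - d2 <= a) by (unfold a; eapply Rle_trans; [apply Rmax_r|apply Rmax_r]).
  destruct (HG a s0 Ha ltac:(lra)) as (s & Hs & Hp).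
  specialize (N1 s ltac:(rewrite Rabs_left; lra)). specialize (N2 s ltac:(rewrite Rabs_left; lra)).
  pose proof (trinoid_gram_neg w1 w2 w3 s A2 A3 B2 B3 ltac:(lra) ltac:(lra) ltac:(lra)). lra.
Qed.

(** For small s, [abs_nu w s] is s |w| / 4 up to (s |w|)^2, so a violation for the |w| would show up
    in the exponents. *)
Lemma w_triangle w1 w2 w3 : w1 < 1 -> w2 < 1 -> w3 < 1 -> w1 <> 0 -> w2 <> 0 -> w3 <> 0 ->
  gram_pos_dense w1 w2 w3 -> Rabs w1 <= Rabs w2 + Rabs w3.
Proof.
  intros A1 A2 A3 B1 B2 B3 HG.
  destruct (Rle_lt_dec (Rabs w1) (Rabs w2 + Rabs w3)) as [|Hv]; [assumption|exfalso].
  set (dl := Rabs w1 - Rabs w2 - Rabs w3). set (S := Rabs w1 + Rabs w2 + Rabs w3).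
  pose proof (Rabs_pos w1). pose proof (Rabs_pos w2). pose proof (Rabs_pos w3).
  assert (HS : 0 < S) by (unfold S; lra).
  assert (Hdl : 0 < dl <= S) by (unfold dl, S; lra).
  (* Small enough that the quadratic errors, at most s^2 S^2 together, stay below the linear gap s
     dl / 4, and that the three exponents add up to less than 1. *)
  set (s := dl / (8 * (S + 1) ^ 2)).
  assert (HS2 : 0 < 8 * (S + 1) ^ 2) by (assert (0 < (S + 1) ^ 2) by (apply pow_lt; lra); lra).
  assert (Es : s * (8 * (S + 1) ^ 2) = dl) by (unfold s; field; lra).
  assert (Hs0 : 0 < s) by (apply Rdiv_lt_0_compat; lra).
  assert (Hs1 : s * (8 * (S + 1)) <= 1).
  { apply (Rmult_le_reg_r (S + 1)); [lra|]. lra. }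
  assert (Hs2 : s <= 1) by nra.
  pose proof (abs_nu_small w1 s A1 B1 ltac:(lra)) as U1.
  pose proof (abs_nu_small w2 s A2 B2 ltac:(lra)) as U2.
  pose proof (abs_nu_small w3 s A3 B3 ltac:(lra)) as U3.
  assert (sq : forall w, w < 1 -> w <> 0 -> abs_nu w s <= s * Rabs w ->
     s * Rabs w / 4 - (s * Rabs w) ^ 2 <= abs_nu w s <= s * Rabs w / 4 + (s * Rabs w) ^ 2).
  { intros w Aw Bw U. destruct (abs_nu_spec w s Aw Bw ltac:(lra)) as [P [(_ & E & _ & Q)|(_ & E & Q)]];
      rewrite E in *; nra. }
  pose proof (sq w1 A1 B1 U1). pose proof (sq w2 A2 B2 U2). pose proof (sq w3 A3 B3 U3).
  assert (Hsum : abs_nu w1 s + abs_nu w2 s + abs_nu w3 s < 1) by (unfold S in Hs1; nra).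
  pose proof (no_violation w1 w2 w3 s A2 A3 B2 B3 HG ltac:(lra) Hsum) as NV.
  assert (C1 : (s * Rabs w1) ^ 2 + (s * Rabs w2) ^ 2 + (s * Rabs w3) ^ 2 <= s * (s * S ^ 2)).
  { replace (s * (s * S ^ 2)) with (s ^ 2 * S ^ 2) by ring. rewrite !Rpow_mult_distr.
    assert (Rabs w1 ^ 2 + Rabs w2 ^ 2 + Rabs w3 ^ 2 <= S ^ 2) by (unfold S; nra).
    assert (0 <= s ^ 2) by apply pow2_ge_0. nra. }
  assert (C2 : s * S ^ 2 < dl / 4).
  { assert (s * S ^ 2 <= s * (S + 1) ^ 2) by (apply Rmult_le_compat_l; nra). lra. }
  assert (C3 : s * (s * S ^ 2) < s * (dl / 4)) by (apply Rmult_lt_compat_l; lra).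
  unfold dl in C3. lra.
Qed.

(** For w1 > 0 the exponent is below 1/2, so a violation would force the sum below 1, where
    [no_violation] applies. *)
Lemma n_triangle w1 w2 w3 s : w1 < 1 -> w2 < 1 -> w3 < 1 -> w1 <> 0 -> w2 <> 0 -> w3 <> 0 ->
  gram_pos_dense w1 w2 w3 -> 0 < s <= 1 -> abs_nu w1 s <= abs_nu w2 s + abs_nu w3 s.
Proof.
  intros A1 A2 A3 B1 B2 B3 HG Hs.
  destruct (Rlt_le_dec w1 0) as [H|H].
  - left. apply triangle_of_neg; auto. apply w_triangle; auto.
  - destruct (Rle_lt_dec (abs_nu w1 s) (abs_nu w2 s + abs_nu w3 s)) as [|Hv]; [assumption|].
    apply no_violation; auto.
    destruct (abs_nu_spec w1 s A1 B1 ltac:(lra)) as [_ [Q|Q]]; lra.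
Qed.

(** If the sum exceeded 1 at s = 1, it would cross 1 at some s1 < 1; just after s1 the sine of the
    sum is negative and the other three are nonnegative. *)
Lemma n_sum w1 w2 w3 : w1 < 1 -> w2 < 1 -> w3 < 1 -> w1 <> 0 -> w2 <> 0 -> w3 <> 0 ->
  gram_pos_dense w1 w2 w3 -> abs_nu w1 1 + abs_nu w2 1 + abs_nu w3 1 <= 1.
Proof.
  intros A1 A2 A3 B1 B2 B3 HG.
  destruct (Rle_lt_dec (abs_nu w1 1 + abs_nu w2 1 + abs_nu w3 1) 1) as [|Hv]; [assumption|exfalso].
  set (f := fun s => abs_nu w1 s + abs_nu w2 s + abs_nu w3 s).
  assert (Cf : forall s, continuous f s).
  { intros s. apply (continuous_plus (V := R_NormedModule)); [apply (continuous_plus (V := R_NormedModule))|]; apply abs_nu_continuous. }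
  assert (F0 : f 0 = 0) by (unfold f; rewrite !abs_nu_0; ring).
  destruct (IVT_gen f 0 1 1) as (s1 & Hs1 & E1).
  { intros s. apply continuity_pt_filterlim, Cf. }
  { rewrite F0. fold (f 1) in Hv. rewrite Rmin_left, Rmax_right by lra. lra. }
  rewrite Rmin_left, Rmax_right in Hs1 by lra.
  assert (Hs1' : 0 < s1 < 1).
  { split.
    - destruct (Req_dec s1 0) as [E|]; [|lra]. rewrite E, F0 in E1. lra.
    - destruct (Req_dec s1 1) as [E|]; [|lra]. rewrite E in E1. unfold f in E1. lra. }
  pose proof (abs_nu_pos w1 s1 A1 B1 ltac:(lra)) as P1. pose proof (abs_nu_pos w2 s1 A2 B2 ltac:(lra)) as P2.
  pose proof (abs_nu_pos w3 s1 A3 B3 ltac:(lra)) as P3.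
  (* While the sum stays below 1 + 2 k, subtracting twice any exponent, each larger than k, leaves
     less than 1. *)
  set (k := Rmin (abs_nu w1 s1) (Rmin (abs_nu w2 s1) (abs_nu w3 s1))).
  assert (K0 : 0 < k) by (unfold k; repeat apply Rmin_glb_lt; lra).
  assert (K1 : k <= abs_nu w1 s1) by apply Rmin_l.
  assert (K2 : k <= abs_nu w2 s1) by (eapply Rle_trans; [apply Rmin_r|apply Rmin_l]).
  assert (K3 : k <= abs_nu w3 s1) by (eapply Rle_trans; [apply Rmin_r|apply Rmin_r]).
  destruct (neg_nearby (fun s => f s - (1 + 2 * k)) s1) as (d & Hd & N).
  { apply (continuous_minus (V := R_NormedModule)); [apply Cf|apply continuous_const]. }
  { lra. }
  destruct (HG s1 (Rmin 1 (s1 + d))) as (s & Hs & Hp).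
  { split; [lra|]. apply Rmin_glb_lt; lra. }
  { apply Rmin_l. }
  assert (s < 1) by (eapply Rlt_le_trans; [apply Hs|apply Rmin_l]).
  assert (s < s1 + d) by (eapply Rlt_le_trans; [apply Hs|apply Rmin_r]).
  specialize (N s ltac:(rewrite Rabs_pos_eq; lra)).
  pose proof (abs_nu_lt w1 s1 s A1 B1 ltac:(lra) ltac:(lra)).
  pose proof (abs_nu_lt w2 s1 s A2 B2 ltac:(lra) ltac:(lra)).
  pose proof (abs_nu_lt w3 s1 s A3 B3 ltac:(lra) ltac:(lra)).
  pose proof (n_triangle w1 w2 w3 s A1 A2 A3 B1 B2 B3 HG ltac:(lra)) as T1.
  pose proof (n_triangle w2 w1 w3 s A2 A1 A3 B2 B1 B3 (gram_pos_dense_swap12 _ _ _ HG) ltac:(lra)) as T2.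
  pose proof (n_triangle w3 w2 w1 s A3 A2 A1 B3 B2 B1 (gram_pos_dense_swap13 _ _ _ HG) ltac:(lra)) as T3.
  unfold f in *.
  pose proof (trinoid_gram_nonpos w1 w2 w3 s ltac:(lra) ltac:(lra) ltac:(lra) ltac:(lra)). lra.
Qed.

Lemma ineqs_of_gram_pos_dense w1 w2 w3 : w1 < 1 -> w2 < 1 -> w3 < 1 -> w1 <> 0 -> w2 <> 0 -> w3 <> 0 ->
  gram_pos_dense w1 w2 w3 -> trinoid_ineqs w1 w2 w3.
Proof.
  intros A1 A2 A3 B1 B2 B3 HG. unfold trinoid_ineqs. rewrite <- !abs_nu_1.
  pose proof (gram_pos_dense_swap12 _ _ _ HG) as HG2. pose proof (gram_pos_dense_swap13 _ _ _ HG) as HG3.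
  pose proof (n_triangle w1 w2 w3 1 A1 A2 A3 B1 B2 B3 HG ltac:(lra)).
  pose proof (n_triangle w2 w1 w3 1 A2 A1 A3 B2 B1 B3 HG2 ltac:(lra)).
  pose proof (n_triangle w3 w2 w1 1 A3 A2 A1 B3 B2 B1 HG3 ltac:(lra)).
  pose proof (w_triangle w1 w2 w3 A1 A2 A3 B1 B2 B3 HG).
  pose proof (w_triangle w2 w1 w3 A2 A1 A3 B2 B1 B3 HG2).
  pose proof (w_triangle w3 w2 w1 A3 A2 A1 B3 B2 B1 HG3).
  pose proof (n_sum w1 w2 w3 A1 A2 A3 B1 B2 B3 HG).
  repeat split; lra.
Qed.

(** * The monodromy of the trinoid potential *)

Definition is_center (c : C) : Prop := c = ctr0 \/ c = ctr1 \/ c = ctrInf.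

Lemma circ_avoids c t : is_center c -> circ c (v_of c) t <> 0%C /\ (circ c (v_of c) t - 1)%C <> 0%C.
Proof.
  intros Hc.
  assert (avoid : forall a : C, Cmod (v_of c) ^ 2 <> Cmod (a - c)%C ^ 2 -> (circ c (v_of c) t - a)%C <> 0%C).
  { intros a Ha E. apply Ha. f_equal. rewrite <- (Rmult_1_r (Cmod (v_of c))), <- (Cmod_Cexpi (2 * PI * t)), <- Cmod_mult.
    f_equal. replace (v_of c * Cexpi (2 * PI * t))%C with (circ c (v_of c) t - a + (a - c))%C by (unfold circ; ring).
    rewrite E. ring. }
  split.
  - replace (circ c (v_of c) t) with (circ c (v_of c) t - 0)%C by ring. apply avoid.
    rewrite !Cmod_sq. unfold v_of, z0. destruct Hc as [->|[->| ->]]; simpl; lra.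
  - apply avoid. rewrite !Cmod_sq. unfold v_of, z0. destruct Hc as [->|[->| ->]]; simpl; lra.
Qed.

Definition spar (lam : C) : R := (1 - fst lam) / 2.

(** Since 1 = lam conj(lam), (lam - 1)^2 = lam (lam + conj(lam) - 2). *)
Lemma spar_eq lam : Cmod lam = 1 -> ((lam - 1) * (lam - 1))%C = (RtoC (- 4 * spar lam) * lam)%C.
Proof.
  intros H. assert (E : fst lam ^ 2 + snd lam ^ 2 = 1) by (rewrite <- Cmod_sq, H; ring).
  unfold spar. destruct lam as [x y]. simpl in *. apply C_ext; simpl; lra.
Qed.

Lemma unit_neq_0 lam : Cmod lam = 1 -> lam <> 0%C.
Proof. intros H E. rewrite E, Cmod_0 in H. lra. Qed.

Definition residue (w s : R) : C := RtoC (- (s * w) / 4).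

(** Partial fractions: the numerator of [QW] is w1 (z - 1)^2 + w2 z^2 + (w3 - w1 - w2) z (z - 1). *)
Lemma qpot_QW w1 w2 w3 (lam z : C) : Cmod lam = 1 -> z <> 0%C -> (z - 1)%C <> 0%C ->
  (((lam - 1) * (lam - 1) * QW w1 w2 w3 z) / lam)%C =
  qpot (residue w1 (spar lam)) (residue w2 (spar lam)) (residue (w3 - w1 - w2) (spar lam)) z.
Proof.
  intros Hl Hz Hz1. rewrite (spar_eq lam Hl). unfold qpot, residue, QW.
  set (s := spar lam).
  unfold Rdiv. rewrite !RtoC_mult, !RtoC_inv, !RtoC_opp, !RtoC_mult, !RtoC_minus, !RtoC_plus, !RtoC_minus by lra.
  replace (RtoC 16) with (RtoC 4 * RtoC 4)%C by (rewrite <- RtoC_mult; f_equal; lra).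
  replace (RtoC (-4)) with (- RtoC 4)%C by (rewrite <- RtoC_opp; f_equal; lra).
  assert (H4 : RtoC 4 <> 0%C) by (intros E; apply (f_equal fst) in E; simpl in E; lra).
  pose proof (unit_neq_0 lam Hl). field. repeat split; assumption.
Qed.

Definition scaling (lam : C) : M2 := mkM2 (/ lam)%C 0%C 0%C 1%C.

Lemma scaling_det (lam : C) : lam <> 0%C -> M2det (scaling lam) <> 0%C.
Proof.
  intros H. unfold M2det, scaling; simpl. replace (/ lam * 1 - 0 * 0)%C with (/ lam)%C by ring.
  intros E. apply C1_nz. replace (RtoC 1) with (lam * / lam)%C by (field; exact H). rewrite E. ring.
Qed.

(** The conjugating matrix P depends only on the initial value and lam, hence is common to the three
    loops. *)
Lemma transport_of_solves_along w1 w2 w3 lam c Y : Cmod lam = 1 -> is_center c ->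
  solves_along w1 w2 w3 lam c Y -> M2det (Y 0) <> 0%C ->
  let P := M2mul (Y 0) (scaling lam) in
  let T := fun t => M2mul (M2inv P) (M2mul (Y t) (scaling lam)) in
  M2det P <> 0%C /\
  transport (residue w1 (spar lam)) (residue w2 (spar lam)) (residue (w3 - w1 - w2) (spar lam))
    (circ c (v_of c)) (dcirc (v_of c)) T /\
  M2mul (Y 1) (M2inv (Y 0)) = M2conj P (T 1).
Proof.
  intros Hl Hc HY HD P T. pose proof (unit_neq_0 lam Hl) as Hl0.
  pose proof (scaling_det lam Hl0) as HS.
  assert (HP : M2det P <> 0%C) by (apply M2det_mul_neq_0; assumption).
  split; [exact HP|]. split; [split|].
  - apply M2mul_inv_l, HP.
  - intros t _. destruct (circ_avoids c t Hc) as [Z0 Z1].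
    rewrite <- (qpot_QW w1 w2 w3 lam _ Hl Z0 Z1).
    destruct (HY t) as (H1 & H2 & H3 & H4).
    apply Cd_of_is_derive in H1, H2, H3, H4. simpl in H1, H2, H3, H4.
    unfold T. set (J := M2inv P). clearbody J. unfold M2mul, scaling; simpl.
    split; [|split; [|split]]; (eapply Cd_eq;
      [apply Cd_plus; (apply Cd_mult; [apply Cd_const|];
        apply Cd_plus; (apply Cd_mult; [eassumption|apply Cd_const]))|cbv beta; field; exact Hl0]).
  - unfold T, M2conj. rewrite !M2mul_assoc, M2mul_inv_r, M2mul_1_l by exact HP.
    unfold P. rewrite M2inv_mul, M2mul_assoc by assumption.
    rewrite <- (M2mul_assoc (Y 1)), M2mul_inv_r, M2mul_1_r by assumption. reflexivity.
Qed.

Lemma spar_range lam : Cmod lam = 1 -> 0 <= spar lam <= 1.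
Proof.
  intros H. pose proof (fst_le_Cmod lam) as F. rewrite H in F. apply Rabs_le_between in F.
  unfold spar. lra.
Qed.

Lemma residue_nu w s : w < 1 -> 0 <= s <= 1 -> residue w s = (RtoC (nu w s) * (RtoC (nu w s) - 1))%C.
Proof. intros Hw Hs. unfold residue. rewrite <- nu_eq, RtoC_mult, RtoC_minus by assumption. reflexivity. Qed.

Lemma cos_sq_le a : cos a ^ 2 <= 1.
Proof. pose proof (COS_bound a). nra. Qed.

Lemma monodromy_criterion w1 w2 w3 lam Y1 Y2 Y3 (F : M2) :
  w1 < 1 -> w2 < 1 -> w3 < 1 -> Cmod lam = 1 -> M2det F <> 0%C ->
  solves_along w1 w2 w3 lam ctr0 Y1 -> Y1 0 = F ->
  solves_along w1 w2 w3 lam ctr1 Y2 -> Y2 0 = F ->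
  solves_along w1 w2 w3 lam ctrInf Y3 -> Y3 0 = F ->
  (nondegenerate (M2mul (Y1 1) (M2inv F)) (M2mul (Y2 1) (M2inv F)) (M2mul (Y3 1) (M2inv F)) /\
   simult_unitarizable (M2mul (Y1 1) (M2inv F)) (M2mul (Y2 1) (M2inv F)) (M2mul (Y3 1) (M2inv F)))
  <-> 0 < trinoid_gram w1 w2 w3 (spar lam).
Proof.
  intros A1 A2 A3 Hl HF S1 I1 S2 I2 S3 I3. pose proof (spar_range lam Hl) as Hs.
  destruct (transport_of_solves_along w1 w2 w3 lam ctr0 Y1 Hl ltac:(unfold is_center; auto) S1) as (HP & T1 & E1);
    [now rewrite I1|].
  destruct (transport_of_solves_along w1 w2 w3 lam ctr1 Y2 Hl ltac:(unfold is_center; auto) S2) as (_ & T2 & E2);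
    [now rewrite I2|].
  destruct (transport_of_solves_along w1 w2 w3 lam ctrInf Y3 Hl ltac:(unfold is_center; auto) S3) as (_ & T3 & E3);
    [now rewrite I3|].
  rewrite I1 in HP, T1, E1. rewrite I2 in T2, E2. rewrite I3 in T3, E3.
  rewrite E1, E2, E3. rewrite (monodromy_product _ _ _ _ _ _ T1 T2 T3).
  apply trinoid_unitarizable_iff; auto using cos_sq_le.
  - apply (transport_det _ _ _ _ _ _ T1); lra.
  - apply (transport_det _ _ _ _ _ _ T2); lra.
  - apply (trace_at_0 _ _ _ (nu w1 (spar lam)) _ (residue_nu _ _ A1 Hs) T1).
  - apply (trace_at_1 _ _ _ (nu w2 (spar lam)) _ (residue_nu _ _ A2 Hs) T2).
  - rewrite <- (monodromy_product _ _ _ _ _ _ T1 T2 T3).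
    apply (trace_at_inf _ _ _ (nu w3 (spar lam)) _) in T3; [exact T3|].
    (* The three coefficients add up to the residue for w3, so infinity has the same indicial
       equation as 0 and 1. *)
    rewrite <- (residue_nu w3 (spar lam) A3 Hs). unfold residue. rewrite <- !RtoC_plus. f_equal. field.
Qed.

Lemma avoid_list (l : list R) : forall a b, a < b -> exists s, a < s < b /\ ~ In s l.
Proof.
  induction l as [|x l IH]; intros a b Hab.
  - exists ((a + b) / 2). split; [lra|]. intros [].
  - destruct (Rle_dec x ((a + b) / 2)).
    + destruct (IH ((a + b) / 2) b ltac:(lra)) as (s & Hs & Hn). exists s. split; [lra|].
      intros [E|E]; [lra|auto].
    + destruct (IH a ((a + b) / 2) ltac:(lra)) as (s & Hs & Hn). exists s. split; [lra|].
      intros [E|E]; [lra|auto].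
Qed.

Theorem mainTheorem4 (w1 w2 w3 : R)
  (hw1 : w1 < 1) (hw2 : w2 < 1) (hw3 : w3 < 1)
  (hw1' : w1 <> 0) (hw2' : w2 <> 0) (hw3' : w3 <> 0)
  (Phi0 : C -> M2) (Y1 Y2 Y3 : C -> R -> M2)
  (hPhi_holo : holo_Cstar Phi0)
  (hPhi_inv : forall lam : C, lam <> 0%C -> M2det (Phi0 lam) <> 0%C)
  (hY1 : forall lam : C, lam <> 0%C ->
           solves_along w1 w2 w3 lam ctr0 (Y1 lam) /\ Y1 lam 0 = Phi0 lam)
  (hY2 : forall lam : C, lam <> 0%C ->
           solves_along w1 w2 w3 lam ctr1 (Y2 lam) /\ Y2 lam 0 = Phi0 lam)
  (hY3 : forall lam : C, lam <> 0%C ->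
           solves_along w1 w2 w3 lam ctrInf (Y3 lam) /\ Y3 lam 0 = Phi0 lam) :
  let M1 := fun lam => M2mul (Y1 lam 1) (M2inv (Phi0 lam)) in
  let M2' := fun lam => M2mul (Y2 lam 1) (M2inv (Phi0 lam)) in
  let M3 := fun lam => M2mul (Y3 lam 1) (M2inv (Phi0 lam)) in
  trinoid_ineqs w1 w2 w3 <->
  exists S : list C, (forall s, In s S -> Cmod s = 1) /\
    forall lam : C, Cmod lam = 1 -> ~ In lam S ->
      nondegenerate (M1 lam) (M2' lam) (M3 lam) /\
      simult_unitarizable (M1 lam) (M2' lam) (M3 lam).
Proof.
  intros M1 M2' M3.
  assert (crit : forall lam, Cmod lam = 1 ->
    (nondegenerate (M1 lam) (M2' lam) (M3 lam) /\ simult_unitarizable (M1 lam) (M2' lam) (M3 lam))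
    <-> 0 < trinoid_gram w1 w2 w3 (spar lam)).
  { intros lam Hl. pose proof (unit_neq_0 lam Hl) as Hl0.
    destruct (hY1 lam Hl0), (hY2 lam Hl0), (hY3 lam Hl0). apply monodromy_criterion; auto. }
  split.
  - intros Hin. exists (RtoC 1 :: RtoC (-1) :: nil). split.
    + intros s [<-|[<-|[]]]; rewrite Cmod_R; [rewrite Rabs_pos_eq|rewrite Rabs_left]; lra.
    + intros lam Hl Hn. apply crit; [exact Hl|]. apply trinoid_gram_of_ineqs; auto.
      pose proof (spar_range lam Hl) as Hr.
      assert (E : fst lam ^ 2 + snd lam ^ 2 = 1) by (rewrite <- Cmod_sq, Hl; ring).
      assert (ends : forall x, (x = 1 \/ x = -1) -> fst lam = x -> lam = RtoC x).
      { intros x Hx Ex. apply C_ext; simpl; [exact Ex|]. rewrite Ex in E. destruct Hx; subst x; nra. }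
      unfold spar in *. split.
      * destruct (Req_dec (fst lam) 1) as [E1|]; [|lra]. exfalso. apply Hn. left. symmetry. auto.
      * destruct (Req_dec (fst lam) (-1)) as [E1|]; [|lra]. exfalso. apply Hn. right; left. symmetry. auto.
  - intros (S & _ & HS). apply ineqs_of_gram_pos_dense; auto. intros a b Hab Hb.
    (* The image of S under [spar] is a finite set of reals, and every s in [0, 1] comes from a
       point of the upper half circle with real part 1 - 2 s. *)
    destruct (avoid_list (map spar S) a b ltac:(lra)) as (s & Hs & Hn).
    exists s. split; [exact Hs|].
    set (lam := (1 - 2 * s, sqrt (1 - (1 - 2 * s) ^ 2)) : C).
    assert (Es : spar lam = s) by (unfold spar, lam; simpl; field).
    assert (Hl : Cmod lam = 1).
    { assert (Q : Cmod lam ^ 2 = 1).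
      { rewrite Cmod_sq. unfold lam; simpl fst; simpl snd. rewrite pow2_sqrt; [ring|nra]. }
      pose proof (Cmod_ge_0 lam). nra. }
    rewrite <- Es. apply crit; [exact Hl|]. apply HS; [exact Hl|].
    intros Hi. apply Hn. rewrite <- Es. apply in_map, Hi.
Qed.
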